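(* Let $q\ge0$. Let $2\le p\le\infty$ and let $\beta$ satisfy $0\le\beta\le1$ if $p=2$ and $0\le\beta<\frac{p+2}{2p}$ if $2<p\le\infty$ (i.e. $0\le \beta<1/2$ when $p=\infty$). Then there is a constant $C>0$ such that for every $\phi\in\mathcal S'(\mathbb R)$ with $\phi,\partial_\xi\phi\in L^2_\xi(\mathbb R)$ and $\phi(0)=0$, and every $t>0$, $$(e^{-itH_q}\mathcal F_q^{-1}\phi)(x)=t^{-1/2}\phi\!\left(\tfrac xt\right)e^{\frac{ix^2}{2t}-\frac{i\pi}4}+R(t,x),$$ where $R$ satisfies $$\|R(t)\|_{L^p_x}\le C\,t^{-\frac12+\frac1p-\frac\beta2}\left(\|\phi\|_{L^2_\xi}+\|\partial_\xi\phi\|_{L^2_\xi}\right).$$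
   Context: The operator $H_q=-\frac12\frac{d^2}{dx^2}+q\delta$ ($\delta$ the Dirac measure at $0$) is the self-adjoint operator on $L^2(\mathbb R)$ with domain $D(H_q)=\{u\in H^1(\mathbb R)\cap H^2(\mathbb R\setminus\{0\}):\ u'(0+)-u'(0-)=2q\,u(0)\}$ and action $H_qu=-\frac12u''$ on $\mathbb R\setminus\{0\}$; $e^{-itH_q}$ is the unitary group it generates. Put $t_q(\xi)=\frac{i\xi}{i\xi-q}$ and $r_q(\xi)=\frac{q}{i\xi-q}$ (so $r_0= 0$, $t_0= 1$), and $$f_+(x,\xi)=\begin{cases}e^{ix\xi}&x\ge0,\\ \frac1{t_q(\xi)}e^{ix\xi}+\frac{r_q(\xi)}{t_q(\xi)}e^{-ix\xi}&x<0,\end{cases}\qquad f_-(x,\xi)=\begin{cases}\frac1{t_q(\xi)}e^{-ix\xi}+\frac{r_q(\xi)}{t_q(\xi)}e^{ix\xi}&x\ge0,\\ e^{-ix\xi}&x<0,\end{cases}$$ $$\Psi(x,\xi)=\begin{cases}t_q(\xi)f_+(x,\xi)&\xi\ge0,\\ t_q(-\xi)f_-(x,-\xi)&\xi<0.\end{cases}$$ The distorted Fourier transform and its inverse are the $L^2$ operators $$\mathcal F_q[\phi](\xi)=\frac1{\sqrt{2\pi}}\int_{-\infty}^\infty\Psi(y,-\xi)\phi(y)\,dy,\qquad \mathcal F_q^{-1}[\phi](x)=\frac1{\sqrt{2\pi}}\int_{-\infty}^\infty\overline{\Psi(x,-\xi)}\,\phi(\xi)\,d\xi$$ (integrals of $L^2$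 functions understood, as for the usual Fourier transform, by extension by density). Since $\phi\in H^1(\mathbb R)$, $\phi$ is identified with its continuous representative, so that $\phi(0)$ makes sense. The constant $C$ may depend on $q,p,\beta$ but not on $\phi$ or $t$. *)

(* Defs.v *)
From HB Require Import structures.
From mathcomp Require Import all_boot all_order all_algebra.
From mathcomp Require Import complex.
From mathcomp Require Import all_classical all_reals all_analysis.

Set Implicit Arguments.
Unset Strict Implicit.
Unset Printing Implicit Defensive.

Import Order.TTheory GRing.Theory Num.Theory.
Import numFieldNormedType.Exports.

Local Open Scope classical_set_scope.
Local Open Scope ring_scope.
Local Open Scope complex_scope.

(* The complex numbers are [R[i]], from mathcomp-real-closed. Elements of
   L^2(R), L^p(R) are represented by functions [R -> R[i]] and compared up to
   equality almost everywhere for the Lebesgue measure. The topology of the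
   complex plane is that of [R[i]^o]. *)

Section ComplexFunctions.
Context {R : realType}.
Local Notation mu := (@lebesgue_measure R).
Implicit Types (u v : R -> R[i]) (D : set R).

Definition expi (x : R) : R[i] := cos x +i* sin x.

Definition cmeasurable u : Prop :=
  measurable_fun setT (fun x => complex.Re (u x)) /\
  measurable_fun setT (fun x => complex.Im (u x)).

Definition cintegrable u : Prop :=
  mu.-integrable setT (fun x => (complex.Re (u x))%:E) /\
  mu.-integrable setT (fun x => (complex.Im (u x))%:E).

Definition cintegral u : R[i] :=
  Rintegral mu setT (fun x => complex.Re (u x)) +i*
  Rintegral mu setT (fun x => complex.Im (u x)).

Definition Lpnorm (p : \bar R) u : \bar R :=
  Lnorm mu p (fun x => (ComplexField.Normc.normc (u x))%:E).

Definition L2 u : Prop := cmeasurable u /\ (Lpnorm 2%:E u < +oo)%E.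

Definition test_function D (eta : R -> R) : Prop :=
  [/\ forall n x, derivable (derive1n n eta) x 1,
      compact (closure [set x | eta x != 0]) &
      closure [set x | eta x != 0] `<=` D].

(* [v] is the distributional derivative of [u] on the open set [D]; real test
   functions suffice since both sides are complex linear in [eta]. *)
Definition weak_derivative D u v : Prop :=
  forall eta, test_function D eta ->
    cintegral (fun x => u x * (derive1 eta x)%:C) =
    - cintegral (fun x => v x * (eta x)%:C).

End ComplexFunctions.

Section DeltaHamiltonian.
Context {R : realType}.
Local Notation mu := (@lebesgue_measure R).
Implicit Types (u v : R -> R[i]).

(* [u] is in D(H_q) and [v] is H_q u: [u1] and [u2] are the first and second
   derivatives of [u], and [w], [w1] are the representatives of [u], [u1]
   continuous on R and on R \ {0}, through which u(0), u'(0+) and u'(0-) are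
   defined. *)
Definition delta_hamiltonian (q : R) u v : Prop :=
  exists u1 u2 : R -> R[i],
    [/\ [/\ L2 u, L2 u1 & weak_derivative setT u u1],
        L2 u2 /\ weak_derivative (~` [set 0]) u1 u2,
        exists (w w1 : R -> R[i]^o) (dp dm : R[i]^o),
          [/\ continuous w /\ u = w %[ae mu],
              {in ~` [set 0], continuous w1} /\ u1 = w1 %[ae mu],
              w1 x @[x --> 0^'+] --> dp,
              w1 x @[x --> 0^'-] --> dm &
              dp - dm = (2 * q)%:C * w 0] &
        v = (fun x => - 2^-1 * u2 x) %[ae mu]].

(* [U t] is e^{-itH} for the self-adjoint operator with graph [H] (Stone): a
   strongly continuous unitary group on L^2(R) with generator -iH. Values of
   [U t] outside L^2 are irrelevant; unitarity is isometry plus the group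
   law, which makes each [U t] invertible. *)
Definition unitary_group_of (H : (R -> R[i]) -> (R -> R[i]) -> Prop)
    (U : R -> (R -> R[i]) -> (R -> R[i])) : Prop :=
  [/\ [/\ forall t u, L2 u -> L2 (U t u),
          forall t u v, L2 u -> L2 v -> u = v %[ae mu] ->
            U t u = U t v %[ae mu],
          forall t (a : R[i]) u v, L2 u -> L2 v ->
            U t (fun x => a * u x + v x) =
            (fun x => a * U t u x + U t v x) %[ae mu] &
          forall t u, L2 u -> Lpnorm 2%:E (U t u) = Lpnorm 2%:E u],
      (forall u, L2 u -> U 0 u = u %[ae mu]) /\
      (forall s t u, L2 u -> U (s + t) u = U s (U t u) %[ae mu]),
      forall u, L2 u ->
        Lpnorm 2%:E (fun x => U h u x - u x) @[h --> (0 : R)] --> 0%E &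
      forall u v, L2 u -> L2 v ->
        (H u v <->
         Lpnorm 2%:E (fun x => (U h u x - u x) / h%:C - (- 'i%C * v x))
           @[h --> (0 : R)^'] --> 0%E)].

End DeltaHamiltonian.

Section DistortedFourier.
Context {R : realType}.
Local Notation mu := (@lebesgue_measure R).
Variable q : R.
Implicit Types (x xi : R).

(* The case distinction gives t_0 = 1 also at xi = 0. When q <> 0 the
   formulas below divide by t_q 0 = 0 at xi = 0; this value is only used
   inside integrals over xi, where a single point does not matter. *)
Definition tq xi : R[i] :=
  if q == 0 then 1 else ('i%C * xi%:C) / ('i%C * xi%:C - q%:C).

Definition rq xi : R[i] := q%:C / ('i%C * xi%:C - q%:C).

Definition fplus x xi : R[i] :=
  if 0 <= x then expi (x * xi)
  else (tq xi)^-1 * expi (x * xi) + rq xi / tq xi * expi (- (x * xi)).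

Definition fminus x xi : R[i] :=
  if 0 <= x then
    (tq xi)^-1 * expi (- (x * xi)) + rq xi / tq xi * expi (x * xi)
  else expi (- (x * xi)).

Definition Psi x xi : R[i] :=
  if 0 <= xi then tq xi * fplus x xi else tq (- xi) * fminus x (- xi).

Definition distorted_ift_integral (phi : R -> R[i]) (x : R) : R[i] :=
  ((Num.sqrt (2 * pi))^-1)%:C *
  cintegral (fun xi => conjc (Psi x (- xi)) * phi xi).

(* [g] is the inverse distorted Fourier transform of [phi] in L^2: the
   extension by density (closure of the graph) of the integral operator on
   L^1 `&` L^2. *)
Definition distorted_ift (phi g : R -> R[i]) : Prop :=
  [/\ L2 phi, L2 g &
      exists phi_ : nat -> R -> R[i],
        [/\ forall n, L2 (phi_ n) /\ cintegrable (phi_ n),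
            Lpnorm 2%:E (fun xi => phi_ n xi - phi xi) @[n --> \oo] --> 0%E &
            Lpnorm 2%:E (fun x => distorted_ift_integral (phi_ n) x - g x)
              @[n --> \oo] --> 0%E]].

End DistortedFourier.

Section Exponents.
Context {R : realType}.

(* (p + 2) / (2 p), with value 1/2 at p = +oo, where [p^-1 = 0]. *)
Definition admissible_exponents (p : \bar R) (beta : R) : Prop :=
  [/\ (2%:E <= p)%E, 0 <= beta &
      match p with
      | r%:E => if r == 2 then beta <= 1 else beta < (r + 2) / (2 * r)
      | _ => beta < 2^-1
      end].

Definition decay_exponent (p : \bar R) (beta : R) : R :=
  - 2^-1 + fine (p^-1)%E - beta / 2.

End Exponents.

(* Main.v *)
(** Since [conj Psi(x,-xi) = e^{i x xi} + rho(xi) e^{-i |x xi|}] with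
    [rho(xi) = (- q^2 + i q |xi|) / (q^2 + xi^2)], the inverse distorted transform
    is [F phi(x) + F h(-|x|)], where [F] is the Fourier integral and [h] is
    [rho(xi) (phi(xi) + phi(-xi))] on [xi > 0] and 0 elsewhere. As [phi 0 = 0],
    [h] is again in H^1 and [h(-|x|/t) = 0].

    For truncated [phi], [w(t) = F_q^{-1} (e^{-i t xi^2/2} phi)] lies in the domain
    of [H_q], the jump condition being [- i xi rho = q (1 + rho)], and the distance
    from [w(t)] to [e^{-itH_q} w(0)] has derivative 0, so it vanishes.

    It remains to study the integrals of [e^{-i (t xi - x)^2 / (2 t)} f(xi)] for
    [f] in H^1. Integrating by parts on both sides of [x / t], against primitives
    of the Fresnel kernels that vanish at infinity, gives the main term and an
    error linear in [f'], the same for the profile [h]. This error is bounded in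
    L^2 by the norm of [f'] and by [t^{1/2}] times that of [f], and uniformly by
    the H^1 norm of [f] and by [t^{-1/4}] times the norm of [f']. Interpolation
    between L^2 and L^oo, and truncation removed by Fatou's lemma, conclude. *)

Require Import Defs.
From HB Require Import structures.
From mathcomp Require Import all_boot all_order all_algebra.
From mathcomp Require Import complex ring lra.
From mathcomp Require Import all_classical all_reals all_analysis.
From mathcomp Require Import measurable_realfun.

Set Implicit Arguments.
Unset Strict Implicit.
Unset Printing Implicit Defensive.

Import Order.TTheory GRing.Theory Num.Theory.
Import numFieldNormedType.Exports.

Local Open Scope classical_set_scope.
Local Open Scope ring_scope.
Local Open Scope complex_scope.

(** * Real integrals and square-integrable functions *)

(** The obstacle is that the Fresnel tail [k] decays only like [1 / s]: it is square integrable but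
    not integrable, so Schur's test just fails for the error term, and a bound in L^2 by the norm of
    [f'] is not direct. A second integration by parts replaces [k] by a primitive [m] of order
    [1 / s^2], at the price of a derivative of [f']. Averaging [f] over a window of length
    [t^(-1/2)] makes that derivative available, and what the averaging removes is small in L^2,
    where Plancherel applies. Likewise, Cauchy-Schwarz against [k] gives the uniform rate
    [t^(-1/4)], which is too weak as [t] tends to 0; there a neighbourhood of the stationary point
    is integrated back by parts. The threshold [1/2 + 1/p] for [beta] is what interpolation between
    the rates [t^(-1/2)] in L^2 and [t^(-3/4)] in the uniform norm yields for large [t]. All
    estimates are carried out on real and imaginary parts, as bounds on squared norms. *)

Section RealIntegrals.
Context {R : realType}.
Local Notation mu := (@lebesgue_measure R).
Local Notation L1 f := (mu.-integrable setT (EFin \o f)).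
Implicit Types (f g h : R -> R) (a b c : R).

Lemma measurable_affine a b : measurable_fun setT (fun x : R => a * x + b).
Proof. by apply: measurable_funD => //; apply: measurable_funM. Qed.

(** Uniqueness of Lebesgue measure: the image of [mu] under the affine map, scaled by [|a|], has the
    right value on half-open intervals. For [a < 0] the preimage is half-open on the other side,
    with the same length. *)
Lemma ge0_integral_affine (f : R -> \bar R) a b : a != 0 ->
  measurable_fun setT f -> (forall x, 0 <= f x)%E ->
  (\int[mu]_x f (a * x + b)%R = (`|a|^-1)%:E * \int[mu]_x f x)%E.
Proof.
move=> a0 mf f0.
have a0' : 0 < `|a| by rewrite normr_gt0.
pose T := fun x : measurableTypeR R => a * x + b : measurableTypeR R.
have mT : measurable_fun setT T by exact: measurable_affine.
have nna : 0 <= `|a| by [].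
pose nu : {measure set _ -> \bar R} := mscale (NngNum nna)
  (measure_function_pushforward__canonical__measure_function_Measure mu mT).
have E A : measurable A -> mu A = nu A.
  apply: lebesgue_measure_unique => _ [[u v] _ <-] /=.
  rewrite /mscale/= /pushforward.
  have ineq x : ((u < a * x + b) && (a * x + b <= v)) = 
      if 0 < a then ((u - b) / a < x <= (v - b) / a)
      else ((v - b) / a <= x < (u - b) / a).
    move: a0; rewrite neq_lt => /orP[ha|ha]; last first.
      by rewrite ha ltr_pdivrMr // ler_pdivlMr // ltrBlDr lerBrDr ![x * a]mulrC.
    rewrite (lt_gtF ha) ltr_ndivlMr // ler_ndivrMr // ltrBlDr lerBrDr.
    by rewrite ![x * a]mulrC andbC.
  rewrite lebesgue_measure_itv /=.
  case: (ltP 0 a) => ha.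
    have -> : T @^-1` `]u, v] = `](u - b) / a, (v - b) / a]%classic.
      apply/seteqP; split => x /=; rewrite !in_itv/= => H.
        by move: H; rewrite ineq ha.
      by rewrite ineq ha.
    rewrite lebesgue_measure_itv /= !lte_fin gtr0_norm //.
    rewrite ltr_pM2r ?invr_gt0 // ltrD2r; case: ifP => _; last by rewrite mule0.
    by rewrite -!EFinB -EFinM; congr EFin; field.
  have ha' : a < 0 by rewrite lt_neqAle a0.
  have -> : T @^-1` `]u, v] = `[(v - b) / a, (u - b) / a[%classic.
    apply/seteqP; split => x /=; rewrite !in_itv/= => H.
      by move: H; rewrite ineq (lt_gtF ha').
    by rewrite ineq (lt_gtF ha').
  rewrite lebesgue_measure_itv /= !lte_fin ltr0_norm //.
  rewrite ltr_nM2r ?invr_lt0 // ltrD2r; case: ifP => _; last by rewrite mule0.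
  by rewrite -!EFinB -EFinM; congr EFin; field.
have -> : (\int[mu]_x f x = \int[nu]_x f x)%E.
  by apply: eq_measure_integral => A mA _; exact: E.
rewrite ge0_integral_mscale //= muleA -EFinM mulVf ?gt_eqF // mul1e.
by rewrite ge0_integral_pushforward // preimage_setT.
Qed.

Lemma Rintegral_affine f a b : a != 0 -> measurable_fun setT f ->
  Rintegral mu setT (fun x => f (a * x + b)) = `|a|^-1 * Rintegral mu setT f.
Proof.
move=> a0 mf; rewrite /Rintegral.
have mf' : measurable_fun setT (EFin \o f) by exact/measurable_EFinP.
rewrite integralE [X in _ = _ * fine X]integralE.
have -> : (\int[mu]_x ((fun x => (f (a * x + b))%:E)^\+ x) =
    (`|a|^-1)%:E * \int[mu]_x ((EFin \o f)^\+ x))%E.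
  rewrite -(ge0_integral_affine b a0 (measurable_funepos mf')); last exact: funepos_ge0.
  by apply: eq_integral => x _; rewrite !funeposE.
have -> : (\int[mu]_x ((fun x => (f (a * x + b))%:E)^\- x) =
    (`|a|^-1)%:E * \int[mu]_x ((EFin \o f)^\- x))%E.
  rewrite -(ge0_integral_affine b a0 (measurable_funeneg mf')); last exact: funeneg_ge0.
  by apply: eq_integral => x _; rewrite !funenegE.
have c0 : 0 < `|a|^-1 by rewrite invr_gt0 normr_gt0.
have cy : ((`|a|^-1)%:E * +oo = +oo)%E by rewrite gt0_muley // lte_fin.
have cNy : ((`|a|^-1)%:E * -oo = -oo)%E by rewrite gt0_muleNy // lte_fin.
move: (`|a|^-1) c0 cy cNy => k c0 cy cNy.
(* Holds also when [P] or [N] is infinite, [fine] being 0 on both sides, so the change of variables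
   covers functions that are not integrable. *)
have key (P N : \bar R) : fine (k%:E * P - k%:E * N)%E = k * fine (P - N)%E.
  by case: P N => [p| |] [n| |]; rewrite ?cy ?cNy /= ?mulr0 // mulrBr.
exact: key.
Qed.

Lemma integrable_affine f a b : a != 0 -> L1 f -> L1 (fun x => f (a * x + b)).
Proof.
move=> a0 /integrableP[/measurable_EFinP mf intf].
apply/integrableP; split.
  by apply/measurable_EFinP; apply: measurableT_comp => //; exact: measurable_affine.
rewrite (@ge0_integral_affine (fun x => `|(f x)%:E|)%E) //.
  by apply: lte_mul_pinfty => //; rewrite lee_fin invr_ge0.
by apply/measurableT_comp => //; exact/measurable_EFinP.
Qed.

End RealIntegrals.

Section RealIntegrals2.
Context {R : realType}.
Local Notation mu := (@lebesgue_measure R).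
Local Notation L1 f := (mu.-integrable setT (EFin \o f)).
Local Notation I f := (Rintegral mu setT f).
Implicit Types (f g h : R -> R) (a b c : R).

Lemma L1_measurable f : L1 f -> measurable_fun setT f.
Proof. by move=> /integrableP[/measurable_EFinP]. Qed.

Lemma L1D f g : L1 f -> L1 g -> L1 (fun x => f x + g x).
Proof.
move=> lf lg; have := integrableD measurableT lf lg.
by apply: eq_integrable => // x _; rewrite /= EFinD.
Qed.

Lemma L1Z c f : L1 f -> L1 (fun x => c * f x).
Proof.
move=> lf; have := integrableZl measurableT c lf.
by apply: eq_integrable => // x _; rewrite /= EFinM.
Qed.

Lemma L1N f : L1 f -> L1 (fun x => - f x).
Proof.
move=> lf; have := L1Z (-1) lf.
by apply: eq_integrable => // x _ /=; rewrite mulN1r.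
Qed.

Lemma L1B f g : L1 f -> L1 g -> L1 (fun x => f x - g x).
Proof. by move=> lf lg; apply: L1D => //; exact: L1N. Qed.

Lemma L1_le f g : measurable_fun setT f -> (forall x, `|f x| <= g x) ->
  L1 g -> L1 f.
Proof.
move=> mf fg lg; apply: le_integrable lg => //; first exact/measurable_EFinP.
move=> x _ /=; rewrite lee_fin; apply: (le_trans (fg x)); exact: ler_norm.
Qed.

Lemma L1_abs f : L1 f -> L1 (fun x => `|f x|).
Proof.
move=> lf; have mf := L1_measurable lf.
have := integrable_abse lf; apply: eq_integrable => // x _.
Qed.

Lemma L1_Ml f g M : L1 f -> measurable_fun setT g ->
  (forall x, `|g x| <= M) -> L1 (fun x => f x * g x).
Proof.
move=> lf mg gM; have mf := L1_measurable lf.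
apply: (L1_le _ _ (L1Z M (L1_abs lf))); first exact: measurable_funM.
by move=> x; rewrite normrM mulrC ler_wpM2r.
Qed.

Lemma I_EFin f : L1 f -> (I f)%:E = (\int[mu]_x (f x)%:E)%E.
Proof. by move=> lf; rewrite /Rintegral fineK //; exact: integrable_fin_num. Qed.

Lemma ID f g : L1 f -> L1 g -> I (fun x => f x + g x) = I f + I g.
Proof. by move=> lf lg; rewrite RintegralD. Qed.

Lemma IZ c f : L1 f -> I (fun x => c * f x) = c * I f.
Proof. by move=> lf; rewrite RintegralZl. Qed.

Lemma IN f : L1 f -> I (fun x => - f x) = - I f.
Proof.
move=> lf; rewrite -mulN1r -IZ //; apply: eq_Rintegral => x _.
by rewrite mulN1r.
Qed.

Lemma IB f g : L1 f -> L1 g -> I (fun x => f x - g x) = I f - I g.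
Proof. by move=> lf lg; rewrite ID ?IN //; exact: L1N. Qed.

Lemma I_norm_le f g : L1 f -> L1 g -> (forall x, `|f x| <= g x) ->
  `|I f| <= I g.
Proof.
move=> lf lg fg; apply: (le_trans (le_normr_Rintegral measurableT lf)).
by apply: le_Rintegral => //; exact: (L1_abs lf).
Qed.

Lemma I_le f g : L1 f -> L1 g -> (forall x, f x <= g x) -> I f <= I g.
Proof. by move=> lf lg fg; apply: le_Rintegral. Qed.

Lemma I_dominated (f_ : nat -> R -> R) f g :
  (forall n, measurable_fun setT (f_ n)) -> measurable_fun setT f ->
  L1 g -> (forall n x, `|f_ n x| <= g x) ->
  (forall x, f_ n x @[n --> \oo] --> f x) -> I (f_ n) @[n --> \oo] --> I f.
Proof.
move=> mf_ mf lg f_g f_f.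
have lf_ n : L1 (f_ n) by exact: L1_le (f_g n) lg.
have fg x : `|f x| <= g x.
  have h : `|f_ n x| @[n --> \oo] --> `|f x| by apply: cvg_norm; exact: f_f.
  rewrite -(cvg_lim _ h) //; apply: limr_le; first exact: cvgP h.
  by apply: nearW => n; exact: f_g.
have lf : L1 f by exact: L1_le fg lg.
have me_ n : measurable_fun setT (EFin \o f_ n) by exact/measurable_EFinP.
have me : measurable_fun setT (EFin \o f) by exact/measurable_EFinP.
have cf : {ae mu, forall x, setT x ->
    (EFin \o f_ n) x @[n --> \oo] --> (EFin \o f) x}.
  by apply: nearW => x _; apply: cvg_EFin; [exact: nearW|exact: f_f].
have bf : {ae mu, forall x n, setT x -> (`|(EFin \o f_ n) x| <= (EFin \o g) x)%E}.
  by apply: nearW => x n _ /=; rewrite lee_fin.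
have [_ _] := @dominated_convergence _ _ _ mu _ measurableT _ _ _ me_ me cf lg bf.
by rewrite -I_EFin // => H; exact: fine_cvg H.
Qed.

(** Tonelli is applied to the positive and negative parts separately, so slices that are not
    integrable are allowed. *)
Lemma measurable_I_param (F : R -> R -> R) :
  measurable_fun setT (fun z : R * R => F z.1 z.2) ->
  measurable_fun setT (fun x => I (F x)).
Proof.
move=> mF; rewrite /Rintegral; apply: (@measurableT_comp _ _ _ _ _ _ fine) => //.
under eq_fun do rewrite integralE.
have mE : measurable_fun setT (fun z : R * R => (F z.1 z.2)%:E).
  exact/measurable_EFinP.
apply: emeasurable_funB.
  have := @measurable_fun_fubini_tonelli_F _ _ _ _ _ mu _ (measurable_funepos mE)
    (fun x => funepos_ge0 _ x).
  apply: eq_measurable_fun => x _; rewrite /fubini_F.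
  by apply: eq_integral => y _; rewrite !funeposE.
have := @measurable_fun_fubini_tonelli_F _ _ _ _ _ mu _ (measurable_funeneg mE)
  (fun x => funeneg_ge0 _ x).
apply: eq_measurable_fun => x _; rewrite /fubini_F.
by apply: eq_integral => y _; rewrite !funenegE.
Qed.

Lemma measurable_comp1 f : measurable_fun setT f ->
  measurable_fun setT (fun z : R * R => f z.1).
Proof. by move=> mf; exact: measurableT_comp. Qed.

Lemma measurable_comp2 f : measurable_fun setT f ->
  measurable_fun setT (fun z : R * R => f z.2).
Proof. by move=> mf; exact: measurableT_comp. Qed.

Lemma measurable_slice1 (F : R -> R -> R) x :
  measurable_fun setT (fun z : R * R => F z.1 z.2) -> measurable_fun setT (F x).
Proof. by move=> mF; apply: (measurableT_comp mF (pair1_measurable x)). Qed.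

Lemma measurable_slice2 (F : R -> R -> R) y :
  measurable_fun setT (fun z : R * R => F z.1 z.2) ->
  measurable_fun setT (fun x => F x y).
Proof. by move=> mF; apply: (measurableT_comp mF (pair2_measurable y)). Qed.

(** The product majorant reduces integrability on the plane to that of its two factors. *)
Lemma I_fubini (F : R -> R -> R) f g :
  measurable_fun setT (fun z : R * R => F z.1 z.2) ->
  L1 f -> L1 g -> (forall x y, `|F x y| <= f x * g y) ->
  I (fun x => I (F x)) = I (fun y => I (fun x => F x y)).
Proof.
move=> mF lf lg Ffg.
have lFx x : L1 (F x).
  by apply: (L1_le (measurable_slice1 _ mF) (Ffg x)); exact: L1Z.
have lFy y : L1 (fun x => F x y).
  apply: (L1_le (measurable_slice2 _ mF) (g := fun x => g y * f x)).
    by move=> x; rewrite mulrC.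
  exact: L1Z.
have mE : measurable_fun setT (fun z : R * R => (F z.1 z.2)%:E).
  exact/measurable_EFinP.
rewrite /Rintegral; congr fine.
under eq_integral do rewrite -/(I _) I_EFin //.
under [in RHS]eq_integral do rewrite -/(I _) I_EFin //.
have := @Fubini _ _ _ _ _ mu mu (fun z : R * R => (F z.1 z.2)%:E).
apply; apply/integrable12ltyP => //=.
have lfg : L1 (fun x => f x * I g).
  by have := L1Z (I g) lf; apply: eq_integrable => // x _ /=; rewrite mulrC.
have /integrableP[_] := lfg.
apply: le_lt_trans; apply: ge0_le_integral => //.
- by move=> x _; apply: integral_ge0.
- have := @measurable_fun_fubini_tonelli_F _ _ _ _ _ mu
    (fun z : R * R => `|(F z.1 z.2)%:E|)%E.
  by apply => //; exact: measurableT_comp.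
- by apply: measurableT_comp => //; apply/measurable_EFinP; exact: L1_measurable lfg.
move=> x _; apply: (@le_trans _ _ (f x * I g)%:E); last first.
  by rewrite lee_fin ler_norm.
rewrite -IZ // I_EFin; last exact: L1Z.
apply: ge0_le_integral => //.
- by apply/measurable_EFinP; apply: measurableT_comp => //; exact: measurable_slice1.
- by apply/measurable_EFinP; exact: L1_measurable (L1Z _ lg).
- by move=> y _ /=; rewrite lee_fin.
Qed.

End RealIntegrals2.

(** * Bounds on squared L^2 norms *)

Section SquareNorm.
Context {R : realType}.
Local Notation mu := (@lebesgue_measure R).
Local Notation L1 f := (mu.-integrable setT (EFin \o f)).
Local Notation I f := (Rintegral mu setT f).
Implicit Types (f g h : R -> R) (a b c A B : R).

(** Squared L^2 norm (see [Lnorm2_sqr]), extended-real so that it can be written before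
    integrability is known. *)
Definition nsq f : \bar R := (\int[mu]_x (f x ^+ 2)%:E)%E.

Lemma nsq_ge0 f : (0 <= nsq f)%E.
Proof. by apply: integral_ge0 => x _; rewrite lee_fin sqr_ge0. Qed.

Lemma measurable_sqE f : measurable_fun setT f ->
  measurable_fun setT (fun x => (f x ^+ 2)%:E).
Proof. by move=> mf; apply/measurable_EFinP; exact: measurable_funX. Qed.
Hint Resolve measurable_sqE : core.

Lemma nsq_le f g : measurable_fun setT f -> measurable_fun setT g ->
  (forall x, `|f x| <= `|g x|) -> (nsq f <= nsq g)%E.
Proof.
move=> mf mg fg; apply: ge0_le_integral => //.
- by move=> x _; rewrite lee_fin sqr_ge0.
- exact: measurable_sqE.
- exact: measurable_sqE.
- move=> x _; rewrite lee_fin -(real_normK (num_real (f x))).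
  by rewrite -(real_normK (num_real (g x))) ler_sqr ?nnegrE.
Qed.

Lemma nsqZ c f : measurable_fun setT f ->
  nsq (fun x => c * f x) = ((c ^+ 2)%:E * nsq f)%E.
Proof.
move=> mf; rewrite /nsq -ge0_integralZl //.
- by apply: eq_integral => x _; rewrite exprMn EFinM.
- exact: measurable_sqE.
- by move=> x _; rewrite lee_fin sqr_ge0.
- by rewrite lee_fin sqr_ge0.
Qed.

Lemma nsqD f g : measurable_fun setT f -> measurable_fun setT g ->
  (nsq (fun x => f x + g x)%R <= 2%:E * nsq f + 2%:E * nsq g)%E.
Proof.
move=> mf mg; rewrite /nsq -!ge0_integralZl //; last first.
- by move=> x _; rewrite lee_fin sqr_ge0.
- exact: measurable_sqE.
- by move=> x _; rewrite lee_fin sqr_ge0.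
- exact: measurable_sqE.
rewrite -ge0_integralD //; last first.
- by apply: emeasurable_funM => //; exact: measurable_sqE.
- by move=> x _; rewrite mule_ge0 // lee_fin sqr_ge0.
- by apply: emeasurable_funM => //; exact: measurable_sqE.
- by move=> x _; rewrite mule_ge0 // lee_fin sqr_ge0.
apply: ge0_le_integral => //.
- by move=> x _; rewrite lee_fin sqr_ge0.
- by apply: measurable_sqE; exact: measurable_funD.
- by apply: emeasurable_funD; apply: emeasurable_funM => //; exact: measurable_sqE.
- move=> x _; rewrite -!EFinM -EFinD lee_fin.
  have := sqr_ge0 (f x - g x); nra.
Qed.

Lemma nsq_affine f a b : a != 0 -> measurable_fun setT f ->
  nsq (fun x => f (a * x + b)) = ((`|a|^-1)%:E * nsq f)%E.
Proof.
move=> a0 mf; rewrite /nsq.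
rewrite -(ge0_integral_affine b a0 (measurable_sqE mf)) // => x.
by rewrite lee_fin sqr_ge0.
Qed.

Lemma Lnorm2_sqr f : (('N[mu]_2[EFin \o f]) `^ 2 = nsq f)%E.
Proof.
rewrite powR_Lnorm //; apply: eq_integral => x _ /=.
by rewrite powR_mulrn // real_normK ?num_real.
Qed.

Lemma Lnorm2_le f A : 0 <= A ->
  ('N[mu]_2[EFin \o f] <= A%:E)%E = (nsq f <= (A ^+ 2)%:E)%E.
Proof.
move=> A0; rewrite -Lnorm2_sqr; have := Lnorm_ge0 mu 2%:E (EFin \o f).
case: ('N[mu]_2[EFin \o f])%E => [r| |] //.
- rewrite lee_fin => r0.
  by rewrite poweR_EFin powR_mulrn // !lee_fin ler_sqr // nnegrE.
- by rewrite poweRyr.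
Qed.

Lemma I_cauchy_schwarz f g A B : 0 <= A -> 0 <= B ->
  measurable_fun setT f -> measurable_fun setT g ->
  (nsq f <= (A ^+ 2)%:E)%E -> (nsq g <= (B ^+ 2)%:E)%E ->
  L1 (fun x => f x * g x) /\ I (fun x => `|f x * g x|) <= A * B.
Proof.
move=> A0 B0 mf mg; rewrite -!Lnorm2_le // => fA gB.
have p2 : 2^-1 + 2^-1 = 1 :> R by lra.
have := @hoelder _ _ _ mu f g 2 2 mf mg ltac:(by []) ltac:(by []) p2.
rewrite Lnorm1 => H.
have {}H : (\int[mu]_x (`|f x * g x|)%:E <= (A * B)%:E)%E.
  apply: (le_trans H); rewrite EFinM; apply: lee_pmul => //; exact: Lnorm_ge0.
have lfg : L1 (fun x => f x * g x).
  apply/integrableP; split; first by apply/measurable_EFinP; exact: measurable_funM.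
  by apply: (le_lt_trans H); rewrite ltry.
split => //; rewrite -lee_fin I_EFin //; exact: (L1_abs lfg).
Qed.

Lemma limn_einf_le (u : nat -> \bar R) (M : \bar R) :
  (\forall n \near \oo, (u n <= M)%E) -> (limn_einf u <= M)%E.
Proof.
move=> uM; rewrite limn_einf_lim; apply: lime_le.
  exact: is_cvg_einfs.
near=> n; apply: (@le_trans _ _ (u n)); last by near: n.
by apply: ereal_inf_lbound; exists n => /=.
Unshelve. all: end_near. Qed.

Lemma nsq_fatou (f_ : nat -> R -> R) f (M : \bar R) :
  (forall n, measurable_fun setT (f_ n)) ->
  (\forall n \near \oo, (nsq (f_ n) <= M)%E) ->
  (forall x, f_ n x @[n --> \oo] --> f x) -> (nsq f <= M)%E.
Proof.
move=> mf_ fM f_f.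
apply: (le_trans _ (limn_einf_le fM)).
have -> : nsq f = (\int[mu]_x limn_einf (fun n => (f_ n x ^+ 2)%:E))%E.
  apply: eq_integral => x _.
  have H : (f_ n x ^+ 2)%:E @[n --> \oo] --> (f x ^+ 2)%:E.
    by apply: cvg_EFin; [exact: nearW|rewrite expr2; apply: cvgM].
  by rewrite (cvg_limn_einf_sup H).
apply: fatou => //.
- by move=> n; exact: measurable_sqE.
- by move=> n x _; rewrite lee_fin sqr_ge0.
Qed.

Lemma L1_sqr f A : measurable_fun setT f -> (nsq f <= A%:E)%E ->
  L1 (fun x => f x ^+ 2) /\ I (fun x => f x ^+ 2) <= A.
Proof.
move=> mf fA.
have l : L1 (fun x => f x ^+ 2).
  apply/integrableP; split; first exact: measurable_sqE.
  under eq_integral do rewrite /= ger0_norm ?sqr_ge0 //.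
  by apply: (le_lt_trans fA); rewrite ltry.
by split => //; rewrite -lee_fin I_EFin.
Qed.

Lemma L1_oneDsqrV : L1 (fun x => (1 + x ^+ 2)^-1).
Proof.
apply/integrableP; split.
  by apply/measurable_EFinP; apply: continuous_measurable_fun; exact: continuous_oneDsqrV.
have p (x : R) : 0 <= (1 + x ^+ 2)^-1 by rewrite invr_ge0 addr_ge0 // sqr_ge0.
under eq_integral do rewrite /= ger0_norm //.
rewrite (@ge0_symfun_integralT R (fun x => (1 + x ^+ 2)^-1)) //.
- apply: lte_mul_pinfty => //.
  have -> : [set x : R | 0 <= x] = `[0, +oo[%classic.
    by apply/seteqP; split => x /=; rewrite in_itv /= andbT.
  by rewrite (@integral0y_oneDsqr R) ltry.
- exact: continuous_oneDsqrV.
- by move=> x /=; rewrite sqrrN.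
Qed.

(** Measurability is bundled with a bound on the square of the norm: such bounds combine by ring
    operations, and they pass to pointwise limits ([L2le_fatou]). *)
Definition L2le f A : Prop := measurable_fun setT f /\ (nsq f <= A%:E)%E.

Lemma L2le_ge0 f A : L2le f A -> 0 <= A.
Proof. by move=> [_ h]; rewrite -lee_fin (le_trans (nsq_ge0 f)). Qed.

Lemma L2leW f A B : A <= B -> L2le f A -> L2le f B.
Proof. by move=> AB [mf h]; split => //; rewrite (le_trans h) // lee_fin. Qed.

Lemma L2leZ c f A : L2le f A -> L2le (fun x => c * f x) (c ^+ 2 * A).
Proof.
move=> [mf h]; split; first exact: measurable_funM.
by rewrite nsqZ // [X in (_ <= X)%E]EFinM lee_wpmul2l // lee_fin sqr_ge0.
Qed.

Lemma L2leD f g A B : L2le f A -> L2le g B ->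
  L2le (fun x => f x + g x) (2 * A + 2 * B).
Proof.
move=> [mf hf] [mg hg]; split; first exact: measurable_funD.
apply: (le_trans (nsqD mf mg)); rewrite [X in (_ <= X)%E]EFinD (EFinM 2 A) (EFinM 2 B).
by apply: leeD; rewrite lee_wpmul2l.
Qed.

Lemma L2leN f A : L2le f A -> L2le (fun x => - f x) A.
Proof.
move=> /(L2leZ (-1)); rewrite sqrrN expr1n mul1r.
by under eq_fun do rewrite mulN1r.
Qed.

Lemma L2leB f g A B : L2le f A -> L2le g B ->
  L2le (fun x => f x - g x) (2 * A + 2 * B).
Proof. by move=> hf hg; apply: L2leD => //; exact: L2leN. Qed.

Lemma L2le_le f g A : measurable_fun setT f -> (forall x, `|f x| <= `|g x|) ->
  L2le g A -> L2le f A.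
Proof. by move=> mf fg [mg h]; split => //; exact: le_trans (nsq_le _ _ fg) h. Qed.

Lemma L2le_Mb f g A : L2le f A -> measurable_fun setT g ->
  (forall x, `|g x| <= 1) -> L2le (fun x => f x * g x) A.
Proof.
move=> hf mg g1; apply: (L2le_le _ _ hf).
  by apply: measurable_funM => //; case: hf.
by move=> x; rewrite normrM ler_piMr.
Qed.

Lemma L2le_affine f a b A : a != 0 -> L2le f A ->
  L2le (fun x => f (a * x + b)) (`|a|^-1 * A).
Proof.
move=> a0 [mf h]; split; first by apply: measurableT_comp => //; exact: measurable_affine.
by rewrite nsq_affine // [X in (_ <= X)%E]EFinM lee_wpmul2l // lee_fin invr_ge0.
Qed.

Lemma L2le_mul f g A B : L2le f A -> L2le g B ->
  L1 (fun x => f x * g x) /\ I (fun x => `|f x * g x|) <= Num.sqrt (A * B).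
Proof.
move=> hf hg; have A0 := L2le_ge0 hf; have B0 := L2le_ge0 hg.
rewrite sqrtrM //; apply: I_cauchy_schwarz; rewrite ?sqrtr_ge0 ?sqr_sqrtr //.
- by case: hf.
- by case: hg.
- by case: hf.
- by case: hg.
Qed.

Lemma L2le_fatou (f_ : nat -> R -> R) f A : (forall n, L2le (f_ n) A) ->
  (forall x, f_ n x @[n --> \oo] --> f x) -> L2le f A.
Proof.
move=> h cf; split.
  apply: (@measurable_fun_cvg _ _ _ _ f_) => [n|x _]; last exact: cf.
  by case: (h n).
apply: (nsq_fatou _ _ cf) => [n|]; first by case: (h n).
by apply: nearW => n; case: (h n).
Qed.

Lemma L2le_sqr f A : L2le f A ->
  L1 (fun x => f x ^+ 2) /\ I (fun x => f x ^+ 2) <= A.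
Proof. by case; exact: L1_sqr. Qed.

Lemma L2le_I f A : measurable_fun setT f -> L1 (fun x => f x ^+ 2) ->
  I (fun x => f x ^+ 2) <= A -> L2le f A.
Proof. by move=> mf l h; split => //; rewrite /nsq -I_EFin // lee_fin. Qed.

End SquareNorm.

(** * A Plancherel estimate *)

Section Ftc.
Context {R : realType}.
Local Notation mu := (@lebesgue_measure R).
Local Notation L1 f := (mu.-integrable setT (EFin \o f)).
Local Notation I f := (Rintegral mu setT f).
Implicit Types (f g h F : R -> R) (a b c A B : R).

Lemma Rintegral_ftc F f a b : (forall x, is_derive x (1 : R) F (f x)) -> continuous f ->
  a <= b -> \int[mu]_(x in `[a, b]) f x = F b - F a.
Proof.
move=> dF cf; rewrite le_eqVlt => /predU1P[->|ab].
  by rewrite subrr set_itv1 Rintegral_set1.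
have cF x : {for x, continuous F}.
  by apply: differentiable_continuous; apply/derivable1_diffP; have [] := dF x.
rewrite /Rintegral (@continuous_FTC2 R f F) //.
- exact: continuous_subspaceT.
- split => //.
  + by apply: cvg_at_right_filter; exact: cF.
  + by apply: cvg_at_left_filter; exact: cF.
- by move=> x _; rewrite derive1E; have [_ ->] := dF x.
Qed.

Lemma L1_itv f a b : continuous f -> mu.-integrable `[a, b] (EFin \o f).
Proof.
move=> cf; apply: continuous_compact_integrable; first exact: segment_compact.
exact: continuous_subspaceT.
Qed.

End Ftc.

(** * Schur's test for kernels depending on a linear form *)

Section Schur.
Context {R : realType}.
Local Notation mu := (@lebesgue_measure R).
Local Notation L1 f := (mu.-integrable setT (EFin \o f)).
Local Notation I f := (Rintegral mu setT f).
Implicit Types (a b : R -> R) (A M p q : R).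

(** Cauchy-Schwarz with [|a| * sqrt b] and [sqrt b] bounds the square of the integral by [I b / |p|]
    times the integral of [a ^+ 2 * b]; Tonelli then integrates in [x], which yields the second
    factor [I b / |q|]. The bound [M] makes [a ^+ 2 * b] integrable in [xi] for each [x]. *)
Lemma schur a b A M p q : p != 0 -> q != 0 ->
  L2le a A -> (forall s, 0 <= b s <= M) -> L1 b ->
  (forall x, L1 (fun xi => `|a xi| * b (p * xi + q * x))) /\
  L2le (fun x => I (fun xi => `|a xi| * b (p * xi + q * x)))
    (I b ^+ 2 / (`|p| * `|q|) * A).
Proof.
move=> p0 q0 [ma aA] bM lb.
have b0 s : 0 <= b s by have /andP[] := bM s.
have mb := L1_measurable lb.
have [la2 Ia2] := L1_sqr ma aA.
have A0 : 0 <= A by apply: le_trans Ia2; apply: Rintegral_ge0 => x _; exact: sqr_ge0.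
pose bx x xi := b (p * xi + q * x).
have bx0 x xi : 0 <= bx x xi by exact: b0.
have mbx x : measurable_fun setT (bx x).
  by apply: measurableT_comp => //; exact: measurable_affine.
have lbx x : L1 (bx x) by exact: integrable_affine.
have Ibx x : I (bx x) = `|p|^-1 * I b by rewrite Rintegral_affine.
have Ib0 : 0 <= I b by apply: Rintegral_ge0 => x _; exact: b0.
have labx x : L1 (fun xi => a xi ^+ 2 * bx x xi).
  apply: (L1_Ml la2 (mbx x) (M := M)) => xi.
  by rewrite ger0_norm //; have /andP[] := bM (p * xi + q * x).
have Iabx0 x : 0 <= I (fun xi => a xi ^+ 2 * bx x xi).
  by apply: Rintegral_ge0 => xi _; rewrite mulr_ge0 ?sqr_ge0 ?bx0.
have sb x xi : Num.sqrt (bx x xi) ^+ 2 = bx x xi by rewrite sqr_sqrtr ?bx0.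
have msb x : measurable_fun setT (fun xi => Num.sqrt (bx x xi)).
  apply: measurableT_comp => //; apply: continuous_measurable_fun.
  exact: sqrt_continuous.
have lee_eq (u v : \bar R) : u = v -> (u <= v)%E by move=> ->.
have key x : L1 (fun xi => `|a xi| * bx x xi) /\
    I (fun xi => `|a xi| * bx x xi) ^+ 2 <=
    I b / `|p| * I (fun xi => a xi ^+ 2 * bx x xi).
  have := @I_cauchy_schwarz R (fun xi => `|a xi| * Num.sqrt (bx x xi))
    (fun xi => Num.sqrt (bx x xi))
    (Num.sqrt (I (fun xi => a xi ^+ 2 * bx x xi))) (Num.sqrt (I (bx x)))
    (sqrtr_ge0 _) (sqrtr_ge0 _).
  have m1 : measurable_fun setT (fun xi => `|a xi| * Num.sqrt (bx x xi)).
    by apply: measurable_funM => //; exact: measurableT_comp.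
  move=> /(_ m1 (msb x)); rewrite !sqr_sqrtr ?Ibx ?mulr_ge0 ?invr_ge0 //.
  have E xi : `|a xi| * Num.sqrt (bx x xi) * Num.sqrt (bx x xi) = `|a xi| * bx x xi.
    by rewrite -mulrA -expr2 sb.
  have -> : (fun xi => `|a xi| * Num.sqrt (bx x xi) * Num.sqrt (bx x xi)) =
    (fun xi => `|a xi| * bx x xi) by apply/funext.
  have -> : (fun xi => `| `|a xi| * Num.sqrt (bx x xi) * Num.sqrt (bx x xi)|) =
    (fun xi => `|a xi| * bx x xi).
    by apply/funext => xi; rewrite E ger0_norm // mulr_ge0.
  case.
  - rewrite I_EFin // /nsq; apply: lee_eq; apply: eq_integral => xi _.
    by rewrite exprMn sb real_normK ?num_real.
  - rewrite -(Ibx x) I_EFin // /nsq; apply: lee_eq; apply: eq_integral => xi _.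
    by rewrite sb.
  move=> l le; split => //.
  have i0 : 0 <= I (fun xi => `|a xi| * bx x xi).
    by apply: Rintegral_ge0 => xi _; rewrite mulr_ge0 ?bx0.
  have : I (fun xi => `|a xi| * bx x xi) ^+ 2 <=
    (Num.sqrt (I (fun xi => a xi ^+ 2 * bx x xi)) * Num.sqrt (`|p|^-1 * I b)) ^+ 2.
    by rewrite ler_sqr // nnegrE mulr_ge0 ?sqrtr_ge0.
  rewrite exprMn !sqr_sqrtr //; last by rewrite mulr_ge0 ?invr_ge0.
  by move=> /le_trans; apply; rewrite mulrC [I b * _]mulrC.
split; first by move=> x; have [] := key x.
have m2 : measurable_fun setT (fun z : R * R => `|a z.2| * bx z.1 z.2).
  apply: measurable_funM.
    by apply: measurableT_comp => //; exact: measurable_comp2.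
  apply: measurableT_comp => //.
  by apply: measurable_funD; apply: measurable_funM.
have m3 : measurable_fun setT (fun z : R * R => a z.2 ^+ 2 * bx z.1 z.2).
  apply: measurable_funM; first by apply: measurable_funX; exact: measurable_comp2.
  apply: measurableT_comp => //.
  by apply: measurable_funD; apply: measurable_funM.
split; first exact: (measurable_I_param m2).
have c0 : 0 <= I b / `|p| by rewrite divr_ge0.
apply: (@le_trans _ _ (\int[mu]_x ((I b / `|p|) * I (fun xi => a xi ^+ 2 * bx x xi))%:E)%E).
  apply: ge0_le_integral => //.
  - by move=> x _; rewrite lee_fin sqr_ge0.
  - by apply: measurable_sqE; exact: (measurable_I_param m2).
  - apply/measurable_EFinP; apply: measurable_funM => //.
    exact: (measurable_I_param m3).
  - by move=> x _; rewrite lee_fin; have [] := key x.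
under eq_integral do rewrite EFinM I_EFin //.
rewrite ge0_integralZl //; last first.
- by move=> x _; apply: integral_ge0 => xi _; rewrite lee_fin mulr_ge0 ?sqr_ge0 ?bx0.
- have := @measurable_fun_fubini_tonelli_F _ _ _ _ _ mu
    (fun z : R * R => (a z.2 ^+ 2 * bx z.1 z.2)%:E).
  apply; first exact/measurable_EFinP.
  by move=> z; rewrite lee_fin mulr_ge0 ?sqr_ge0 ?bx0.
have -> : (\int[mu]_x \int[mu]_xi (a xi ^+ 2 * bx x xi)%:E =
    \int[mu]_xi (a xi ^+ 2 * (I b / `|q|))%:E)%E.
  have := @fubini_tonelli _ _ _ _ _ mu mu
    (fun z : R * R => (a z.2 ^+ 2 * bx z.1 z.2)%:E).
  move=> -> /=; last first.
  - by move=> z; rewrite lee_fin mulr_ge0 ?sqr_ge0 ?bx0.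
  - exact/measurable_EFinP.
  apply: eq_integral => xi _.
  have lq : L1 (fun x => b (q * x + p * xi)) by exact: integrable_affine.
  have E : (fun x => bx x xi) = (fun x => b (q * x + p * xi)).
    by apply/funext => x; rewrite /bx addrC.
  have l' : L1 (fun x => bx x xi) by rewrite E.
  rewrite -I_EFin; last exact: L1Z.
  by rewrite IZ // E Rintegral_affine // [I b / _]mulrC.
have lA : L1 (fun xi => a xi ^+ 2 * (I b / `|q|)).
  by have := L1Z (I b / `|q|) la2; apply: eq_integrable => // x _; rewrite /= mulrC.
rewrite -I_EFin // -EFinM lee_fin.
have -> : (fun xi => a xi ^+ 2 * (I b / `|q|)) = (fun xi => (I b / `|q|) * a xi ^+ 2).
  by apply/funext => xi; rewrite mulrC.
rewrite IZ // mulrA.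
have -> : I b / `|p| * (I b / `|q|) = I b ^+ 2 / (`|p| * `|q|).
  by rewrite invfM expr2 mulrACA.
by apply: ler_wpM2l => //; rewrite divr_ge0 ?sqr_ge0 ?mulr_ge0.
Qed.

End Schur.

Section Plancherel.
Context {R : realType}.
Local Notation mu := (@lebesgue_measure R).
Local Notation L1 f := (mu.-integrable setT (EFin \o f)).
Local Notation I f := (Rintegral mu setT f).
Implicit Types (a b f g : R -> R) (A M p q s x xi : R).

Lemma sqr_le_norm x M : `|x| <= M -> x ^+ 2 <= M ^+ 2.
Proof.
move=> xM; rewrite -real_normK ?num_real // ler_sqr ?nnegrE //.
exact: le_trans xM.
Qed.

Lemma cos_norm_le1 x : `|cos x| <= 1.
Proof. by rewrite ler_norml cos_geN1 cos_le1. Qed.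

Lemma sin_norm_le1 x : `|sin x| <= 1.
Proof. by rewrite ler_norml sin_geN1 sin_le1. Qed.

Lemma measurable_cos : measurable_fun setT (@cos R).
Proof. by apply: continuous_measurable_fun; exact: continuous_cos. Qed.

Lemma measurable_sin : measurable_fun setT (@sin R).
Proof. by apply: continuous_measurable_fun; exact: continuous_sin. Qed.

(** A parabolic weight: continuous, as it vanishes at the ends of [[-1, 1]], it has an absolutely
    integrable transform, [4 (sin s - s cos s) / s^3]. *)
Definition fejer : R -> R := (fun x => 1 - x ^+ 2) \_ `[-1, 1].

Lemma fejerE x : fejer x = if `|x| <= 1 then 1 - x ^+ 2 else 0.
Proof.
rewrite /fejer patchE; case: ifPn => [/set_mem /=|].
  by rewrite in_itv /= => h; rewrite ler_norml h.
by rewrite notin_setE /= in_itv /= => /negP/negbTE h; rewrite ler_norml h.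
Qed.

Lemma fejer_ge0 x : 0 <= fejer x.
Proof.
rewrite fejerE; case: ifP => // h; rewrite subr_ge0 -real_normK ?num_real //.
by rewrite expr_le1.
Qed.

Lemma fejer_le1 x : fejer x <= 1.
Proof. by rewrite fejerE; case: ifP => // _; rewrite gerBl sqr_ge0. Qed.

Lemma L1_fejer : L1 fejer.
Proof.
have : mu.-integrable `[(-1 : R), 1] (EFin \o (fun x : R => 1 - x ^+ 2)).
  apply: L1_itv => x; apply: cvgB; first exact: cvg_cst.
  exact: exprn_continuous.
rewrite integrable_mkcond //; apply: eq_integrable => // x _.
by rewrite /= /fejer !patchE; case: ifP.
Qed.

(** For [|s| <= 1] the trivial bound 2 is enough. Otherwise the explicit transform is at most
    [8 / s^2]: the weight vanishes at both ends, which removes the boundary term of order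
    [1 / s]. *)
Lemma fejer_transform s :
  `|I (fun x => fejer x * cos (x * s))| <= 16 * (1 + s ^+ 2)^-1.
Proof.
have -> : I (fun x => fejer x * cos (x * s)) =
    \int[mu]_(x in `[-1, 1]) ((1 - x ^+ 2) * cos (x * s)).
  rewrite [RHS]Rintegral_mkcond; apply: eq_Rintegral => x _.
  by rewrite /fejer !patchE; case: ifP; rewrite ?mul0r.
have cg : continuous (fun x : R => (1 - x ^+ 2) * cos (x * s)).
  move=> x; apply: cvgM.
    by apply: cvgB; [exact: cvg_cst|exact: exprn_continuous].
  apply: continuous_comp; last exact: continuous_cos.
  by apply: cvgMr_tmp; exact: cvg_id.
have d0 : 0 < 1 + s ^+ 2 by rewrite ltr_wpDr ?sqr_ge0.
have m11 : mu `[(-1 : R), 1] = 2%:E.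
  have h : (-1 : R) < 1 by lra.
  rewrite lebesgue_measure_itv /= lte_fin h.
  by rewrite -EFinB opprK.
have [s1|s1] := leP `|s| 1.
  have lg := L1_itv (-1) 1 cg.
  apply: (le_trans (le_normr_Rintegral _ lg)) => //.
  apply: (@le_trans _ _ (\int[mu]_(x in `[(-1 : R), 1]) cst 1 x)).
    apply: le_Rintegral => //.
    - exact: (integrable_norm lg).
    - by apply: (@L1_itv _ (cst 1)) => ?; exact: cvg_cst.
    - move=> x /=; rewrite in_itv /= => h; rewrite normrM.
      rewrite mulr_ile1 ?cos_norm_le1 //.
      have := fejer_le1 x; have := fejer_ge0 x; rewrite fejerE ler_norml h => p q.
      by rewrite ger0_norm.
  have -> : \int[mu]_(x in `[(-1 : R), 1]) cst 1 x = 1 * fine (mu `[(-1 : R), 1]).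
    exact: Rintegral_cst.
  rewrite m11 /= mul1r.
  rewrite ler_pdivlMr //.
  have : s ^+ 2 <= 1 by rewrite -real_normK ?num_real // expr_le1.
  lra.
have s0 : s != 0 by apply: contraTneq s1 => ->; rewrite normr0 ltr10.
(* A primitive of the integrand, found by integrating by parts twice. *)
pose F x := (1 - x ^+ 2) * (sin (x * s) / s) - 2 * x * (cos (x * s) / s ^+ 2)
  + 2 * (sin (x * s) / s ^+ 3).
have dF x : is_derive x (1 : R) F ((1 - x ^+ 2) * cos (x * s)).
  rewrite /F; apply: is_derive_eq.
  by rewrite /GRing.scale /=; field.
rewrite (Rintegral_ftc dF cg) /F ?mul1r ?mulN1r; last lra.
rewrite sinN cosN.
have -> : (1 - 1 ^+ 2) * (sin s / s) - 2 * 1 * (cos s / s ^+ 2) +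
    2 * (sin s / s ^+ 3) - ((1 - (-1) ^+ 2) * (- sin s / s) -
    2 * -1 * (cos s / s ^+ 2) + 2 * (- sin s / s ^+ 3)) =
    4 * (s ^+ 2)^-1 * (sin s * s^-1 - cos s) by field.
have i0 : 0 < s ^+ 2 by rewrite exprn_even_gt0.
have s2 : 1 <= s ^+ 2 by rewrite -real_normK ?num_real // expr_ge1 // ltW.
have h1 : `|sin s * s^-1 - cos s| <= 2.
  apply: (le_trans (ler_normB _ _)); rewrite normrM normfV.
  have := cos_norm_le1 s; have := sin_norm_le1 s => p q.
  have : `|sin s| * `|s|^-1 <= 1.
    by rewrite mulr_ile1 ?invr_ge0 // invf_le1 ?normr_gt0 // ltW.
  lra.
rewrite normrM ger0_norm; last by rewrite mulr_ge0 // invr_ge0 ltW.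
have i1 : 0 <= 4 * (s ^+ 2)^-1 by rewrite mulr_ge0 // invr_ge0 ltW.
apply: (le_trans (ler_wpM2l i1 h1)).
rewrite ler_pdivlMr // mulrAC mulrC.
have -> : 2 * (4 * (s ^+ 2)^-1 * (1 + s ^+ 2)) = 8 * (s ^+ 2)^-1 + 8 by field.
have : (s ^+ 2)^-1 <= 1 by rewrite invf_le1.
lra.
Qed.

Definition CT a x : R := I (fun xi => a xi * cos (x * xi)).
Definition ST a x : R := I (fun xi => a xi * sin (x * xi)).

Lemma measurable_cosM : measurable_fun setT (fun z : R * R => cos (z.1 * z.2)).
Proof. by apply: measurableT_comp; [exact: measurable_cos|apply: measurable_funM]. Qed.

Lemma measurable_sinM : measurable_fun setT (fun z : R * R => sin (z.1 * z.2)).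
Proof. by apply: measurableT_comp; [exact: measurable_sin|apply: measurable_funM]. Qed.

Lemma L1_Mcos a x : L1 a -> L1 (fun xi => a xi * cos (x * xi)).
Proof.
move=> la; apply: (L1_Ml la) => [|xi]; last exact: cos_norm_le1.
exact: (@measurable_slice1 _ (fun x xi => cos (x * xi)) x measurable_cosM).
Qed.

Lemma L1_Msin a x : L1 a -> L1 (fun xi => a xi * sin (x * xi)).
Proof.
move=> la; apply: (L1_Ml la) => [|xi]; last exact: sin_norm_le1.
exact: (@measurable_slice1 _ (fun x xi => sin (x * xi)) x measurable_sinM).
Qed.

Lemma measurable_CT a : measurable_fun setT a -> measurable_fun setT (CT a).
Proof.
move=> ma; apply: (@measurable_I_param _ (fun x xi => a xi * cos (x * xi))).
by apply: measurable_funM; [exact: measurable_comp2|exact: measurable_cosM].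
Qed.

Lemma measurable_ST a : measurable_fun setT a -> measurable_fun setT (ST a).
Proof.
move=> ma; apply: (@measurable_I_param _ (fun x xi => a xi * sin (x * xi))).
by apply: measurable_funM; [exact: measurable_comp2|exact: measurable_sinM].
Qed.

Lemma CT_le a x : L1 a -> `|CT a x| <= I (fun xi => `|a xi|).
Proof.
move=> la; apply: I_norm_le; [exact: L1_Mcos|exact: L1_abs|move=> xi].
by rewrite normrM ler_piMr // cos_norm_le1.
Qed.

Lemma ST_le a x : L1 a -> `|ST a x| <= I (fun xi => `|a xi|).
Proof.
move=> la; apply: I_norm_le; [exact: L1_Msin|exact: L1_abs|move=> xi].
by rewrite normrM ler_piMr // sin_norm_le1.
Qed.

(** The mass of [1 / (1 + s^2)], to which the decaying kernels below are compared. *)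
Definition kb : R := I (fun s => (1 + s ^+ 2)^-1).

Lemma kb_ge0 : 0 <= kb.
Proof. by apply: Rintegral_ge0 => x _; rewrite invr_ge0 addr_ge0 // sqr_ge0. Qed.

(* The transform of the Fejer weight is nonnegative and integrable, so the
   weighted square norm of the cosine and sine transforms is a quadratic form
   in [a] controlled by Schur's test. *)
Lemma fejer_plancherel a A N : 0 < N -> L1 a -> L2le a A ->
  let G x := fejer (N^-1 * x + 0) * (CT a x ^+ 2 + ST a x ^+ 2) in
  L1 G /\ I G <= 16 * kb * A.
Proof.
move=> N0 la ha G.
have A0 := L2le_ge0 ha; have ma := L1_measurable la.
have mC := measurable_CT ma; have mS := measurable_ST ma.
have N1 : N^-1 != 0 by rewrite invr_neq0 // gt_eqF.
pose w x := fejer (N^-1 * x + 0).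
have lw : L1 w by exact: (integrable_affine _ N1 L1_fejer).
have mw := L1_measurable lw.
have w0 x : 0 <= w x by exact: fejer_ge0.
pose M := I (fun xi => `|a xi|).
have M0 : 0 <= M by exact: Rintegral_ge0.
have CM x : `|CT a x| <= M by exact: CT_le.
have SM x : `|ST a x| <= M by exact: ST_le.
have lG : L1 G.
  apply: (L1_Ml lw (M := 2 * M ^+ 2)).
    by apply: measurable_funD; exact: measurable_funX.
  move=> x; rewrite ger0_norm ?addr_ge0 ?sqr_ge0 //.
  have hC : CT a x ^+ 2 <= M ^+ 2 by exact: sqr_le_norm.
  have hS : ST a x ^+ 2 <= M ^+ 2 by exact: sqr_le_norm.
  lra.
split => //.
(* Only one of the two factors in each square of [CT a x ^+ 2 + ST a x ^+ 2] is expanded as an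
   integral, so that a single explicit factor [a xi] appears. *)
pose h x xi := cos (x * xi) * CT a x + sin (x * xi) * ST a x.
have hM x xi : `|h x xi| <= 2 * M.
  apply: (le_trans (ler_normD _ _)); rewrite !normrM.
  have := cos_norm_le1 (x * xi); have := sin_norm_le1 (x * xi).
  have := CM x; have := SM x.
  have := normr_ge0 (cos (x * xi)); have := normr_ge0 (sin (x * xi)).
  have := normr_ge0 (CT a x); have := normr_ge0 (ST a x).
  nra.
have mh : measurable_fun setT (fun z : R * R => h z.1 z.2).
  apply: measurable_funD; apply: measurable_funM.
  - exact: measurable_cosM.
  - exact: measurable_comp1.
  - exact: measurable_sinM.
  - exact: measurable_comp1.
have lah x : L1 (fun xi => a xi * h x xi).
  by apply: (L1_Ml la _ (hM x)); exact: measurable_slice1 mh.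
have lwh xi : L1 (fun x => w x * h x xi).
  by apply: (L1_Ml lw _ (fun x => hM x xi)); exact: measurable_slice2 mh.
have E1 x : G x = I (fun xi => w x * (a xi * h x xi)).
  rewrite IZ //; congr (_ * _).
  have -> : (fun xi => a xi * h x xi) = (fun xi => CT a x * (a xi * cos (x * xi)) +
      ST a x * (a xi * sin (x * xi))) by apply/funext => xi; rewrite /h; ring.
  rewrite ID ?IZ ?expr2 //; try exact: L1_Mcos; try exact: L1_Msin.
    by apply: L1Z; exact: L1_Mcos.
  by apply: L1Z; exact: L1_Msin.
pose D xi := I (fun x => w x * h x xi).
(* Majorant of the transform of the rescaled weight; its mass [16 * kb] does not depend on [N]. *)
pose b s := 16 * N * (1 + (N * s + 0) ^+ 2)^-1.
have N00 : N != 0 by rewrite gt_eqF.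
have lb : L1 b by apply: L1Z; exact: (integrable_affine 0 N00 L1_oneDsqrV).
have Ib : I b = 16 * kb.
  rewrite IZ; last exact: (integrable_affine 0 N00 L1_oneDsqrV).
  rewrite (@Rintegral_affine _ (fun s => (1 + s ^+ 2)^-1)) //; last first.
    exact: L1_measurable L1_oneDsqrV.
  by rewrite gtr0_norm // -mulrA mulVKf.
have bN s : 0 <= b s <= 16 * N.
  have N16 : 0 <= 16 * N by rewrite mulr_ge0 // ltW.
  have s0 : 0 < 1 + (N * s + 0) ^+ 2 by rewrite ltr_wpDr ?sqr_ge0.
  apply/andP; split; first by rewrite /b mulr_ge0 // invr_ge0 ltW.
  by rewrite /b ler_piMr // invf_le1 // lerDl sqr_ge0.
have nm1 : -1 != 0 :> R by rewrite oppr_eq0 oner_neq0.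
have [lS hS] := schur nm1 (oner_neq0 _) ha bN lb.
rewrite normrN1 normr1 mulr1 divr1 Ib in hS.
set Sch := (fun xi => I _) in hS.
have what s : I (fun x => w x * cos (x * s)) = N * I (fun y => fejer y * cos (y * (N * s))).
  have := @Rintegral_affine _ (fun y => fejer y * cos (y * (N * s))) N^-1 0 N1.
  rewrite normfV gtr0_norm // invrK => <-; last first.
    apply: measurable_funM; first exact: L1_measurable L1_fejer.
    apply: measurableT_comp; first exact: measurable_cos.
    exact: measurable_funM.
  by apply: eq_Rintegral => x _; rewrite addr0 /w addr0; congr (_ * cos _); field.
have whatb s : `|I (fun x => w x * cos (x * s))| <= b s.
  rewrite what normrM gtr0_norm //.
  apply: (le_trans (ler_wpM2l (ltW N0) (fejer_transform _))).
  by rewrite /b addr0 mulrA [N * 16]mulrC.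
have DS xi : `|D xi| <= Sch xi.
  (* By the subtraction formula for the cosine, [D] is the convolution of [a] with the transform of
     the weight, a kernel to which Schur's test applies. *)
  have -> : D xi = I (fun eta => a eta * I (fun x => w x * cos (x * (xi - eta)))).
    have -> : D xi = I (fun x => I (fun eta => w x * (a eta * cos (x * (xi - eta))))).
      apply: eq_Rintegral => x _; rewrite IZ; last first.
        apply: (L1_Ml la) => [|eta]; last exact: cos_norm_le1.
        apply: measurableT_comp; first exact: measurable_cos.
        by apply: measurable_funM => //; apply: measurable_funB.
      congr (_ * _).
      have -> : (fun eta => a eta * cos (x * (xi - eta))) = (fun eta =>
        cos (x * xi) * (a eta * cos (x * eta)) + sin (x * xi) * (a eta * sin (x * eta))).
        by apply/funext => eta; rewrite mulrBr cosB; ring.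
      by rewrite ID ?IZ //; do ?apply: L1Z; try exact: L1_Mcos; exact: L1_Msin.
    rewrite (@I_fubini _ (fun x eta => w x * (a eta * cos (x * (xi - eta)))) w
      (fun eta => `|a eta|)) //.
    - apply: eq_Rintegral => eta _.
      have -> : (fun x => w x * (a eta * cos (x * (xi - eta)))) =
        (fun x => a eta * (w x * cos (x * (xi - eta)))) by apply/funext => x; ring.
      rewrite IZ //; apply: (L1_Ml lw) => [|x]; last exact: cos_norm_le1.
      by apply: measurableT_comp; [exact: measurable_cos|exact: measurable_funM].
    - apply: measurable_funM; first exact: measurable_comp1.
      apply: measurable_funM; first exact: measurable_comp2.
      apply: measurableT_comp; first exact: measurable_cos.
      by apply: measurable_funM => //; apply: measurable_funB.
    - exact: L1_abs.
    - move=> x eta; rewrite !normrM ger0_norm //.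
      by rewrite ler_wpM2l // ler_piMr // cos_norm_le1.
  apply: I_norm_le.
  - apply: (L1_le _ _ (lS xi)).
      apply: measurable_funM => //.
      apply: (@measurable_I_param _ (fun eta x => w x * cos (x * (xi - eta)))).
      apply: measurable_funM; first exact: measurable_comp2.
      apply: measurableT_comp; first exact: measurable_cos.
      by apply: measurable_funM => //; apply: measurable_funB.
    move=> eta; rewrite normrM mulN1r mul1r; apply: ler_wpM2l => //.
    by rewrite [- _ + _]addrC whatb.
  - exact: lS.
  - move=> eta; rewrite normrM mulN1r mul1r; apply: ler_wpM2l => //.
    by rewrite [- _ + _]addrC whatb.
have -> : I G = I (fun x => I (fun xi => w x * (a xi * h x xi))).
  by apply: eq_Rintegral => x _; exact: E1.
rewrite (@I_fubini _ (fun x xi => w x * (a xi * h x xi)) (fun x => 2 * M * w x)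
  (fun eta => `|a eta|)); last first.
- move=> x xi; rewrite !normrM (ger0_norm (w0 x)).
  rewrite [2 * M * w x]mulrC -mulrA [2 * M * _]mulrC.
  by apply: ler_wpM2l => //; exact: ler_wpM2l.
- exact: L1_abs.
- exact: L1Z.
- apply: measurable_funM; first exact: measurable_comp1.
  by apply: measurable_funM => //; exact: measurable_comp2.
have -> : (fun xi => I (fun x => w x * (a xi * h x xi))) = (fun xi => a xi * D xi).
  apply/funext => xi; rewrite -IZ //; apply: eq_Rintegral => x _; ring.
have mD : measurable_fun setT D.
  apply: (@measurable_I_param _ (fun xi x => w x * h x xi)).
  apply: measurable_funM; first exact: measurable_comp2.
  by have := measurableT_comp mh (@measurable_swap _ _ R R).
(* The weighted square norm is the pairing of [a] with [D], hence at most
   [sqrt (A * ((16 * kb)^2 * A))]. *)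
have [l1 i1] := L2le_mul ha hS.
have Sch0 xi : 0 <= Sch xi by apply: le_trans (DS xi).
have aD xi : `|a xi * D xi| <= `|a xi * Sch xi|.
  by rewrite !normrM ler_wpM2l // (ger0_norm (Sch0 xi)).
have laD : L1 (fun xi => a xi * D xi).
  by apply: (L1_le _ aD); [exact: measurable_funM|exact: L1_abs].
apply: (le_trans (ler_norm _)).
apply: (le_trans (I_norm_le laD (L1_abs l1) aD)).
apply: (le_trans i1); rewrite mulrCA -expr2 -exprMn.
rewrite [X in _ <= X](_ : _ = Num.sqrt ((16 * kb * A) ^+ 2)); last first.
  by rewrite sqrtr_sqr ger0_norm // !mulr_ge0 // kb_ge0.
by rewrite ler_wsqrtr // ; lra.
Qed.

(** The bound of [fejer_plancherel] is uniform in [N] and the weights tend to 1, so Fatou's lemma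
    concludes; the square root of the weight appears because [nsq] squares. *)
Lemma plancherel a A : L1 a -> L2le a A ->
  L2le (CT a) (16 * kb * A) /\ L2le (ST a) (16 * kb * A).
Proof.
move=> la ha.
have ma := L1_measurable la.
pose w (n : nat) x := fejer (n.+1%:R^-1 * x + 0).
have w0 n x : 0 <= w n x by exact: fejer_ge0.
have mw n : measurable_fun setT (w n).
  by apply: measurableT_comp; [exact: L1_measurable L1_fejer|exact: measurable_affine].
have w1 x : Num.sqrt (w n x) @[n --> \oo] --> (1 : R).
  rewrite -[X in _ --> X]sqrtr1.
  apply: (@cvg_comp _ _ _ (fun n => w n x) Num.sqrt); last exact: sqrt_continuous.
  have cN : n.+1%:R^-1 * x + 0 @[n --> \oo] --> (0 : R).
    rewrite -[X in _ --> X]addr0; apply: cvgD; last exact: cvg_cst.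
    rewrite -[X in _ --> X](mul0r x); apply: cvgM; last exact: cvg_cst.
    exact: cvg_harmonic.
  have c1 : 1 - (n.+1%:R^-1 * x + 0) ^+ 2 @[n --> \oo] --> (1 : R).
    rewrite -[X in _ --> X]subr0; apply: cvgB; first exact: cvg_cst.
    by rewrite -[X in _ --> X](mulr0 0); exact: (cvgM cN cN).
  apply: cvg_trans c1; apply: near_eq_cvg; near=> n.
  rewrite /w fejerE ifT //.
  near: n; move/cvgrPdist_le : cN => /(_ _ ltr01).
  by apply: filterS => n; rewrite sub0r normrN.
have key (C : R -> R) : measurable_fun setT C ->
    (forall x, C x ^+ 2 <= CT a x ^+ 2 + ST a x ^+ 2) -> L2le C (16 * kb * A).
  move=> mC hC.
  apply: (@L2le_fatou _ (fun n x => Num.sqrt (w n x) * C x)); last first.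
    by move=> x; rewrite -[X in _ --> X]mul1r; apply: cvgM => //; exact: cvg_cst.
  move=> n.
  have [lG iG] := @fejer_plancherel a A n.+1%:R (ltr0Sn _ _) la ha.
  have msq : measurable_fun setT (fun x => Num.sqrt (w n x) * C x).
    apply: measurable_funM => //; apply: measurableT_comp => //.
    by apply: continuous_measurable_fun; exact: sqrt_continuous.
  have le2 x : (Num.sqrt (w n x) * C x) ^+ 2 <=
      fejer (n.+1%:R^-1 * x + 0) * (CT a x ^+ 2 + ST a x ^+ 2).
    by rewrite exprMn sqr_sqrtr // ler_wpM2l.
  have l2 : L1 (fun x => (Num.sqrt (w n x) * C x) ^+ 2).
    apply: (L1_le _ _ lG); first exact: measurable_funX.
    by move=> x; rewrite ger0_norm ?sqr_ge0.
  by apply: L2le_I => //; apply: le_trans iG; exact: I_le.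
split; apply: key.
- exact: measurable_CT.
- by move=> x; rewrite lerDl sqr_ge0.
- exact: measurable_ST.
- by move=> x; rewrite lerDr sqr_ge0.
Unshelve. all: end_near. Qed.

End Plancherel.

(** * Fresnel integrals *)

Section UnderIntegral.
Context {R : realType}.
Local Notation mu := (@lebesgue_measure R).

Lemma is_derive_under_integral (f df : R -> R -> R) (B : set R) (a u v : R) (G : R -> R) :
  measurable B -> u < a < v ->
  (forall x, u < x < v -> mu.-integrable B (EFin \o f x)) ->
  (forall x y, u < x < v -> B y -> is_derive x (1 : R) (f ^~ y) (df x y)) ->
  (forall y, 0 <= G y) -> mu.-integrable B (EFin \o G) ->
  (forall x y, u < x < v -> B y -> `|df x y| <= G y) ->
  is_derive a (1 : R) (fun x => \int[mu]_(y in B) f x y) (\int[mu]_(y in B) df a y).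
Proof.
move=> mB auv lf dff G0 lG dfG.
have inI x : `]u, v[%classic x -> u < x < v by rewrite /= in_itv.
have Ia : `]u, v[%classic a by rewrite /= in_itv.
have h1 x : `]u, v[%classic x -> mu.-integrable B (EFin \o f x).
  by move=> /inI; exact: lf.
have pE x y : `]u, v[%classic x -> B y -> partial1of2 f x y = df x y.
  by move=> /inI xI By; rewrite partial1of2E; have [_] := dff _ _ xI By.
have h2 x y : `]u, v[%classic x -> B y -> derivable (f^~ y) x 1.
  by move=> /inI xI By; have [] := dff _ _ xI By.
have h3 x y : `]u, v[%classic x -> B y -> `|partial1of2 f x y| <= G y.
  by move=> xI By; rewrite pE //; apply: dfG => //; exact: inI.
split.
  by have := @derivable_under_integral _ _ _ mu f B mB a u v Ia h1 h2 G G0 lG h3.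
rewrite -derive1E (@differentiation_under_integral _ _ _ mu f B mB a u v Ia h1 h2 G G0 lG h3).
by apply: eq_Rintegral => y /set_mem By; rewrite pE.
Qed.

End UnderIntegral.

Section FresnelKernel.
Context {R : realType}.
Local Notation mu := (@lebesgue_measure R).
Local Notation L1 f := (mu.-integrable setT (EFin \o f)).
Local Notation I f := (Rintegral mu setT f).
Local Notation W := (`[0, +oo[%classic : set R).
Local Notation LW f := (mu.-integrable W (EFin \o f)).
Implicit Types (a b f g F : R -> R) (A M p q s x xi w L : R).

Lemma inW w : W w <-> 0 <= w.
Proof. by rewrite /= in_itv /= andbT. Qed.

Let mW : measurable (W : set (measurableTypeR R)).
Proof. exact: measurable_itv. Qed.

Lemma LW_le f g : continuous f -> (forall w, 0 <= w -> `|f w| <= g w) -> LW g -> LW f.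
Proof.
move=> cf fg lg; apply: le_integrable lg => //.
  apply/measurable_EFinP; apply: measurable_funS (continuous_measurable_fun cf) => //.
move=> w /inW w0 /=; rewrite lee_fin; apply: (le_trans (fg _ w0)); exact: ler_norm.
Qed.

Lemma integral_expRN s : 0 < s ->
  (\int[mu]_(w in W) (expR (- (s * w)))%:E = (s^-1)%:E)%E.
Proof.
move=> s0; have s1 : s != 0 by rewrite gt_eqF.
have dF w : is_derive w (1 : R) (fun w => - s^-1 * expR (- (s * w))) (expR (- (s * w))).
  by apply: is_derive_eq; rewrite /GRing.scale /=; field.
have cF w : {for w, continuous (fun w => - s^-1 * expR (- (s * w)))}.
  by apply: differentiable_continuous; apply/derivable1_diffP; have [] := dF w.
rewrite (@ge0_continuous_FTC2y R _ (fun w => - s^-1 * expR (- (s * w))) 0 0).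
- by rewrite mulr0 oppr0 expR0 mulr1 sub0e -EFinN opprK.
- by move=> w _; exact: expR_ge0.
- apply: continuous_subspaceT => w.
  apply: continuous_comp; last exact: continuous_expR.
  by apply: cvgN; apply: cvgM; [exact: cvg_cst|exact: cvg_id].
- rewrite -[X in _ --> X](mulr0 (- s^-1)); apply: cvgM; first exact: cvg_cst.
  apply: (@cvg_comp _ _ _ ( *%R s) (fun y => expR (- y))); last exact: cvgr_expR.
  by apply: gt0_cvgMry => //; exact: cvg_id.
- by move=> w _; have [] := dF w.
- by apply: cvg_at_right_filter; exact: cF.
- by move=> w _; rewrite derive1E; have [_ ->] := dF w.
Qed.

Lemma LW_expRN s : 0 < s -> LW (fun w => expR (- (s * w))).
Proof.
move=> s0; apply/integrableP; split.
  apply/measurable_EFinP; apply: measurable_funS (continuous_measurable_fun _) => // w.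
  apply: continuous_comp; last exact: continuous_expR.
  by apply: cvgN; apply: cvgM; [exact: cvg_cst|exact: cvg_id].
under eq_integral do rewrite /= ger0_norm ?expR_ge0 //.
by rewrite integral_expRN // ltry.
Qed.

Lemma LWZ k f : LW f -> LW (fun w => k * f w).
Proof.
move=> lf; have := integrableZl mW k lf.
by apply: eq_integrable => // x _; rewrite /= EFinM.
Qed.

Lemma LWD f g : LW f -> LW g -> LW (fun w => f w + g w).
Proof.
move=> lf lg; have := integrableD mW lf lg.
by apply: eq_integrable => // x _; rewrite /= EFinD.
Qed.

Lemma LW_norm_le f g : LW f -> LW g -> (forall w, 0 <= w -> `|f w| <= g w) ->
  `|\int[mu]_(w in W) f w| <= \int[mu]_(w in W) g w.
Proof.
move=> lf lg fg; apply: (le_trans (le_normr_Rintegral mW lf)).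
apply: le_Rintegral => //; first exact: (integrable_norm lf).
by move=> w /inW; exact: fg.
Qed.

(* [w <= expR w] turns the factor [w] into a change of [L]. *)
Lemma gauss_expR_le L w : 0 <= w ->
  expR (- w ^+ 2 + L * w) <= expR ((L + 1) ^+ 2 / 4) * expR (- (1 * w)) /\
  w * expR (- w ^+ 2 + L * w) <= expR ((L + 2) ^+ 2 / 4) * expR (- (1 * w)).
Proof.
move=> w0; have E L' : expR (- w ^+ 2 + L' * w) <= expR ((L' + 1) ^+ 2 / 4) * expR (- (1 * w)).
  rewrite -expRD ler_expR; have := sqr_ge0 (w - (L' + 1) / 2); nra.
split; first exact: E.
have -> : L + 2 = (L + 1) + 1 by lra.
apply: (le_trans _ (E (L + 1))).
have -> : - w ^+ 2 + (L + 1) * w = w + (- w ^+ 2 + L * w) by ring.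
rewrite expRD ler_wpM2r ?expR_ge0 //; apply: (le_trans _ (expR_ge1Dx _)); lra.
Qed.

(** The integrand may oscillate: the formula on [[0, n]] passes to the limit by dominated
    convergence, with majorant [|f|] on the half line. *)
Lemma Rintegral_ftc_pinfty F f l : (forall x, is_derive x (1 : R) F (f x)) ->
  continuous f -> LW f -> F n%:R @[n --> \oo] --> l ->
  \int[mu]_(w in W) f w = l - F 0.
Proof.
move=> dF cf lf cF.
have H : \int[mu]_(w in `[0, n%:R]) f w @[n --> \oo] --> \int[mu]_(w in W) f w.
  rewrite Rintegral_mkcond.
  have -> : (fun n : nat => \int[mu]_(w in `[0, n%:R]) f w) =
    (fun n : nat => I (f \_ `[0, n%:R])) by apply/funext => n; rewrite Rintegral_mkcond.
  have lW : L1 (f \_ W).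
    have : mu.-integrable setT ((EFin \o f) \_ W) by rewrite -integrable_mkcond.
    by apply: eq_integrable => // x _; rewrite /= !patchE; case: ifP.
  apply: (@I_dominated _ _ _ (fun x => `|(f \_ W) x|)).
  - move=> n; apply/(measurable_restrictT _ _).1 => //.
    exact: measurable_funS (continuous_measurable_fun cf).
  - exact: L1_measurable lW.
  - exact: L1_abs.
  - move=> n x; rewrite !patchE; case: ifPn; last by rewrite normr0.
    move=> /set_mem; rewrite /= in_itv /= => /andP[x0 _].
    by rewrite mem_set // inW.
  - move=> x; apply: cvg_near_cst; near=> n.
    rewrite !patchE /=; congr (if _ then _ else _); apply/idP/idP => /set_mem.
      by rewrite /= in_itv /= => /andP[x0 _]; rewrite mem_set // inW.
    move=> /inW x0; rewrite mem_set //= in_itv /= x0 /=.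
    near: n; exact: nbhs_infty_ger.
rewrite -(cvg_lim _ H) //; apply: cvg_lim => //.
have -> : (fun n : nat => \int[mu]_(w in `[0, n%:R]) f w) = (fun n : nat => F n%:R - F 0).
  by apply/funext => n; rewrite (Rintegral_ftc dF cf).
by apply: cvgB => //; exact: cvg_cst.
Unshelve. all: end_near. Qed.

(** Turning the contour by [pi / 4], that is [r = s + (1 + i) w], writes the Fresnel tail, the
    integral of [exp (i r^2 / 2)] over [r >= s], as [exp (i s^2 / 2)] times [1 + i] times the
    integral over [w >= 0] of [exp (- w^2 - s w + i s w)], which converges absolutely. [fresnelA1]
    and [fresnelA2] are the real and imaginary parts of the product of the last two factors. *)
Definition gx s w : R := expR (- w ^+ 2 + - s * w).
Definition fresnelA1 s : R := \int[mu]_(w in W) (gx s w * (cos (s * w) - sin (s * w))).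
Definition fresnelA2 s : R := \int[mu]_(w in W) (gx s w * (cos (s * w) + sin (s * w))).

Lemma gx0 s : gx s 0 = 1.
Proof. by rewrite /gx expr0n /= oppr0 mulr0 addr0 expR0. Qed.

Lemma continuous_trig_poly s (P : R -> R) (c d : R) : continuous P ->
  continuous (fun w => P w * gx s w * (c * cos (s * w) + d * sin (s * w))).
Proof.
move=> cP w.
have cs : {for w, continuous (fun w => s * w)}.
  by apply: cvgM; [exact: cvg_cst|exact: cvg_id].
apply: cvgM; first (apply: cvgM; first exact: cP).
  apply: continuous_comp; last exact: continuous_expR.
  apply: cvgD; first by apply: cvgN; exact: exprn_continuous.
  by apply: cvgM; [exact: cvg_cst|exact: cvg_id].
apply: cvgD; apply: cvgM; try exact: cvg_cst.
  by apply: continuous_comp => //; exact: continuous_cos.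
by apply: continuous_comp => //; exact: continuous_sin.
Qed.

Lemma trig_comb_le (c d : R) x : `|c| <= 1 -> `|d| <= 1 -> `|c * cos x + d * sin x| <= 2.
Proof.
move=> c1 d1; apply: (le_trans (ler_normD _ _)); rewrite !normrM.
have := cos_norm_le1 x; have := sin_norm_le1 x => hs hc.
have : `|c| * `|cos x| <= 1 by rewrite mulr_ile1.
have : `|d| * `|sin x| <= 1 by rewrite mulr_ile1.
lra.
Qed.

Lemma LW_gx1 s (c d : R) : `|c| <= 1 -> `|d| <= 1 ->
  LW (fun w => 1 * gx s w * (c * cos (s * w) + d * sin (s * w))).
Proof.
move=> c1 d1; apply: (@LW_le _ (fun w =>
  (2 * expR ((- s + 1) ^+ 2 / 4)) * expR (- (1 * w)))).
- by apply: (@continuous_trig_poly s (cst 1)) => w; exact: cvg_cst.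
- move=> w w0; have [h _] := gauss_expR_le (- s) w0.
  rewrite mul1r normrM ger0_norm ?expR_ge0 // [2 * _]mulrC [X in _ <= X]mulrAC.
  by apply: ler_pM; rewrite ?expR_ge0 ?trig_comb_le.
- by apply: LWZ; exact: LW_expRN.
Qed.

Lemma LW_gxw s (c d : R) : `|c| <= 1 -> `|d| <= 1 ->
  LW (fun w => w * gx s w * (c * cos (s * w) + d * sin (s * w))).
Proof.
move=> c1 d1; apply: (@LW_le _ (fun w =>
  (2 * expR ((- s + 2) ^+ 2 / 4)) * expR (- (1 * w)))).
- by apply: (@continuous_trig_poly s id) => w; exact: cvg_id.
- move=> w w0; have [_ h] := gauss_expR_le (- s) w0.
  rewrite normrM ger0_norm ?mulr_ge0 ?expR_ge0 // [2 * _]mulrC [X in _ <= X]mulrAC.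
  by apply: ler_pM; rewrite ?mulr_ge0 ?expR_ge0 ?trig_comb_le.
- by apply: LWZ; exact: LW_expRN.
Qed.

Lemma is_derive_gx_comb (c d a : R) : `|c| <= 1 -> `|d| <= 1 -> 
  is_derive a (1 : R)
    (fun s => \int[mu]_(w in W) (1 * gx s w * (c * cos (s * w) + d * sin (s * w))))
    (\int[mu]_(w in W) (w * gx a w * ((d - c) * cos (a * w) + (- c - d) * sin (a * w)))).
Proof.
(* A majorant valid for all [s] within distance 1 of [a]: there [- s <= |a| + 1], and the factor [w]
   adds 2 in [gauss_expR_le]. *)
move=> c1 d1; pose L : R := `|a| + 1 + 2.
apply: (@is_derive_under_integral _ 
  (fun s w => 1 * gx s w * (c * cos (s * w) + d * sin (s * w)))
  (fun s w => w * gx s w * ((d - c) * cos (s * w) + (- c - d) * sin (s * w)))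
  W a (a - 1) (a + 1) (fun w => (4 * expR (L ^+ 2 / 4)) * expR (- (1 * w)))) => //.
- by lra.
- by move=> s _; exact: LW_gx1.
- move=> s w _ _; rewrite /gx; apply: is_derive_eq; rewrite /GRing.scale /=; ring.
- by apply: LWZ; exact: LW_expRN.
- move=> s w sa /inW w0.
  have h1 : `|(d - c) * cos (s * w) + (- c - d) * sin (s * w)| <= 4.
    (* Coefficients of size 2 are split into two combinations with coefficients of size 1, each
       bounded by 2. *)
    have -> : (d - c) * cos (s * w) + (- c - d) * sin (s * w) =
      (d * cos (s * w) + (- c) * sin (s * w)) - (c * cos (s * w) + d * sin (s * w)) by ring.
    apply: (le_trans (ler_normB _ _)).
    have := @trig_comb_le d (- c) (s * w) d1; rewrite normrN => /(_ c1).
    have := @trig_comb_le c d (s * w) c1 d1; lra.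
  have [_ h] := gauss_expR_le (`|a| + 1) w0.
  have h2 : w * gx s w <= expR (L ^+ 2 / 4) * expR (- (1 * w)).
    apply: le_trans h; apply: ler_wpM2l => //; rewrite ler_expR lerD2l ler_wpM2r //.
    have := ler_norm (- a); rewrite normrN; lra.
  rewrite normrM ger0_norm ?mulr_ge0 ?expR_ge0 // [4 * _]mulrC [X in _ <= X]mulrAC.
  by apply: ler_pM; rewrite ?mulr_ge0 ?expR_ge0.
Qed.

Lemma cvg_gx_trig s (t : R -> R) : (forall x, `|t x| <= 1) ->
  gx s n%:R * t n%:R @[n --> \oo] --> (0 : R).
Proof.
move=> t1; apply/cvgr0Pnorm_le => e e0.
have cN : expR ((- s + 1) ^+ 2 / 4) * expR (- n%:R) @[n --> \oo] --> (0 : R).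
  rewrite -[X in _ --> X](mulr0 (expR ((- s + 1) ^+ 2 / 4))).
  apply: cvgM; first exact: cvg_cst.
  apply: (@cvg_comp _ _ _ (fun n : nat => n%:R : R) (fun y => expR (- y))); last exact: cvgr_expR.
  exact: cvgr_idn.
move/cvgr0Pnorm_le : cN => /(_ e e0); apply: filterS => n.
apply: le_trans; rewrite normrM (ger0_norm (expR_ge0 _)).
have [h _] := gauss_expR_le (- s) (ler0n R n).
rewrite mul1r in h.
rewrite [X in _ <= X]ger0_norm ?mulr_ge0 ?expR_ge0 //.
by apply: le_trans h; rewrite ler_piMr ?expR_ge0.
Qed.

Lemma fresnelA1E s : fresnelA1 s =
  \int[mu]_(w in W) (1 * gx s w * (1 * cos (s * w) + (-1) * sin (s * w))).
Proof. by apply: eq_Rintegral => w _; rewrite !mul1r mulN1r. Qed.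

Lemma fresnelA2E s : fresnelA2 s =
  \int[mu]_(w in W) (1 * gx s w * (1 * cos (s * w) + 1 * sin (s * w))).
Proof. by apply: eq_Rintegral => w _; rewrite !mul1r. Qed.

(* The differential equation [A' = i s A - 1] satisfied by [A = A1 - i A2],
   which makes [expR (- i s^2/2) A] a primitive of [- expR (- i s^2/2)]. *)
Lemma is_derive_fresnelA s :
  is_derive s (1 : R) fresnelA1 (s * fresnelA2 s - 1) /\
  is_derive s (1 : R) fresnelA2 (- s * fresnelA1 s).
Proof.
have n1 : `|1 : R| <= 1 by rewrite normr1.
have nN1 : `|-1 : R| <= 1 by rewrite normrN1.
have n0 : `|0 : R| <= 1 by rewrite normr0.
have l1 := @LW_gx1 s 1 1 n1 n1.
have l2 := @LW_gx1 s 1 (-1) n1 nN1.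
have m1 := @LW_gxw s 1 0 n1 n0.
have m2 := @LW_gxw s 0 1 n0 n1.
have H1 := @is_derive_gx_comb 1 (-1) s n1 nN1.
have H2 := @is_derive_gx_comb 1 1 s n1 n1.
have c1 : continuous (cst 1 : R -> R) by move=> ?; exact: cvg_cst.
have ci : continuous (id : R -> R) by move=> ?; exact: cvg_id.
split.
- have -> : fresnelA1 = fun s => \int[mu]_(w in W) (1 * gx s w * (1 * cos (s * w) + (-1) * sin (s * w))).
    by apply/funext => s'; exact: fresnelA1E.
  apply: is_derive_eq; rewrite fresnelA2E.
  (* The derivative in [w] of [gx s w * cos (s * w)] integrates to -1; this trades the factor [w] of
     the differentiated integral for a factor [s]. *)
  have F1 : \int[mu]_(w in W) ((-2) * (w * gx s w * (1 * cos (s * w) + 0 * sin (s * w)))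
     + (- s) * (1 * gx s w * (1 * cos (s * w) + 1 * sin (s * w)))) = 0 - gx s 0 * cos (s * 0).
    apply: (@Rintegral_ftc_pinfty (fun w => gx s w * cos (s * w))).
    + move=> w; rewrite /gx; apply: is_derive_eq; rewrite /GRing.scale /=; ring.
    + move=> w; apply: cvgD; apply: cvgM; try exact: cvg_cst; exact: continuous_trig_poly.
    + by apply: LWD; exact: LWZ.
    + by apply: (@cvg_gx_trig s (fun w => cos (s * w))) => x; exact: cos_norm_le1.
  move: F1; rewrite RintegralD ?RintegralZl //; try exact: LWZ.
  rewrite (mulr0 s) cos0 mulr1 sub0r gx0 => F1.
  have -> : \int[mu]_(w in W) (w * gx s w * ((-1 - 1) * cos (s * w) + (-1 - -1) * sin (s * w)))
      = - 2 * \int[mu]_(w in W) (w * gx s w * (1 * cos (s * w) + 0 * sin (s * w))).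
    rewrite -RintegralZl //; apply: eq_Rintegral => w _; ring.
  lra.
- have -> : fresnelA2 = fun s => \int[mu]_(w in W) (1 * gx s w * (1 * cos (s * w) + 1 * sin (s * w))).
    by apply/funext => s'; exact: fresnelA2E.
  apply: is_derive_eq; rewrite fresnelA1E.
  have F1 : \int[mu]_(w in W) ((-2) * (w * gx s w * (0 * cos (s * w) + 1 * sin (s * w)))
     + s * (1 * gx s w * (1 * cos (s * w) + (-1) * sin (s * w)))) = 0 - gx s 0 * sin (s * 0).
    apply: (@Rintegral_ftc_pinfty (fun w => gx s w * sin (s * w))).
    + move=> w; rewrite /gx; apply: is_derive_eq; rewrite /GRing.scale /=; ring.
    + move=> w; apply: cvgD; apply: cvgM; try exact: cvg_cst; exact: continuous_trig_poly.
    + by apply: LWD; exact: LWZ.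
    + by apply: (@cvg_gx_trig s (fun w => sin (s * w))) => x; exact: sin_norm_le1.
  move: F1; rewrite RintegralD ?RintegralZl //; try exact: LWZ.
  rewrite (mulr0 s) sin0 mulr0 subr0 => F1.
  have -> : \int[mu]_(w in W) (w * gx s w * ((1 - 1) * cos (s * w) + (-1 - 1) * sin (s * w)))
      = - 2 * \int[mu]_(w in W) (w * gx s w * (0 * cos (s * w) + 1 * sin (s * w))).
    rewrite -RintegralZl //; apply: eq_Rintegral => w _; ring.
  lra.
Qed.

Lemma Rintegral_expRN s : 0 < s -> \int[mu]_(w in W) expR (- (s * w)) = s^-1.
Proof. by move=> s0; rewrite /Rintegral integral_expRN. Qed.

(** The bounds without a power of [s] keep only the Gaussian factor; those with a power of [s] keep
    only [exp (- s w)], which gives [1 / s] for [J] and, because of the factor [w], [1 / s^2] for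
    [K]. *)
Lemma fresnel_comb_le (c d : R) : `|c| <= 1 -> `|d| <= 1 ->
  exists2 C : R, 0 <= C & forall s, 0 <= s ->
  let J := \int[mu]_(w in W) (1 * gx s w * (c * cos (s * w) + d * sin (s * w))) in
  let K := \int[mu]_(w in W) (w * gx s w * (c * cos (s * w) + d * sin (s * w))) in
  [/\ `|J| <= C, s * `|J| <= C, `|K| <= C & s ^+ 2 * `|K| <= C].
Proof.
move=> c1 d1; pose C := 8 + 2 * expR ((0 + 2) ^+ 2 / 4) + 2 * expR ((0 + 1) ^+ 2 / 4) : R.
have e1 := expR_ge0 ((0 + 2) ^+ 2 / 4 : R); have e2 := expR_ge0 ((0 + 1) ^+ 2 / 4 : R).
exists C; first by rewrite /C; lra.
move=> s s0 J K.
have l1 := @LW_gx1 s c d c1 d1; have l2 := @LW_gxw s c d c1 d1.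
have lE : LW (fun w => expR (- (1 * w))) by exact: LW_expRN.
have g0 w : 0 <= w -> gx s w <= expR (- w ^+ 2 + 0 * w).
  by move=> w0; rewrite ler_expR lerD2l ler_wpM2r // oppr_le0.
have J1 : `|J| <= 2 * expR ((0 + 1) ^+ 2 / 4).
  apply: (@le_trans _ _ (\int[mu]_(w in W) (2 * expR ((0 + 1) ^+ 2 / 4) * expR (- (1 * w))))).
    apply: LW_norm_le => //; first exact: LWZ.
    move=> w w0; have [h _] := gauss_expR_le 0 w0.
    rewrite mul1r normrM ger0_norm ?expR_ge0 // [2 * _]mulrC [X in _ <= X]mulrAC.
    apply: ler_pM; rewrite ?expR_ge0 ?trig_comb_le //.
    by apply: le_trans h; exact: g0.
  by rewrite RintegralZl // Rintegral_expRN // invr1 mulr1.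
have K1 : `|K| <= 2 * expR ((0 + 2) ^+ 2 / 4).
  apply: (@le_trans _ _ (\int[mu]_(w in W) (2 * expR ((0 + 2) ^+ 2 / 4) * expR (- (1 * w))))).
    apply: LW_norm_le => //; first exact: LWZ.
    move=> w w0; have [_ h] := gauss_expR_le 0 w0.
    rewrite normrM ger0_norm ?mulr_ge0 ?expR_ge0 // [2 * _]mulrC [X in _ <= X]mulrAC.
    apply: ler_pM; rewrite ?mulr_ge0 ?expR_ge0 ?trig_comb_le //.
    by apply: le_trans h; apply: ler_wpM2l => //; exact: g0.
  by rewrite RintegralZl // Rintegral_expRN // invr1 mulr1.
have [->|sn0] := eqVneq s 0.
  by rewrite /C expr0n /= !mul0r; split; lra.
have sp : 0 < s by rewrite lt_neqAle eq_sym sn0.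
have gs w : 0 <= w -> gx s w <= expR (- (s * w)).
  by move=> w0; rewrite ler_expR mulNr gerDr oppr_le0 sqr_ge0.
have J2 : s * `|J| <= 2.
  rewrite mulrC -ler_pdivlMr // -(Rintegral_expRN sp) -RintegralZl //; last exact: LW_expRN.
  apply: LW_norm_le => //; first by apply: LWZ; exact: LW_expRN.
  move=> w w0; rewrite mul1r normrM ger0_norm ?expR_ge0 // [2 * _]mulrC.
  by apply: ler_pM; rewrite ?expR_ge0 ?trig_comb_le ?gs.
have K2 : s ^+ 2 * `|K| <= 8.
  have s2 : 0 < s / 2 by rewrite divr_gt0.
  have sq : 0 < s ^+ 2 by rewrite exprn_gt0.
  have E : 8 / s ^+ 2 = 4 / s * (s / 2)^-1 by field.
  rewrite mulrC -ler_pdivlMr // E -(Rintegral_expRN s2) -RintegralZl //; last exact: LW_expRN.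
  apply: LW_norm_le => //; first by apply: LWZ; exact: LW_expRN.
  move=> w w0; rewrite normrM ger0_norm ?mulr_ge0 ?expR_ge0 //.
  have -> : 4 / s * expR (- (s / 2 * w)) = (2 / s * expR (- (s / 2 * w))) * 2 by field.
  apply: ler_pM; rewrite ?mulr_ge0 ?expR_ge0 ?trig_comb_le //.
  (* Half of the exponential decay absorbs [w]; the other half has integral [2 / s]. *)
  have h1 : w <= 2 / s * expR (s / 2 * w).
    have := expR_ge1Dx (s / 2 * w) => h.
    rewrite -ler_pdivrMl ?divr_gt0 // invfM invrK [2^-1 * s]mulrC.
    by apply: le_trans h; lra.
  apply: (@le_trans _ _ (2 / s * expR (s / 2 * w) * expR (- (s * w)))).
    by apply: ler_pM; rewrite ?expR_ge0 ?gs.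
  rewrite -mulrA -expRD; apply: ler_wpM2l; first by rewrite divr_ge0 // ltW.
  by rewrite ler_expR; lra.
have [hC1 hC2 hC3 hC4] : [/\ 2 * expR ((0 + 1) ^+ 2 / 4) <= C,
    2 * expR ((0 + 2) ^+ 2 / 4) <= C, 2 <= C & 8 <= C].
  by rewrite /C; move: e1 e2; move: (expR _) (expR _) => u v u0 v0; split; lra.
by split; [exact: le_trans hC1|exact: le_trans hC3|exact: le_trans hC2|exact: le_trans hC4].
Qed.

(** The cancellation in [s * fresnelA2 s - 1] cannot be read off a bound on [fresnelA2]. Both
    derivatives are computed a second time under the integral sign, where a factor [w] appears and
    gains one power of decay. *)
Lemma fresnelA_bound : exists2 C : R, 0 <= C & forall s, 0 <= s ->
  [/\ `|fresnelA1 s| <= C, `|fresnelA2 s| <= C, s * `|fresnelA1 s| <= C,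
      s * `|fresnelA2 s| <= C &
   [/\ `|s * fresnelA2 s - 1| <= C, `|- s * fresnelA1 s| <= C,
      s ^+ 2 * `|s * fresnelA2 s - 1| <= C & s ^+ 2 * `|- s * fresnelA1 s| <= C]].
Proof.
have n1 : `|1 : R| <= 1 by rewrite normr1.
have nN1 : `|-1 : R| <= 1 by rewrite normrN1.
have n0 : `|0 : R| <= 1 by rewrite normr0.
have [C1 C10 H1] := fresnel_comb_le n1 nN1.
have [C2 C20 H2] := fresnel_comb_le n1 n1.
have [C3 C30 H3] := fresnel_comb_le n1 n0.
have [C4 C40 H4] := fresnel_comb_le n0 n1.
exists (C1 + C2 + 2 * C3 + 2 * C4); first lra.
move=> s s0; have [a1 a2 _ _] := H1 s s0; have [b1 b2 _ _] := H2 s s0.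
have [_ _ c1 c2] := H3 s s0; have [_ _ d1 d2] := H4 s s0.
rewrite -fresnelA1E in a1 a2; rewrite -fresnelA2E in b1 b2.
have m1 := @LW_gxw s 1 0 n1 n0.
have m2 := @LW_gxw s 0 1 n0 n1.
have [D1 D2] := is_derive_fresnelA s.
have E1 : s * fresnelA2 s - 1 = - 2 *
    \int[mu]_(w in W) (w * gx s w * (1 * cos (s * w) + 0 * sin (s * w))).
  have H := @is_derive_gx_comb 1 (-1) s n1 nN1.
  have E : fresnelA1 = fun s => \int[mu]_(w in W) (1 * gx s w * (1 * cos (s * w) + (-1) * sin (s * w))).
    by apply/funext => s'; exact: fresnelA1E.
  have <- : 'D_1 fresnelA1 s = s * fresnelA2 s - 1 by case: D1.
  rewrite E; case: H => _ ->; rewrite -RintegralZl //.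
  apply: eq_Rintegral => w _; ring.
have E2 : - s * fresnelA1 s = - 2 *
    \int[mu]_(w in W) (w * gx s w * (0 * cos (s * w) + 1 * sin (s * w))).
  have H := @is_derive_gx_comb 1 1 s n1 n1.
  have E : fresnelA2 = fun s => \int[mu]_(w in W) (1 * gx s w * (1 * cos (s * w) + 1 * sin (s * w))).
    by apply/funext => s'; exact: fresnelA2E.
  have <- : 'D_1 fresnelA2 s = - s * fresnelA1 s by case: D2.
  rewrite E; case: H => _ ->; rewrite -RintegralZl //.
  apply: eq_Rintegral => w _; ring.
rewrite E1 E2 !normrM normrN normr_nat ![s ^+ 2 * (2 * _)]mulrCA.
have [hC1 hC2] : C1 <= C1 + C2 + 2 * C3 + 2 * C4 /\ C2 <= C1 + C2 + 2 * C3 + 2 * C4.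
  by clear - C10 C20 C30 C40; split; lra.
have [hC3 hC4] : 2 * C3 <= C1 + C2 + 2 * C3 + 2 * C4 /\ 2 * C4 <= C1 + C2 + 2 * C3 + 2 * C4.
  by clear - C10 C20 C30 C40; split; lra.
split; [exact: le_trans hC1|exact: le_trans hC2|exact: le_trans hC1|exact: le_trans hC2|].
by split; [apply: le_trans hC3|apply: le_trans hC4|apply: le_trans hC3|apply: le_trans hC4];
  exact: ler_wpM2l.
Qed.

Lemma fresnelA0 : fresnelA1 0 = Num.sqrt pi / 2 /\ fresnelA2 0 = Num.sqrt pi / 2.
Proof.
have E : \int[mu]_(w in W) expR (- w ^+ 2) = Num.sqrt pi / 2 :> R.
  by rewrite /Rintegral (@integral0y_gauss R).
by split; rewrite -E; apply: eq_Rintegral => w _;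
  rewrite /gx oppr0 !mul0r addr0 cos0 sin0 ?subr0 ?addr0 mulr1.
Qed.

End FresnelKernel.

(** * Fresnel tails, their primitives, and the oscillatory integral in L^2 *)

Section FresnelRecord.
Context {R : realType}.
Local Notation mu := (@lebesgue_measure R).
Local Notation L1 f := (mu.-integrable setT (EFin \o f)).
Local Notation I f := (Rintegral mu setT f).
Implicit Types (f g c k m : R -> R) (A C s x xi t : R).

(* For [c = cos (s^2/2)] and [c = sin (s^2/2)], [k] is the primitive of [- c]
   vanishing at infinity and [m] that of [- k]. *)
Record fresnel_kernel c k m C : Prop := FresnelKernel {
  fk_ge0 : 0 <= C;
  fk_cont : continuous c;
  fk_le1 : forall s, `|c s| <= 1;
  fk_even : forall s, c (- s) = c s;
  fk_k : forall s, is_derive s (1 : R) k (- c s);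
  fk_m : forall s, is_derive s (1 : R) m (- k s);
  fk_k0 : k 0 = Num.sqrt pi / 2;
  fk_k_le : forall s, 0 <= s -> `|k s| <= C /\ s * `|k s| <= C;
  fk_m_le : forall s, 0 <= s -> `|m s| <= C /\ s ^+ 2 * `|m s| <= C;
  fk_L2 : forall t f A, 0 < t -> L1 f -> L2le f A ->
    L2le (fun x => I (fun xi => f xi * c ((t * xi - x) / Num.sqrt t))) (C * A)
}.

Lemma half_sqr_phase t xi x : 0 < t ->
  ((t * xi - x) / Num.sqrt t) ^+ 2 / 2 =
  (t * xi ^+ 2 / 2 - x * xi) + x ^+ 2 / (2 * t).
Proof.
move=> t0; rewrite expr_div_n sqr_sqrtr ?ltW //; field.
by rewrite gt_eqF.
Qed.

(** Completing the square splits the phase into a chirp in [xi], absorbed in [f], a chirp in [x],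
    factored out, and [x * xi], left to [plancherel]. Each of the two regroupings of cosines and
    sines multiplies the constant 16 by 4, hence 256. *)
Lemma quadratic_phase_L2 t f A : 0 < t -> L1 f -> L2le f A ->
  L2le (fun x => I (fun xi => f xi * cos (((t * xi - x) / Num.sqrt t) ^+ 2 / 2)))
    (256 * kb * A) /\
  L2le (fun x => I (fun xi => f xi * sin (((t * xi - x) / Num.sqrt t) ^+ 2 / 2)))
    (256 * kb * A).
Proof.
move=> t0 lf hf; have mf := L1_measurable lf.
pose th xi := t * xi ^+ 2 / 2.
pose be x := x ^+ 2 / (2 * t).
have mth : measurable_fun setT th.
  by apply: measurable_funM => //; apply: measurable_funM => //; exact: measurable_funX.
have mbe : measurable_fun setT be by apply: measurable_funM => //; exact: measurable_funX.
have mct : measurable_fun setT (fun xi => cos (th xi)).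
  by apply: measurableT_comp => //; exact: measurable_cos.
have mst : measurable_fun setT (fun xi => sin (th xi)).
  by apply: measurableT_comp => //; exact: measurable_sin.
have mcb : measurable_fun setT (fun xi => cos (be xi)).
  by apply: measurableT_comp => //; exact: measurable_cos.
have msb : measurable_fun setT (fun xi => sin (be xi)).
  by apply: measurableT_comp => //; exact: measurable_sin.
pose fc xi := f xi * cos (th xi); pose fs xi := f xi * sin (th xi).
have lfc : L1 fc by apply: (L1_Ml lf mct) => xi; exact: cos_norm_le1.
have lfs : L1 fs by apply: (L1_Ml lf mst) => xi; exact: sin_norm_le1.
have hfc : L2le fc A by apply: (L2le_Mb hf mct) => xi; exact: cos_norm_le1.
have hfs : L2le fs A by apply: (L2le_Mb hf mst) => xi; exact: sin_norm_le1.
have [pc1 pc2] := plancherel lfc hfc; have [ps1 ps2] := plancherel lfs hfs.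
pose X x := CT fc x + ST fs x; pose Y x := CT fs x - ST fc x.
have hX : L2le X (64 * kb * A).
  by apply: L2leW (L2leD pc1 ps2); rewrite -!mulrA; lra.
have hY : L2le Y (64 * kb * A).
  by apply: L2leW (L2leB ps1 pc2); rewrite -!mulrA; lra.
have XE x : I (fun xi => f xi * cos (th xi - x * xi)) = X x.
  rewrite /X /CT /ST -ID; [|exact: L1_Mcos|exact: L1_Msin].
  by apply: eq_Rintegral => xi _; rewrite cosB /fc /fs; ring.
have YE x : I (fun xi => f xi * sin (th xi - x * xi)) = Y x.
  rewrite /Y /CT /ST -IB; [|exact: L1_Mcos|exact: L1_Msin].
  by apply: eq_Rintegral => xi _; rewrite sinB /fc /fs; ring.
have mlin x : measurable_fun setT (fun xi => th xi - x * xi).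
  by apply: measurable_funB => //; exact: measurable_funM.
have lX x : L1 (fun xi => f xi * cos (th xi - x * xi)).
  apply: (L1_Ml lf) => [|xi]; last exact: cos_norm_le1.
  by apply: measurableT_comp => //; exact: measurable_cos.
have lY x : L1 (fun xi => f xi * sin (th xi - x * xi)).
  apply: (L1_Ml lf) => [|xi]; last exact: sin_norm_le1.
  by apply: measurableT_comp => //; exact: measurable_sin.
have hXc : L2le (fun x => X x * cos (be x)) (64 * kb * A).
  by apply: (L2le_Mb hX mcb) => x; exact: cos_norm_le1.
have hXs : L2le (fun x => X x * sin (be x)) (64 * kb * A).
  by apply: (L2le_Mb hX msb) => x; exact: sin_norm_le1.
have hYc : L2le (fun x => Y x * cos (be x)) (64 * kb * A).
  by apply: (L2le_Mb hY mcb) => x; exact: cos_norm_le1.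
have hYs : L2le (fun x => Y x * sin (be x)) (64 * kb * A).
  by apply: (L2le_Mb hY msb) => x; exact: sin_norm_le1.
split.
- have -> : (fun x => I (fun xi => f xi * cos (((t * xi - x) / Num.sqrt t) ^+ 2 / 2))) =
    (fun x => X x * cos (be x) - Y x * sin (be x)).
    apply/funext => x; rewrite -XE -YE [_ * cos _]mulrC [_ * sin (be x)]mulrC.
    rewrite -!IZ // -IB; [|exact: L1Z|exact: L1Z].
    apply: eq_Rintegral => xi _; rewrite half_sqr_phase // cosD; ring.
  by apply: L2leW (L2leB hXc hYs); rewrite -!mulrA; lra.
- have -> : (fun x => I (fun xi => f xi * sin (((t * xi - x) / Num.sqrt t) ^+ 2 / 2))) =
    (fun x => Y x * cos (be x) + X x * sin (be x)).
    apply/funext => x; rewrite -XE -YE [_ * cos _]mulrC [_ * sin (be x)]mulrC.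
    rewrite -!IZ // -ID; [|exact: L1Z|exact: L1Z].
    apply: eq_Rintegral => xi _; rewrite half_sqr_phase // sinD; ring.
  by apply: L2leW (L2leD hYc hXs); rewrite -!mulrA; lra.
Qed.

(** With [A = A1 + i A2], [fres_k1 + i fres_k2] is [exp (i s^2 / 2) A], the Fresnel tail itself, and
    [fres_m1 + i fres_m2] is [- i exp (i s^2 / 2) A']. Differentiating [A' = - i s A - 1] once more
    shows that the latter is a primitive of minus the former, so no further integral is needed to
    define it. *)
Definition fres_k1 s : R :=
  cos (s ^+ 2 / 2) * fresnelA1 s - sin (s ^+ 2 / 2) * fresnelA2 s.
Definition fres_k2 s : R :=
  cos (s ^+ 2 / 2) * fresnelA2 s + sin (s ^+ 2 / 2) * fresnelA1 s.
Definition fres_m1 s : R :=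
  cos (s ^+ 2 / 2) * (- s * fresnelA1 s) + sin (s ^+ 2 / 2) * (s * fresnelA2 s - 1).
Definition fres_m2 s : R :=
  sin (s ^+ 2 / 2) * (- s * fresnelA1 s) - cos (s ^+ 2 / 2) * (s * fresnelA2 s - 1).

Lemma rot_le (u v a b C : R) : 0 <= C -> `|u| <= 1 -> `|v| <= 1 -> `|a| <= C -> `|b| <= C ->
  `|u * a + v * b| <= 2 * C.
Proof.
move=> C0 u1 v1 aC bC; apply: (le_trans (ler_normD _ _)); rewrite !normrM.
have h1 : `|u| * `|a| <= C by apply: le_trans aC; rewrite ler_piMl.
have h2 : `|v| * `|b| <= C by apply: le_trans bC; rewrite ler_piMl.
lra.
Qed.

Lemma rot_le_scale (s u v a b C : R) : 0 <= s -> `|u| <= 1 -> `|v| <= 1 ->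
  s * `|a| <= C -> s * `|b| <= C -> s * `|u * a + v * b| <= 2 * C.
Proof.
move=> s0 u1 v1 aC bC.
have C0 : 0 <= C by apply: le_trans aC; rewrite mulr_ge0.
have -> : s * `|u * a + v * b| = `|u * (s * a) + v * (s * b)|.
  by rewrite -{1}(ger0_norm s0) -normrM; congr (`|_|); ring.
by apply: rot_le => //; rewrite normrM ger0_norm.
Qed.

Lemma exists_fresnel_kernels : exists C,
  fresnel_kernel (fun s => cos (s ^+ 2 / 2)) fres_k1 fres_m1 C /\
  fresnel_kernel (fun s => sin (s ^+ 2 / 2)) fres_k2 fres_m2 C.
Proof.
have [C C0 HC] := @fresnelA_bound R.
have [A10 A20] := @fresnelA0 R.
have kb0 := @kb_ge0 R.
have cq : continuous (fun s : R => s ^+ 2 / 2).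
  by move=> s; apply: cvgM; [exact: exprn_continuous|exact: cvg_cst].
have c1 (s : R) := cos_norm_le1 (s ^+ 2 / 2).
have s1 (s : R) := sin_norm_le1 (s ^+ 2 / 2).
have sN1 (s : R) : `|- sin (s ^+ 2 / 2)| <= 1 by rewrite normrN.
have cN1 (s : R) : `|- cos (s ^+ 2 / 2)| <= 1 by rewrite normrN.
have bk s : 0 <= s -> [/\ `|fres_k1 s| <= 2 * C, s * `|fres_k1 s| <= 2 * C,
    `|fres_k2 s| <= 2 * C & s * `|fres_k2 s| <= 2 * C].
  move=> s0; have [a1 a2 a3 a4 _] := HC s s0.
  by split; rewrite /fres_k1 /fres_k2 -?mulNr; [apply: rot_le|apply: rot_le_scale|
    apply: rot_le|apply: rot_le_scale].
have bm s : 0 <= s -> [/\ `|fres_m1 s| <= 2 * C, s ^+ 2 * `|fres_m1 s| <= 2 * C,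
    `|fres_m2 s| <= 2 * C & s ^+ 2 * `|fres_m2 s| <= 2 * C].
  move=> s0; have [_ _ _ _ [a1 a2 a3 a4]] := HC s s0.
  by split; rewrite /fres_m1 /fres_m2 -?[- (cos _ * _)]mulNr; [apply: rot_le|apply: rot_le_scale|
    apply: rot_le|apply: rot_le_scale]; rewrite ?sqr_ge0.
have dq s : is_derive s (1 : R) (fun s : R => s ^+ 2 / 2) s.
  by apply: is_derive_eq; rewrite /GRing.scale /=; field.
(* [2 * C] bounds the kernels and [256 * kb] the oscillatory integral. *)
exists (2 * C + 256 * kb); split; split.
- lra.
- by move=> s; apply: continuous_comp; [exact: cq|exact: continuous_cos].
- exact: c1.
- by move=> s; rewrite sqrrN.
- move=> s; have [D1 D2] := is_derive_fresnelA s.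
  by apply: is_derive_eq; rewrite /GRing.scale /=; ring.
- move=> s; have [D1 D2] := is_derive_fresnelA s.
  by apply: is_derive_eq; rewrite /fres_k1 /GRing.scale /=; ring.
- by rewrite /fres_k1 expr0n /= !mul0r cos0 sin0 mul0r subr0 mul1r.
- by move=> s /bk[a b _ _]; split; lra.
- by move=> s /bm[a b _ _]; split; lra.
- move=> t f A t0 lf hf; have [h _] := quadratic_phase_L2 t0 lf hf.
  by apply: L2leW h; rewrite ler_wpM2r ?(L2le_ge0 hf) //; lra.
- lra.
- by move=> s; apply: continuous_comp; [exact: cq|exact: continuous_sin].
- exact: s1.
- by move=> s; rewrite sqrrN.
- move=> s; have [D1 D2] := is_derive_fresnelA s.
  by apply: is_derive_eq; rewrite /GRing.scale /=; ring.
- move=> s; have [D1 D2] := is_derive_fresnelA s.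
  by apply: is_derive_eq; rewrite /fres_k2 /GRing.scale /=; ring.
- by rewrite /fres_k2 expr0n /= !mul0r cos0 sin0 mul0r addr0 mul1r.
- by move=> s /bk[_ _ a b]; split; lra.
- by move=> s /bm[_ _ a b]; split; lra.
- move=> t f A t0 lf hf; have [_ h] := quadratic_phase_L2 t0 lf hf.
  by apply: L2leW h; rewrite ler_wpM2r ?(L2le_ge0 hf) //; lra.
Qed.

End FresnelRecord.

(** * Absolutely continuous functions *)

Section AbsolutelyContinuous.
Context {R : realType}.
Local Notation mu := (@lebesgue_measure R).
Local Notation L1 f := (mu.-integrable setT (EFin \o f)).
Local Notation I f := (Rintegral mu setT f).
Implicit Types (f g h F G : R -> R) (a b c A B s x y : R).

(** Real-valued, so that truncation is a multiplication; it is zero when [b < a]. *)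
Definition ind a b x : R := ((a <= x <= b)%R)%:R.

Lemma ind_ge0 a b x : 0 <= ind a b x. Proof. exact: ler0n. Qed.
Lemma ind_le1 a b x : ind a b x <= 1. Proof. by rewrite /ind; case: (_ <= _ <= _). Qed.
Lemma ind_norm a b x : `|ind a b x| <= 1.
Proof. by rewrite ger0_norm ?ind_ge0 // ind_le1. Qed.
Hint Resolve ind_ge0 ind_le1 ind_norm : core.

Lemma Rintegral_ind a b f :
  \int[mu]_(x in `[a, b]) f x = I (fun x => ind a b x * f x).
Proof.
rewrite Rintegral_mkcond; apply: eq_Rintegral => x _.
rewrite patchE /ind mem_setE /= in_itv /=.
by case: (_ <= _ <= _); rewrite ?mul1r ?mul0r.
Qed.

Lemma measurable_ind a b : measurable_fun setT (ind a b).
Proof.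
have -> : ind a b = \1_(`[a, b]%classic : set R).
  by apply/funext => x; rewrite indicE mem_setE /= in_itv.
exact: measurable_indic.
Qed.
Hint Resolve measurable_ind : core.

Lemma measurable_ind2 (u v : R * R -> R) : measurable_fun setT u -> measurable_fun setT v ->
  measurable_fun setT (fun z => ((u z <= v z)%R)%:R : R).
Proof.
move=> mu_ mv; pose D := [set z | u z <= v z].
have mD : measurable D.
  have -> : D = [set z | 0 <= v z - u z].
    by apply/seteqP; split => z /=; rewrite /D /= subr_ge0.
  have := @measurable_funB _ _ _ _ _ _ mv mu_ measurableT `[0, +oo[%classic.
  rewrite setTI => /(_ (measurable_itv _)); congr measurable.
  by apply/seteqP; split => z /=; rewrite in_itv /= andbT.
have -> : (fun z => ((u z <= v z)%R)%:R : R) = \1_D.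
  by apply/funext => z; rewrite indicE mem_setE.
exact: measurable_indic.
Qed.

Lemma L1_ind a b : L1 (ind a b).
Proof.
have : L1 (\1_(`[a, b]%classic : set R)) by exact: integrable_indic_itv.
by apply: eq_integrable => // x _; rewrite /= indicE mem_setE /= in_itv.
Qed.

Lemma I_ind a b : a <= b -> I (ind a b) = b - a.
Proof.
move=> ab; have E : (fun x => ind a b x) = (fun x => ind a b x * 1).
  by apply/funext => x; rewrite mulr1.
rewrite [X in Rintegral _ _ X]E -Rintegral_ind.
have d x : is_derive x (1 : R) (id : R -> R) 1 by exact: is_derive_id.
by rewrite (Rintegral_ftc d) // => x; exact: cvg_cst.
Qed.

Lemma L2le_ind a b : a <= b -> L2le (ind a b) (b - a).
Proof.
move=> ab.
have E : (fun x => ind a b x ^+ 2) = ind a b.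
  by apply/funext => x; rewrite /ind -natrX; case: (_ <= _ <= _).
by apply: L2le_I => //; rewrite E; [exact: L1_ind|rewrite I_ind].
Qed.

Lemma I_eq_off1 f g y : measurable_fun setT f -> measurable_fun setT g ->
  (forall x, x != y -> f x = g x) -> I f = I g.
Proof.
move=> mf mg fg; rewrite /Rintegral; congr fine.
apply: ae_eq_integral => //; try exact/measurable_EFinP.
exists [set y]; split => //; first exact: lebesgue_measure_set1.
move=> x /= H; apply: contrapT => /eqP xy; apply: H => _.
by rewrite fg.
Qed.

Lemma L2le_ind_L1 f A a b : a <= b -> L2le f A ->
  L1 (fun x => ind a b x * f x) /\
  I (fun x => `|ind a b x * f x|) <= Num.sqrt ((b - a) * A).
Proof. by move=> ab hf; exact: (L2le_mul (L2le_ind ab) hf). Qed.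

Lemma L2le_indM a b f A : L2le f A -> L2le (fun x => ind a b x * f x) A.
Proof.
move=> hf; under eq_fun do rewrite mulrC.
exact: L2le_Mb.
Qed.

(* The function [f] is absolutely continuous with derivative [f'] (almost
   everywhere), and [f], [f'] have squared L^2 norms at most [A], [B]. *)
Record H1fun f f' A B : Prop := H1Fun {
  h1_f : L2le f A;
  h1_f' : L2le f' B;
  h1_ftc : forall a b, a <= b -> f b - f a = I (fun x => ind a b x * f' x)
}.

Lemma h1_holder f f' A B a b : H1fun f f' A B -> a <= b ->
  `|f b - f a| <= I (fun x => `|ind a b x * f' x|) /\
  `|f b - f a| <= Num.sqrt ((b - a) * B).
Proof.
move=> hf ab; rewrite (h1_ftc hf) //.
have [l i] := L2le_ind_L1 ab (h1_f' hf).
have h : `|I (fun x => ind a b x * f' x)| <= I (fun x => `|ind a b x * f' x|).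
  by apply: I_norm_le => //; exact: L1_abs.
by split => //; exact: le_trans i.
Qed.

Lemma h1_continuous f f' A B : H1fun f f' A B -> continuous f.
Proof.
move=> hf x; have B0 := L2le_ge0 (h1_f' hf).
apply/cvgrPdist_le => e e0.
have key y : `|x - y| <= e ^+ 2 / (B + 1) -> `|f x - f y| <= e.
  have B1 : 0 < B + 1 by lra.
  have S u v : u <= v -> v - u <= e ^+ 2 / (B + 1) -> `|f v - f u| <= e.
    move=> uv h; have [_ H] := h1_holder hf uv; apply: (le_trans H).
    rewrite -[X in _ <= X](ger0_norm (ltW e0)) -sqrtr_sqr ler_wsqrtr //.
    rewrite ler_pdivlMr // in h; apply: le_trans h.
    by rewrite ler_wpM2l ?subr_ge0 //; lra.
  case: (lerP y x) => yx h; first exact: S.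
  rewrite distrC; apply: S; first exact: ltW.
  exact: h.
near=> y; apply: key; near: y.
have d0 : 0 < e ^+ 2 / (B + 1) by rewrite divr_gt0 ?exprn_gt0 //; lra.
have := @cvgrPdist_le _ _ _ (nbhs x) _ id x.
by case=> [+ _]; apply; [exact: cvg_id|].
Unshelve. all: end_near. Qed.

(** Averaging over [[x, x + 1]]: there [f y] differs from [f x] by at most [sqrt B]. *)
Lemma h1_sup f f' A B x : H1fun f f' A B -> f x ^+ 2 <= 2 * A + 2 * B.
Proof.
move=> hf; have [lf iA] := L2le_sqr (h1_f hf).
have B0 := L2le_ge0 (h1_f' hf).
have x1 : x <= x + 1 by lra.
have -> : f x ^+ 2 = I (fun y => f x ^+ 2 * ind x (x + 1) y).
  by rewrite IZ ?I_ind //; [ring|exact: L1_ind].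
apply: (@le_trans _ _ (I (fun y => 2 * f y ^+ 2 + 2 * B * ind x (x + 1) y))).
  apply: I_le.
  - by apply: L1Z; exact: L1_ind.
  - by apply: L1D; apply: L1Z => //; exact: L1_ind.
  - move=> y; rewrite /ind; case: (boolP (x <= y <= x + 1)) => [/andP[xy yx]|_]; last first.
      by rewrite !mulr0 addr0 mulr_ge0 // sqr_ge0.
    have [_ h] := h1_holder hf xy.
    have : `|f y - f x| ^+ 2 <= B.
      apply: (@le_trans _ _ (Num.sqrt ((y - x) * B) ^+ 2)).
        by rewrite ler_sqr // nnegrE sqrtr_ge0.
      by rewrite sqr_sqrtr ?mulr_ge0 ?subr_ge0 // ler_piMl //; lra.
    rewrite real_normK ?num_real // !mulr1 => {}h.
    have := sqr_ge0 (f x - 2 * f y); nra.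
rewrite ID ?IZ //; [|exact: L1_ind|exact: L1Z|by apply: L1Z; exact: L1_ind].
by rewrite I_ind //; nra.
Qed.

Lemma L1_ind_continuous a b g : continuous g -> L1 (fun x => ind a b x * g x).
Proof.
move=> cg; have := L1_itv a b cg.
rewrite integrable_mkcond //; apply: eq_integrable => // x _.
rewrite /= patchE /ind mem_setE /= in_itv /=.
by case: (_ <= _ <= _); rewrite ?mul1r ?mul0r.
Qed.

Lemma I_ind_ftc F f a b : (forall x, is_derive x (1 : R) F (f x)) -> continuous f ->
  a <= b -> I (fun x => ind a b x * f x) = F b - F a.
Proof. by move=> dF cf ab; rewrite -Rintegral_ind (Rintegral_ftc dF). Qed.

Lemma L1_ind_L1 f a x b : x <= b -> L1 (fun s => ind a b s * f s) ->
  L1 (fun s => ind a x s * f s).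
Proof.
move=> xb lf.
have : L1 (fun s => (ind a b s * f s) * ind a x s).
  exact: (L1_Ml lf (measurable_ind a x) (ind_norm a x)).
apply: eq_integrable => // s _ /=; congr EFin.
rewrite mulrC mulrA; congr (_ * _); rewrite /ind.
case: (boolP (a <= s <= x)) => [/andP[as_ sx]|_]; last by rewrite mul0r.
by rewrite as_ (le_trans sx xb) mul1r.
Qed.

Lemma continuous_itv_bounded a b g : continuous g ->
  exists M, forall x, a <= x <= b -> `|g x| <= M.
Proof.
move=> cg; case: (leP a b) => ab; last first.
  by exists 0 => x /andP[ax xb]; move: (lt_le_trans ab (le_trans ax xb)); rewrite ltxx.
have cn : {within `[a, b], continuous (fun x => `|g x|)}.
  by apply: continuous_subspaceT => x; apply: cvg_norm; exact: cg.
have [c _ h] := EVT_max ab cn.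
by exists `|g c| => x xab; apply: h; rewrite in_itv.
Qed.

(** Fubini on the triangle [a <= s <= x <= b] for [f' s * g x]: integrating in [s] first gives
    [f x - f a], integrating in [x] first gives [G b - G s]. *)
Lemma ibp f f' G g a b : a <= b -> measurable_fun setT f -> measurable_fun setT f' ->
  L1 (fun x => ind a b x * f' x) ->
  (forall u v, u <= v -> f v - f u = I (fun x => ind u v x * f' x)) ->
  (forall x, is_derive x (1 : R) G (g x)) -> continuous g ->
  I (fun x => ind a b x * (f x * g x)) =
  f b * G b - f a * G a - I (fun x => ind a b x * (f' x * G x)).
Proof.
move=> ab mf mf' lf' ftc dG cg.
have lg : L1 (fun x => ind a b x * g x) by exact: L1_ind_continuous.
have mg : measurable_fun setT g by exact: continuous_measurable_fun.
have cG : continuous G.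
  move=> x; apply: differentiable_continuous; apply/derivable1_diffP.
  by have [] := dG x.
have mG : measurable_fun setT G by exact: continuous_measurable_fun.
pose H x s := (ind a b x * g x) * ((s <= x)%R%:R * (ind a b s * f' s)).
have mH : measurable_fun setT (fun z : R * R => H z.1 z.2).
  apply: measurable_funM.
    by apply: (@measurable_comp1 _ (fun x => ind a b x * g x)); exact: measurable_funM.
  apply: measurable_funM; first exact: measurable_ind2.
  by apply: (@measurable_comp2 _ (fun x => ind a b x * f' x)); exact: measurable_funM.
have Hle x s : `|H x s| <= `|ind a b x * g x| * `|ind a b s * f' s|.
  rewrite /H [X in X <= _]normrM ler_wpM2l // normrM ler_piMl //.
  by case: (s <= x); rewrite ?normr1 ?normr0.
have := @I_fubini _ H _ _ mH (L1_abs lg) (L1_abs lf') Hle.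
have -> : (fun x => I (H x)) = (fun x => (ind a b x * (f x * g x)) - f a * (ind a b x * g x)).
  apply/funext => x; rewrite /H.
  case: (boolP (a <= x <= b)) => xab; last first.
    have E : ind a b x = 0 by rewrite /ind (negbTE xab).
    rewrite E !mul0r mulr0 subr0; under eq_Rintegral do rewrite !mul0r.
    by rewrite Rintegral_cst // mul0r.
  have E : ind a b x = 1 by rewrite /ind xab.
  have /andP[ax xb] := xab.
  have E2 : (fun s => (s <= x)%R%:R * (ind a b s * f' s)) = (fun s => ind a x s * f' s).
    apply/funext => s; rewrite mulrA /ind; congr (_ * _).
    case: (leP s x) => sx; rewrite ?mul1r ?mul0r ?andbF ?andbT //.
    by rewrite (le_trans sx xb) andbT.
  rewrite IZ; last first.
    by rewrite E2; exact: L1_ind_L1 xb lf'.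
  by rewrite E2 -ftc // E; ring.
have -> : (fun s => I (H ^~ s)) = (fun s => G b * (ind a b s * f' s) - ind a b s * (f' s * G s)).
  apply/funext => s; rewrite /H.
  case: (boolP (a <= s <= b)) => sab; last first.
    have E : ind a b s = 0 by rewrite /ind (negbTE sab).
    rewrite E !mul0r mulr0 subr0; under eq_Rintegral do rewrite !mulr0.
    by rewrite Rintegral_cst // mul0r.
  have E : ind a b s = 1 by rewrite /ind sab.
  have /andP[as_ sb] := sab.
  have E2 : (fun x => ind a b x * g x * ((s <= x)%R%:R * (ind a b s * f' s))) =
      (fun x => f' s * (ind s b x * g x)).
    apply/funext => x; rewrite E mul1r.
    have -> : ind s b x = ind a b x * (s <= x)%R%:R.
      rewrite /ind; case: (leP s x) => sx; rewrite ?mulr1 ?mulr0 //=.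
      by rewrite (le_trans as_ sx).
    by ring.
  rewrite E2 IZ; last exact: L1_ind_continuous.
  by rewrite (I_ind_ftc dG) // E; ring.
have lfg : L1 (fun x => ind a b x * (f x * g x)).
  apply: (L1_le _ _ (L1Z (`|f a| + I (fun x => `|ind a b x * f' x|)) (L1_abs lg))).
    by apply: measurable_funM => //; exact: measurable_funM.
  move=> x; rewrite /ind; case: (boolP (a <= x <= b)) => [/andP[ax xb]|_]; last first.
    by rewrite !mul0r normr0 mulr0.
  rewrite !mul1r normrM ler_wpM2r //.
  have -> : f x = f a + (f x - f a) by ring.
  apply: (le_trans (ler_normD _ _)); rewrite lerD2l ftc //.
  apply: I_norm_le; [exact: L1_ind_L1 xb lf'|exact: L1_abs|move=> s].
  rewrite !normrM ler_wpM2r // /ind.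
  case: (boolP (a <= s <= x)) => [/andP[as_ sx]|_]; last by rewrite normr0.
  by rewrite as_ (le_trans sx xb).
have lf'G : L1 (fun x => ind a b x * (f' x * G x)).
  have [M GM] := continuous_itv_bounded a b cG.
  apply: (L1_le _ _ (L1Z M (L1_abs lf'))).
    by apply: measurable_funM => //; exact: measurable_funM.
  move=> x; have := GM x; rewrite /ind; case: (_ <= _ <= _) => [/(_ isT) h|_].
    by rewrite !mul1r normrM mulrC ler_wpM2r.
  by rewrite !mul0r normr0 mulr0.
rewrite !IB ?IZ //; [|exact: L1Z|exact: L1Z].
rewrite -ftc // (I_ind_ftc dG) // => h.
lra.
Qed.

End AbsolutelyContinuous.

(** * The error term of the stationary phase *)

Section FresnelRemainder.
Context {R : realType}.
Local Notation mu := (@lebesgue_measure R).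
Local Notation L1 f := (mu.-integrable setT (EFin \o f)).
Local Notation I f := (Rintegral mu setT f).
Implicit Types (f g h F G u v c k m : R -> R) (a b A B C s x y xi : R).

Lemma cvgn_unique (u : nat -> R) (l l' : R) :
  u n @[n --> \oo] --> l -> u n @[n --> \oo] --> l' -> l = l'.
Proof. by move=> h h'; rewrite -(cvg_lim _ h) // -(cvg_lim _ h'). Qed.

Lemma L2le_sqr_le f g : measurable_fun setT f -> L1 g -> (forall x, f x ^+ 2 <= g x) ->
  L2le f (I g).
Proof.
move=> mf lg fg.
have l : L1 (fun x => f x ^+ 2).
  apply: (L1_le _ _ lg); first exact: measurable_funX.
  by move=> x; rewrite ger0_norm ?sqr_ge0.
by apply: L2le_I => //; exact: I_le.
Qed.

Lemma reflectE f : (fun x => f (- x)) = (fun x => f ((-1) * x + 0)).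
Proof. by apply/funext => x; rewrite mulN1r addr0. Qed.

Lemma N1_neq0 : (-1 : R) != 0. Proof. by rewrite oppr_eq0 oner_neq0. Qed.

Lemma I_reflect f : measurable_fun setT f -> I (fun x => f (- x)) = I f.
Proof.
move=> mf; rewrite reflectE Rintegral_affine ?N1_neq0 //.
by rewrite normrN1 invr1 mul1r.
Qed.

Lemma L2le_reflect f A : L2le f A -> L2le (fun x => f (- x)) A.
Proof.
move=> hf; rewrite reflectE; have := L2le_affine 0 N1_neq0 hf.
by rewrite normrN1 invr1 mul1r.
Qed.

Lemma ind_reflect a b x : ind a b (- x) = ind (- b) (- a) x.
Proof. by rewrite /ind lerNr lerNl andbC. Qed.

Lemma h1_reflect f f' A B : H1fun f f' A B ->
  H1fun (fun x => f (- x)) (fun x => - f' (- x)) A B.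
Proof.
move=> hf; have [hA hB ftc] := hf; split; first exact: L2le_reflect.
  by apply: L2leN; exact: L2le_reflect.
move=> a b ab.
have ab' : - b <= - a by rewrite lerN2.
have [l _] := L2le_ind_L1 ab' hB.
have -> : f (- b) - f (- a) = - (f (- a) - f (- b)) by ring.
rewrite ftc // -IN // -I_reflect; last first.
  by apply: measurable_funN; exact: L1_measurable l.
by apply: eq_Rintegral => x _; rewrite ind_reflect !opprK; ring.
Qed.

(** The bounds on the Fresnel kernels hold on the positive half line only; the cut makes them square
    integrable on the whole line. *)
Definition hv u s : R := (0 <= s)%R%:R * u s.

Lemma measurable_hv u : continuous u -> measurable_fun setT (hv u).
Proof.
move=> cu; apply: measurable_funM; last exact: continuous_measurable_fun.
have -> : (fun s => (0 <= s)%R%:R : R) = \1_(`[0, +oo[%classic : set R).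
  by apply/funext => s; rewrite indicE mem_setE /= in_itv /= andbT.
exact: measurable_indic.
Qed.

Definition decaying u C := forall s, 0 <= s -> `|u s| <= C /\ s * `|u s| <= C.

Lemma L2le_hv u C : continuous u -> decaying u C -> L2le (hv u) (2 * C ^+ 2 * kb).
Proof.
move=> cu du; rewrite /kb -IZ; last exact: L1_oneDsqrV.
apply: L2le_sqr_le; first exact: measurable_hv.
  by apply: L1Z; exact: L1_oneDsqrV.
move=> s; have s1 : 0 < 1 + s ^+ 2 by rewrite ltr_wpDr ?sqr_ge0.
rewrite /hv; case: (leP 0 s) => s0; last first.
  by rewrite mul0r expr0n /= mulr_ge0 ?invr_ge0 ?(ltW s1) // mulr_ge0 ?sqr_ge0.
rewrite mul1r ler_pdivlMr //; have [h1 h2] := du s s0.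
have e1 : u s ^+ 2 <= C ^+ 2 by exact: sqr_le_norm.
have e2 : (s * u s) ^+ 2 <= C ^+ 2.
  by apply: sqr_le_norm; rewrite normrM ger0_norm.
by rewrite exprMn in e2; nra.
Qed.

Section FixedTime.
Variable t : R.
Hypothesis t0 : 0 < t.
Let st0 : 0 < Num.sqrt t. Proof. by rewrite sqrtr_gt0. Qed.
Let st_neq0 : Num.sqrt t != 0. Proof. by rewrite gt_eqF. Qed.
Let t_neq0 : t != 0. Proof. by rewrite gt_eqF. Qed.
Let stE : Num.sqrt t * Num.sqrt t = t.
Proof. by rewrite -expr2 sqr_sqrtr // ltW. Qed.

(** The phase [(t xi - x)^2 / (2 t)] is [sig x xi ^+ 2 / 2], stationary at the zero [x / t] of
    [sig x]. *)
Definition sig x xi : R := (t * xi - x) / Num.sqrt t.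

Lemma sig_affine x xi : sig x xi = Num.sqrt t * xi + - (x / Num.sqrt t).
Proof. by rewrite /sig mulrBl -{1}stE; field. Qed.

Lemma sig_center x : sig x (x / t) = 0.
Proof. by rewrite /sig; field; rewrite st_neq0. Qed.

Lemma sig_ge0 x xi : (0 <= sig x xi) = (x / t <= xi).
Proof. by rewrite /sig pmulr_lge0 ?invr_gt0 // subr_ge0 ler_pdivrMr // mulrC. Qed.

Lemma sigN x xi : sig (- x) (- xi) = - sig x xi.
Proof. by rewrite /sig; field. Qed.

Lemma is_derive_sig x xi : is_derive xi (1 : R) (sig x) (Num.sqrt t).
Proof.
have -> : sig x = fun xi => Num.sqrt t * xi + - (x / Num.sqrt t).
  by apply/funext => z; rewrite sig_affine.
by apply: is_derive_eq; rewrite /GRing.scale /=; ring.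
Qed.

Lemma continuous_sig x : continuous (sig x).
Proof.
move=> xi; apply: differentiable_continuous; apply/derivable1_diffP.
by have [] := is_derive_sig x xi.
Qed.

Lemma measurable_sig x : measurable_fun setT (sig x).
Proof. by apply: continuous_measurable_fun; exact: continuous_sig. Qed.

Lemma L2le_sig f A x : L2le f A -> L2le (fun xi => f (sig x xi)) ((Num.sqrt t)^-1 * A).
Proof.
move=> hf; have := L2le_affine (- (x / Num.sqrt t)) st_neq0 hf.
rewrite gtr0_norm //; congr L2le.
by apply/funext => xi; rewrite sig_affine.
Qed.

Lemma sig_cvg_pinfty x (M : R) : \forall n \near \oo, M <= sig x n%:R.
Proof.
near=> n; rewrite /sig ler_pdivlMr // lerBrDr -ler_pdivrMl //.
by near: n; exact: nbhs_infty_ger.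
Unshelve. all: end_near. Qed.

Lemma cvg_truncated_hv f u x : L1 (fun xi => f xi * hv u (sig x xi)) ->
  measurable_fun setT f -> continuous u ->
  I (fun xi => ind (x / t) n%:R xi * (f xi * u (sig x xi))) @[n --> \oo] -->
  I (fun xi => f xi * hv u (sig x xi)).
Proof.
move=> l mf cu.
have mus : measurable_fun setT (fun xi => u (sig x xi)).
  by apply: measurableT_comp; [exact: continuous_measurable_fun|exact: measurable_sig].
apply: (@I_dominated _ _ _ (fun xi => `|f xi * hv u (sig x xi)|)).
- by move=> n; apply: measurable_funM; [exact: measurable_ind|exact: measurable_funM].
- exact: L1_measurable l.
- exact: L1_abs.
- move=> n xi; rewrite /hv /ind sig_ge0; case: (x / t <= xi); rewrite /=.
    by case: (xi <= _); rewrite ?mul1r ?mul0r ?normr0.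
  by rewrite !mul0r normr0.
- move=> xi; apply: cvg_near_cst; near=> n.
  rewrite /hv /ind sig_ge0.
  have -> : xi <= n%:R by near: n; exact: nbhs_infty_ger.
  by rewrite andbT mulrCA.
Unshelve. all: end_near. Qed.

Lemma cvg_boundary f u C M x : decaying u C -> (forall x, `|f x| <= M) ->
  f n%:R * u (sig x n%:R) @[n --> \oo] --> (0 : R).
Proof.
move=> du fM; apply/cvgr0Pnorm_le => e e0.
have M0 : 0 <= M by apply: le_trans (fM 0).
have C0 : 0 <= C by have [h _] := du 0 (lexx _); apply: le_trans h.
near=> n.
have h : M * C / e + 1 <= sig x n%:R by near: n; exact: sig_cvg_pinfty.
have p : 0 < sig x n%:R.
  by apply: lt_le_trans h; rewrite ltr_wpDl // divr_ge0 ?mulr_ge0 // ltW.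
have [_ d] := du _ (ltW p).
rewrite normrM -(ler_pM2l p) mulrCA.
apply: (@le_trans _ _ (M * C)).
  by apply: ler_pM => //; rewrite mulr_ge0 // ltW.
rewrite -ler_pdivrMr //; apply: le_trans h; lra.
Unshelve. all: end_near. Qed.

Lemma h1_bounded f f' A B x : H1fun f f' A B -> `|f x| <= Num.sqrt (2 * A + 2 * B).
Proof.
by move=> hf; rewrite -(sqrtr_sqr (f x)) ler_wsqrtr // (h1_sup _ hf).
Qed.

Section HalfLine.
Variables (u v : R -> R) (C : R).
Hypotheses (du : forall s, is_derive s (1 : R) u (- v s)) (cv : continuous v)
  (decu : decaying u C).

Let cu : continuous u.
Proof.
move=> s; apply: differentiable_continuous; apply/derivable1_diffP.
by have [] := du s.
Qed.

Lemma L1_hv f A x : L2le f A -> L1 (fun xi => f xi * hv u (sig x xi)).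
Proof. by move=> hf; have [] := L2le_mul hf (L2le_sig x (L2le_hv cu decu)). Qed.

Lemma ibp_sig f f' A B x a b : H1fun f f' A B -> a <= b ->
  Num.sqrt t * I (fun xi => ind a b xi * (f xi * v (sig x xi))) =
  f a * u (sig x a) - f b * u (sig x b) + I (fun xi => ind a b xi * (f' xi * u (sig x xi))).
Proof.
move=> hf ab; have [[mf _] hB ftc] := hf.
have [lf' _] := L2le_ind_L1 ab hB.
have d xi : is_derive xi (1 : R) (fun xi => u (sig x xi)) (- Num.sqrt t * v (sig x xi)).
  have := is_derive_sig x xi => ds.
  by apply: is_derive_eq; ring.
have cg : continuous (fun xi => - Num.sqrt t * v (sig x xi)).
  move=> xi; apply: cvgM; first exact: cvg_cst.
  by apply: continuous_comp; [exact: continuous_sig|exact: cv].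
have mf' := (h1_f' hf).1.
have := ibp ab mf mf' lf' ftc d cg.
have -> : (fun xi => ind a b xi * (f xi * (- Num.sqrt t * v (sig x xi)))) =
  (fun xi => - Num.sqrt t * (ind a b xi * (f xi * v (sig x xi)))).
  by apply/funext => xi; ring.
rewrite IZ => [h|]; last first.
  apply: L1_ind_continuous => xi; apply: cvgM; first exact: (h1_continuous hf).
  by apply: continuous_comp; [exact: continuous_sig|exact: cv].
lra.
Qed.

(** Stated for any decaying [u] with derivative [- v]: the pair [(k, c)] produces the main term, the
    pair [(m, k)] the second integration by parts. The boundary term at [n] vanishes because [f] is
    bounded and [u] decays. *)
Lemma cvg_right_half f f' A B x : H1fun f f' A B ->
  I (fun xi => ind (x / t) n%:R xi * (f xi * v (sig x xi))) @[n --> \oo] -->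
  (Num.sqrt t)^-1 * (f (x / t) * u 0 + I (fun xi => f' xi * hv u (sig x xi))).
Proof.
move=> hf.
have H : (Num.sqrt t)^-1 * (f (x / t) * u 0 - f n%:R * u (sig x n%:R) +
    I (fun xi => ind (x / t) n%:R xi * (f' xi * u (sig x xi)))) @[n --> \oo] -->
  (Num.sqrt t)^-1 * (f (x / t) * u 0 - 0 + I (fun xi => f' xi * hv u (sig x xi))).
  apply: cvgM; first exact: cvg_cst.
  apply: cvgD; last first.
    apply: cvg_truncated_hv => //; first exact: L1_hv (h1_f' hf).
    exact: (h1_f' hf).1.
  apply: cvgB; first exact: cvg_cst.
  exact: cvg_boundary decu (fun x => h1_bounded x hf).
rewrite subr0 in H; apply: cvg_trans H; apply: near_eq_cvg; near=> n.
have yn : x / t <= n%:R by near: n; exact: nbhs_infty_ger.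
have := ibp_sig x hf yn; rewrite sig_center => <-.
by rewrite mulKf.
Unshelve. all: end_near. Qed.

Lemma I_hv_reflect f' B x : L2le f' B ->
  I (fun xi => - f' (- xi) * hv u (sig (- x) xi)) =
  - I (fun xi => f' xi * hv u (- sig x xi)).
Proof.
move=> hB.
have l : L1 (fun xi => - f' (- xi) * hv u (sig (- x) xi)).
  exact: (L1_hv (- x) (L2leN (L2le_reflect hB))).
rewrite -I_reflect; last exact: L1_measurable l.
rewrite -IN; last first.
  have := integrable_affine 0 N1_neq0 (L1N l).
  by apply: eq_integrable => // xi _; rewrite /= mulN1r addr0 mulNr !opprK sigN.
by apply: eq_Rintegral => xi _; rewrite opprK sigN mulNr.
Qed.

(** This is the right half line for the reflected function at the point [- x]; the derivative
    changes sign under reflection. *)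
Lemma cvg_left_half f f' A B x : H1fun f f' A B ->
  I (fun xi => ind (- n%:R) (x / t) xi * (f xi * v (- sig x xi))) @[n --> \oo] -->
  (Num.sqrt t)^-1 * (f (x / t) * u 0 - I (fun xi => f' xi * hv u (- sig x xi))).
Proof.
move=> hf; have hr := h1_reflect hf.
have := cvg_right_half (x := - x) hr; rewrite mulNr opprK.
have mv : measurable_fun setT v by exact: continuous_measurable_fun.
have ms : measurable_fun setT (sig x) by exact: measurable_sig.
rewrite (I_hv_reflect x (h1_f' hf)).
apply: cvg_trans; apply: near_eq_cvg; apply: nearW => n.
rewrite -[LHS]I_reflect; last first.
  apply: measurable_funM; first exact: measurable_ind.
  apply: measurable_funM; first exact: (h1_f hr).1.
  by apply: measurableT_comp => //; exact: measurable_sig.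
apply: eq_Rintegral => xi _; rewrite ind_reflect opprK -sigN.
by rewrite opprK.
Qed.

End HalfLine.
Lemma I_ind_split g a y b : a <= y -> y <= b -> measurable_fun setT g ->
  L1 (fun x => ind a b x * g x) ->
  I (fun x => ind a b x * g x) =
  I (fun x => ind a y x * g x) + I (fun x => ind y b x * g x).
Proof.
move=> ay yb mg l.
have l1 := L1_ind_L1 yb l.
have l2 : L1 (fun x => ind y b x * g x).
  have : L1 (fun x => ind a b x * g x * ind y b x).
    exact: (L1_Ml l (measurable_ind y b) (ind_norm y b)).
  apply: eq_integrable => // x _ /=; congr EFin.
  rewrite mulrC mulrA; congr (_ * _); rewrite /ind.
  case: (boolP (y <= x <= b)) => [/andP[yx xb]|_]; last by rewrite mul0r.
  by rewrite xb (le_trans ay yx) mul1r.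
rewrite -ID //; apply: (@I_eq_off1 _ _ _ y).
- exact: L1_measurable l.
- exact: L1_measurable (L1D l1 l2).
- move=> x xy; rewrite -mulrDl; congr (_ * _); rewrite /ind.
  case: (ltgtP x y) (xy) => // h _.
    by rewrite (le_trans (ltW h) yb) andbT addr0.
  by rewrite (le_trans ay (ltW h)) andbF add0r.
Qed.

(** Odd extension of [k] from the positive half line: left of the stationary point the kernel is
    [k (- sig)], and the reflected derivative contributes the sign. *)
Definition kap k s : R := hv k s - hv k (- s).
Definition fresE k f' x : R := I (fun xi => f' xi * kap k (sig x xi)).

Section Kernel.
Variables (c k m : R -> R) (C : R).
Hypothesis K : fresnel_kernel c k m C.

Let ck : continuous k.
Proof.
move=> s; apply: differentiable_continuous; apply/derivable1_diffP.
by have [] := fk_k K s.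
Qed.

Let cm : continuous m.
Proof.
move=> s; apply: differentiable_continuous; apply/derivable1_diffP.
by have [] := fk_m K s.
Qed.

Let cc : continuous c. Proof. by case: K. Qed.

Let deck : decaying k C. Proof. exact: fk_k_le K. Qed.

Let decm : decaying m C.
Proof.
move=> s s0; have [h1 h2] := fk_m_le K s0; split => //.
case: (leP s 1) => s1; first by apply: le_trans h1; rewrite ler_piMl.
by apply: le_trans h2; rewrite ler_wpM2r // expr2 ler_peMr // ltW.
Qed.

Let C0 : 0 <= C. Proof. exact: fk_ge0 K. Qed.

Let L1_hv_left u f A x : continuous u -> decaying u C -> L2le f A ->
  L1 (fun xi => f xi * hv u (- sig x xi)).
Proof.
move=> cu du hf.
by have [] := L2le_mul hf (L2le_sig x (L2le_reflect (L2le_hv cu du))).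
Qed.

Lemma fresE_split f A x : L2le f A -> fresE k f x =
  I (fun xi => f xi * hv k (sig x xi)) - I (fun xi => f xi * hv k (- sig x xi)).
Proof.
move=> hf; rewrite -IB; [|exact (L1_hv (fk_k K) deck x hf)|exact: L1_hv_left hf].
by apply: eq_Rintegral => xi _; rewrite /kap mulrBr.
Qed.

Lemma L1_kap f A x : L2le f A -> L1 (fun xi => f xi * kap k (sig x xi)).
Proof.
move=> hf; have := L1B (L1_hv (fk_k K) deck x hf) (L1_hv_left x ck deck hf).
by apply: eq_integrable => // xi _ /=; rewrite /kap mulrBr.
Qed.

Lemma fresE_sub f g A B x : L2le f A -> L2le g B ->
  fresE k (fun y => f y - g y) x = fresE k f x - fresE k g x.
Proof.
move=> hf hg; rewrite -IB; [|exact: L1_kap hf|exact: L1_kap hg].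
by apply: eq_Rintegral => xi _; rewrite mulrBl.
Qed.

Lemma measurable_kap : measurable_fun setT (kap k).
Proof.
apply: measurable_funB; first exact: measurable_hv.
apply: (@measurableT_comp _ _ _ _ _ _ (hv k)); first exact: measurable_hv.
exact: measurable_funN.
Qed.

Lemma measurable_sig2 : measurable_fun setT (fun z : R * R => sig z.1 z.2).
Proof.
by apply: measurable_funM => //; apply: measurable_funB => //; exact: measurable_funM.
Qed.

Lemma measurable_fresE f' : measurable_fun setT f' -> measurable_fun setT (fresE k f').
Proof.
move=> mf; apply: (@measurable_I_param _ (fun x xi => f' xi * kap k (sig x xi))).
apply: measurable_funM; first exact: measurable_comp2.
by apply: measurableT_comp; [exact: measurable_kap|exact: measurable_sig2].
Qed.

(* Stationary phase: the two half lines each contribute [k 0 * f (x / t)]. *)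
Lemma cvg_fresnel f f' A B x : H1fun f f' A B ->
  I (fun xi => ind (- n%:R) n%:R xi * (f xi * c (sig x xi))) @[n --> \oo] -->
  (Num.sqrt t)^-1 * (Num.sqrt pi * f (x / t) + fresE k f' x).
Proof.
move=> hf; have mf := (h1_f hf).1.
have E : (Num.sqrt t)^-1 * (Num.sqrt pi * f (x / t) + fresE k f' x) =
  (Num.sqrt t)^-1 * (f (x / t) * k 0 - I (fun xi => f' xi * hv k (- sig x xi))) +
  (Num.sqrt t)^-1 * (f (x / t) * k 0 + I (fun xi => f' xi * hv k (sig x xi))).
  rewrite (fk_k0 K) (fresE_split x (h1_f' hf)); field; exact: st_neq0.
rewrite E; apply: (@cvg_trans _ ((fun n : nat =>
    I (fun xi => ind (- n%:R) (x / t) xi * (f xi * c (- sig x xi))) +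
    I (fun xi => ind (x / t) n%:R xi * (f xi * c (sig x xi)))) @ \oo)); last first.
  apply: cvgD.
    exact (cvg_left_half (x := x) (fk_k K) (fk_cont K) deck hf).
  exact (cvg_right_half (x := x) (fk_k K) (fk_cont K) deck hf).
apply: near_eq_cvg; near=> n.
have h : `|x / t| <= n%:R by near: n; exact: nbhs_infty_ger.
move: h; rewrite ler_norml => /andP[h1 h2].
rewrite (I_ind_split h1 h2).
- congr (_ + _); apply: eq_Rintegral => xi _; by rewrite (fk_even K).
- apply: measurable_funM => //; apply: measurableT_comp; last exact: measurable_sig.
  exact: continuous_measurable_fun (fk_cont K).
- apply: L1_ind_continuous => xi; apply: cvgM; first exact: (h1_continuous hf).
  by apply: continuous_comp; [exact: continuous_sig|exact: cc].
Unshelve. all: end_near. Qed.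

(* A second integration by parts; the boundary terms at [x / t] cancel. *)
Lemma fresE_ibp g g' A B x : H1fun g g' A B ->
  fresE k g x = (Num.sqrt t)^-1 *
    I (fun xi => g' xi * (hv m (sig x xi) + hv m (- sig x xi))).
Proof.
move=> hg; have hA := h1_f hg; have hB := h1_f' hg; have mg := hA.1.
have mg' := hB.1.
have R1 := cvg_right_half (x := x) (fk_m K) ck decm hg.
have R2 := cvg_truncated_hv (L1_hv (fk_k K) deck x hA) mg ck.
have ER := cvgn_unique R1 R2.
have L1' := cvg_left_half (x := x) (fk_m K) ck decm hg.
have hgr := L2le_reflect hA.
have L2' : I (fun xi => ind (- n%:R) (x / t) xi * (g xi * k (- sig x xi))) @[n --> \oo] -->
    I (fun xi => g xi * hv k (- sig x xi)).
  have l0 := L1_hv (fk_k K) deck (- x) hgr.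
  have := cvg_truncated_hv l0 hgr.1 ck; rewrite mulNr.
  have mk : measurable_fun setT k by exact: continuous_measurable_fun.
  have -> : I (fun xi => g (- xi) * hv k (sig (- x) xi)) =
      I (fun xi => g xi * hv k (- sig x xi)).
    rewrite -[LHS]I_reflect; last exact: L1_measurable l0.
    by apply: eq_Rintegral => xi _; rewrite opprK sigN.
  apply: cvg_trans; apply: near_eq_cvg; apply: nearW => n.
  rewrite -[LHS]I_reflect; last first.
    apply: measurable_funM; first exact: measurable_ind.
    apply: measurable_funM; first exact: hgr.1.
    by apply: measurableT_comp => //; exact: measurable_sig.
  by apply: eq_Rintegral => xi _; rewrite ind_reflect opprK -sigN opprK.
have EL := cvgn_unique L1' L2'.
rewrite (fresE_split x hA) -ER -EL //.
have -> : I (fun xi => g' xi * (hv m (sig x xi) + hv m (- sig x xi))) =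
  I (fun xi => g' xi * hv m (sig x xi)) + I (fun xi => g' xi * hv m (- sig x xi)).
  rewrite -ID; [|exact (L1_hv (fk_m K) decm x hB)|exact: L1_hv_left hB].
  by apply: eq_Rintegral => xi _; rewrite mulrDr.
by ring.
Qed.

(** After the second integration by parts the kernel is at most [4 C / (1 + s^2)], hence integrable.
    Schur's test applies with slopes [sqrt t] and [- 1 / sqrt t], whose product has modulus 1, so
    the gain [t^-1] is the square of the prefactor. *)
Lemma fresE_smooth_L2 g g' A B : H1fun g g' A B ->
  L2le (fresE k g) (t^-1 * ((4 * C * kb) ^+ 2 * B)).
Proof.
move=> hg; have hB := h1_f' hg; have hA := h1_f hg.
pose b s := 4 * C * (1 + s ^+ 2)^-1.
have lb : L1 b by apply: L1Z; exact: L1_oneDsqrV.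
have s1 (s : R) : 0 < 1 + s ^+ 2 by rewrite ltr_wpDr ?sqr_ge0.
have bM s : 0 <= b s <= 4 * C.
  have C4 : 0 <= 4 * C by rewrite mulr_ge0.
  by rewrite /b mulr_ge0 ?invr_ge0 ?(ltW (s1 s)) //= ler_piMr // invf_le1 // lerDl sqr_ge0.
have p2 : - (Num.sqrt t)^-1 != 0 by rewrite oppr_eq0 invr_eq0.
have [lS hS] := schur st_neq0 p2 hB bM lb.
have Ib : I b = 4 * C * kb by rewrite IZ //; exact: L1_oneDsqrV.
rewrite Ib normrN normfV divff ?normr_eq0 // divr1 in hS.
set S := (fun x => I _) in hS.
have hS' := L2leZ (Num.sqrt t)^-1 hS.
have -> : t^-1 = (Num.sqrt t)^-1 ^+ 2 by rewrite exprVn sqr_sqrtr // ltW.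
apply: L2le_le hS'; first exact: measurable_fresE hA.1.
move=> x; rewrite (fresE_ibp x hg) !normrM ler_wpM2l //.
rewrite [X in _ <= X]ger0_norm; last first.
  by apply: Rintegral_ge0 => xi _; rewrite mulr_ge0 //; have /andP[] := bM (Num.sqrt t * xi + - (Num.sqrt t)^-1 * x).
have msum : L1 (fun xi => g' xi * (hv m (sig x xi) + hv m (- sig x xi))).
  have := L1D (L1_hv (fk_m K) decm x hB) (L1_hv_left x cm decm hB).
  by apply: eq_integrable => // xi _ /=; rewrite mulrDr.
apply: I_norm_le => // xi; rewrite normrM ler_wpM2l //.
have -> : Num.sqrt t * xi + - (Num.sqrt t)^-1 * x = sig x xi.
  by rewrite sig_affine; congr (_ + _); rewrite mulNr mulrC.
move: (sig x xi) => s.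
have hm r : 0 <= r -> `|m r| * (1 + r ^+ 2) <= 2 * C.
  move=> r0; have [h1 h2] := fk_m_le K r0; lra.
rewrite /b ler_pdivlMr //; apply: (le_trans (ler_wpM2r (ltW (s1 s)) (ler_normD _ _))).
rewrite /hv; case: (ltgtP s 0) => s0.
- have sN0 : 0 <= - s by rewrite oppr_ge0 ltW.
  rewrite sN0 mul0r normr0 add0r mul1r.
  rewrite -sqrrN; apply: (le_trans (hm _ sN0)).
  by rewrite ler_wpM2r // ler_nat.
- have /lt_geF -> : - s < 0 by rewrite oppr_lt0.
  rewrite mul0r normr0 addr0 mul1r; apply: (le_trans (hm _ (ltW s0))).
  by rewrite ler_wpM2r // ler_nat.
(* At [s = 0] both cut-offs equal 1, which accounts for [4 C] instead of [2 C]. *)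
- rewrite s0 oppr0 lexx mul1r mulrDl.
  apply: (le_trans (lerD (hm 0 (lexx _)) (hm 0 (lexx _)))).
  by rewrite -mulrDl ler_wpM2r // -natrD ler_nat.
Qed.

(** The stationary phase formula read backwards: the error is [sqrt t] times the oscillatory
    integral minus [sqrt pi * f (x / t)], and both terms have squared norm of order [t * A]. Fatou's
    lemma removes the truncation of [f]. *)
Lemma fresE_plancherel_L2 f f' A B : H1fun f f' A B ->
  L2le (fresE k f') ((2 * C + 2 * pi) * t * A).
Proof.
move=> hf; have [hA hB _] := hf; have A0 := L2le_ge0 hA.
apply: (@L2le_fatou _ (fun n x => Num.sqrt t *
   I (fun xi => ind (- n%:R) n%:R xi * (f xi * c (sig x xi))) + - (Num.sqrt pi) * f (x / t))).
  move=> n; pose fn xi := ind (- n%:R) n%:R xi * f xi.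
  have hn : L2le fn A by exact: L2le_indM.
  have nn : - n%:R <= n%:R :> R by rewrite ge0_cp // ler0n.
  have [ln _] := L2le_ind_L1 nn hA.
  have := fk_L2 K t0 ln hn.
  have -> : (fun x => I (fun xi => fn xi * c ((t * xi - x) / Num.sqrt t))) =
    (fun x => I (fun xi => ind (- n%:R) n%:R xi * (f xi * c (sig x xi)))).
    by apply/funext => x; apply: eq_Rintegral => xi _; rewrite /fn mulrA.
  move=> /(L2leZ (Num.sqrt t)) h1.
  have h2 : L2le (fun x => - Num.sqrt pi * f (x / t)) (pi * (t * A)).
    have t1 : t^-1 != 0 by rewrite invr_eq0.
    have hx : L2le (fun x => f (x / t)) (t * A).
      have := L2le_affine 0 t1 hA; rewrite normfV invrK gtr0_norm //.
      by congr L2le; apply/funext => x; rewrite addr0 mulrC.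
    by have := L2leZ (- Num.sqrt pi) hx; rewrite sqrrN sqr_sqrtr // pi_ge0.
  apply: L2leW (L2leD h1 h2); rewrite sqr_sqrtr ?(ltW t0) //.
  by rewrite le_eqVlt; apply/orP; left; apply/eqP; ring.
move=> x; have H := cvg_fresnel (x := x) hf.
have -> : fresE k f' x = Num.sqrt t * ((Num.sqrt t)^-1 *
   (Num.sqrt pi * f (x / t) + fresE k f' x)) + - Num.sqrt pi * f (x / t).
  by rewrite mulVKf //; ring.
by apply: cvgD; [apply: cvgM => //; exact: cvg_cst|exact: cvg_cst].
Qed.

(** Cauchy-Schwarz: the squared norm of [kap k] composed with [sig x] carries the factor
    [1 / sqrt t] of the change of variables. *)
Lemma fresE_sup_large f' B x : L2le f' B ->
  fresE k f' x ^+ 2 <= 8 * C ^+ 2 * kb * B / Num.sqrt t.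
Proof.
move=> hB; have B0 := L2le_ge0 hB; have kb0 := @kb_ge0 R.
have hk : L2le (kap k) (8 * C ^+ 2 * kb).
  have h1 := L2le_hv ck deck.
  apply: L2leW (L2leB h1 (L2le_reflect h1)).
  by rewrite le_eqVlt; apply/orP; left; apply/eqP; ring.
have [l i] := L2le_mul hB (L2le_sig x hk).
have h : `|fresE k f' x| <= Num.sqrt (B * ((Num.sqrt t)^-1 * (8 * C ^+ 2 * kb))).
  apply: le_trans i; apply: I_norm_le => //; exact: L1_abs.
have := sqr_le_norm h; rewrite sqr_sqrtr; last first.
  by rewrite !mulr_ge0 ?invr_ge0 ?sqrtr_ge0 ?sqr_ge0.
by move=> /le_trans; apply; rewrite le_eqVlt; apply/orP; left; apply/eqP; ring.
Qed.

End Kernel.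
End FixedTime.
End FresnelRemainder.

(** * Error bounds by averaging and by localisation near the stationary point *)

Section FresnelBounds.
Context {R : realType}.
Local Notation mu := (@lebesgue_measure R).
Local Notation L1 f := (mu.-integrable setT (EFin \o f)).
Local Notation I f := (Rintegral mu setT f).
Implicit Types (f g h F G u v c k m : R -> R) (a b A B C s t x y xi e : R).

Lemma I_shift f e : measurable_fun setT f -> I (fun x => f (x + e)) = I f.
Proof.
move=> mf; have -> : (fun x => f (x + e)) = (fun x => f (1 * x + e)).
  by apply/funext => x; rewrite mul1r.
by rewrite Rintegral_affine ?oner_neq0 // normr1 invr1 mul1r.
Qed.

Lemma L2le_shift f e A : L2le f A -> L2le (fun x => f (x + e)) A.
Proof.
move=> /(L2le_affine e (oner_neq0 R)); rewrite normr1 invr1 mul1r; congr L2le.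
by apply/funext => x; rewrite mul1r.
Qed.

Lemma ind_shift a b e x : ind (a + e) (b + e) (x + e) = ind a b x.
Proof. by rewrite /ind !lerD2r. Qed.

Lemma h1_shift f f' A B e : H1fun f f' A B ->
  H1fun (fun x => f (x + e)) (fun x => f' (x + e)) A B.
Proof.
move=> [hA hB ftc]; split; [exact: L2le_shift|exact: L2le_shift|move=> a b ab].
have ab' : a + e <= b + e by rewrite lerD2r.
have [l _] := L2le_ind_L1 ab' hB.
rewrite ftc // -(I_shift e (L1_measurable l)).
by apply: eq_Rintegral => x _; rewrite ind_shift.
Qed.

Lemma h1_scale f f' A B e : H1fun f f' A B ->
  H1fun (fun x => e * f x) (fun x => e * f' x) (e ^+ 2 * A) (e ^+ 2 * B).
Proof.
move=> [hA hB ftc]; split; [exact: L2leZ|exact: L2leZ|move=> a b ab].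
have [l _] := L2le_ind_L1 ab hB.
rewrite -mulrBr ftc // -IZ //; apply: eq_Rintegral => x _; ring.
Qed.

Lemma h1_sub f f' g g' A B A' B' : H1fun f f' A B -> H1fun g g' A' B' ->
  H1fun (fun x => f x - g x) (fun x => f' x - g' x) (2 * A + 2 * A') (2 * B + 2 * B').
Proof.
move=> [hA hB ftc] [hA' hB' ftc']; split; [exact: L2leB|exact: L2leB|move=> a b ab].
have [l _] := L2le_ind_L1 ab hB; have [l' _] := L2le_ind_L1 ab hB'.
have -> : f b - g b - (f a - g a) = (f b - f a) - (g b - g a) by ring.
rewrite ftc // ftc' // -IB //; apply: eq_Rintegral => x _; ring.
Qed.

Section Mollify.
Variables (f f' : R -> R) (A B e : R).
Hypotheses (hf : H1fun f f' A B) (e0 : 0 < e).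

Let e_neq0 : e != 0. Proof. by rewrite gt_eqF. Qed.

(** [diffq f] is the derivative of the average of [f] over [[x, x + e]], so [f'] is the sum of
    [diffq f], which is itself in H^1, and of the derivative of [unavg]. *)
Definition diffq h x := e^-1 * (h (x + e) - h x).
Definition unavg x := f x - e^-1 * I (fun s => ind x (x + e) s * f s).

Lemma h1_diffq : H1fun (diffq f) (diffq f') (4 * (e ^- 2 * A)) (4 * (e ^- 2 * B)).
Proof.
have := h1_scale e^-1 (h1_sub (h1_shift e hf) hf).
have E X : e^-1 ^+ 2 * (2 * X + 2 * X) = 4 * (e ^- 2 * X) by rewrite exprVn; ring.
by rewrite !E.
Qed.

Lemma measurable_unavg : measurable_fun setT unavg.
Proof.
have mf := (h1_f hf).1.
apply: measurable_funB => //; apply: measurable_funM => //.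
apply: (@measurable_I_param _ (fun x s => ind x (x + e) s * f s)).
apply: measurable_funM; last exact: measurable_comp2.
have -> : (fun z : R * R => ind z.1 (z.1 + e) z.2) =
    (fun z : R * R => (z.1 <= z.2)%R%:R * (z.2 <= z.1 + e)%R%:R).
  by apply/funext => z; rewrite /ind -natrM mulnb.
apply: measurable_funM; apply: measurable_ind2 => //.
exact: measurable_funD.
Qed.

(** [f x] differs from each value of [f] on [[x, x + e]] by at most the integral of [|f'|] there,
    which is an integral against a Schur kernel of mass [e]. *)
Lemma unavg_L2 : L2le unavg (e ^+ 2 * B).
Proof.
have [hA hB ftc] := hf.
have bM s : 0 <= ind 0 e s <= 1 by rewrite ind_ge0 ind_le1.
have [lS hS] := schur (oner_neq0 R) (@N1_neq0 R) hB bM (L1_ind 0 e).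
rewrite I_ind ?(ltW e0) // subr0 normr1 normrN1 mulr1 divr1 in hS.
set S := (fun x => I _) in hS.
apply: L2le_le hS; first exact: measurable_unavg.
move=> x; rewrite [X in _ <= X]ger0_norm; last first.
  by apply: Rintegral_ge0 => s _; rewrite mulr_ge0 // ind_ge0.
have xe : x <= x + e by rewrite lerDl ltW.
have [lf _] := L2le_ind_L1 xe hA; have [lf' _] := L2le_ind_L1 xe hB.
have SE : S x = I (fun s => `|ind x (x + e) s * f' s|).
  apply: eq_Rintegral => s _; rewrite normrM ger0_norm ?ind_ge0 // mulrC.
  congr (_ * _); rewrite -(ind_shift 0 e x).
  by rewrite mul1r mulN1r subrK add0r [e + x]addrC.
have -> : unavg x = e^-1 * I (fun s => ind x (x + e) s * (f x - f s)).
  have -> : (fun s => ind x (x + e) s * (f x - f s)) =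
    (fun s => f x * ind x (x + e) s - ind x (x + e) s * f s).
    by apply/funext => s; ring.
  rewrite IB ?IZ ?I_ind //; try exact: L1_ind; last by apply: L1Z; exact: L1_ind.
  by rewrite /unavg; field.
rewrite normrM gtr0_norm ?invr_gt0 // ler_pdivrMl //.
have -> : e * S x = I (fun s => S x * ind x (x + e) s).
  rewrite IZ ?I_ind //; last exact: L1_ind.
  ring.
apply: I_norm_le.
- have : L1 (fun s => f x * ind x (x + e) s - ind x (x + e) s * f s).
    by apply: L1B => //; apply: L1Z; exact: L1_ind.
  by apply: eq_integrable => // s _ /=; congr EFin; ring.
- by apply: L1Z; exact: L1_ind.
move=> s; rewrite mulrC normrM [X in _ * X]ger0_norm ?ind_ge0 //.
rewrite /ind; case: (boolP (x <= s <= x + e)) => [/andP[xs sx]|_]; last by rewrite !mulr0.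
rewrite !mulr1 distrC.
have [h _] := h1_holder hf xs; apply: (le_trans h); rewrite SE.
apply: I_le; try exact: L1_abs; last first.
  move=> r; rewrite !normrM ler_wpM2r // /ind.
  case: (boolP (x <= r <= s)) => [/andP[xr rs]|_]; last by rewrite normr0.
  by rewrite xr (le_trans rs sx).
by apply: L1_abs; exact: L1_ind_L1 sx lf'.
Qed.

(** The integral of [diffq f] over [[a, b]] is the average at [b] minus the average at [a]: this
    compares the two ways of cutting [[a, b + e]], at [b] and at [a + e]. *)
Lemma h1_unavg : H1fun unavg (fun x => f' x - diffq f x) (e ^+ 2 * B)
  (2 * B + 2 * (4 * (e ^- 2 * A))).
Proof.
have [hA hB ftc] := hf.
split; first exact: unavg_L2.
  by apply: L2leB => //; exact: h1_f h1_diffq.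
move=> a b ab; have mf := hA.1.
have lf (u v : R) : u <= v -> L1 (fun s => ind u v s * f s).
  by move=> uv; have [] := L2le_ind_L1 uv hA.
have [lf' _] := L2le_ind_L1 ab hB.
have [lg _] := L2le_ind_L1 ab (h1_f h1_diffq).
have ae : a <= a + e by rewrite lerDl ltW.
have be : b <= b + e by rewrite lerDl ltW.
have aebe : a + e <= b + e by rewrite lerD2r.
have S1 := I_ind_split ab be mf (lf _ _ (le_trans ab be)).
have S2 := I_ind_split ae aebe mf (lf _ _ (le_trans ab be)).
have -> : (fun x => ind a b x * (f' x - diffq f x)) =
    (fun x => ind a b x * f' x - ind a b x * diffq f x).
  by apply/funext => x; ring.
rewrite IB // -ftc //.
have [ls _] := L2le_ind_L1 ab (L2le_shift e hA).
have -> : I (fun x => ind a b x * diffq f x) =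
    e^-1 * (I (fun s => ind (a + e) (b + e) s * f s) - I (fun s => ind a b s * f s)).
  rewrite -(I_shift e (L1_measurable (lf _ _ aebe))).
  have -> : (fun x => ind (a + e) (b + e) (x + e) * f (x + e)) =
      (fun x => ind a b x * f (x + e)) by apply/funext => x; rewrite ind_shift.
  rewrite -IB ?lf // -IZ; last by apply: L1B => //; exact: lf.
  by apply: eq_Rintegral => x _; rewrite /diffq; ring.
rewrite /unavg.
have -> : I (fun s => ind b (b + e) s * f s) = I (fun s => ind a (a + e) s * f s) +
   I (fun s => ind (a + e) (b + e) s * f s) - I (fun s => ind a b s * f s).
  by rewrite -S2 S1; ring.
ring.
Qed.

End Mollify.

Section Bounds.
Variables (c k m : R -> R) (C : R).
Hypothesis K : fresnel_kernel c k m C.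
Let C0 : 0 <= C. Proof. exact: fk_ge0 K. Qed.
Let ck : continuous k.
Proof.
move=> s; apply: differentiable_continuous; apply/derivable1_diffP.
by have [] := fk_k K s.
Qed.

(* [f] is split at scale [t^(-1/2)] into its average, to which the second
   integration by parts applies, and [unavg], which is small in L^2. *)
Lemma fresE_L2 t f f' A B : 0 < t -> H1fun f f' A B ->
  L2le (fresE t k f') ((8 * (4 * C * kb) ^+ 2 + 2 * (2 * C + 2 * pi)) * B).
Proof.
move=> t0 hf; pose e := (Num.sqrt t)^-1.
have e0 : 0 < e by rewrite invr_gt0 sqrtr_gt0.
have e2 : e ^+ 2 = t^-1 by rewrite exprVn sqr_sqrtr // ltW.
have t_neq0 : t != 0 by rewrite gt_eqF.
have hg := h1_diffq e hf; have hp := h1_unavg hf e0.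
have E1 := fresE_smooth_L2 t0 K hg.
have E2 := fresE_plancherel_L2 t0 K hp.
have -> : fresE t k f' = fun x => fresE t k (fun x => f' x - diffq e f x) x + fresE t k (diffq e f) x.
  by apply/funext => x; rewrite (fresE_sub t0 K x (h1_f' hf) (h1_f hg)) subrK.
(* With [e ^+ 2 = t^-1] the powers of [t] cancel: [t * e^2] in the part treated by Plancherel,
   [t^-1 / e^2] in the averaged part. *)
apply: L2leW (L2leD E2 E1).
rewrite e2 invrK le_eqVlt; apply/orP; left; apply/eqP; field; exact: t_neq0.
Qed.

(* The part of the integral over [x / t, x / t + 1 / t] is integrated by parts
   back, so that it costs the L^2 norm of [f]; the rest is estimated by the
   Cauchy-Schwarz inequality. *)
Lemma hv_sup t f f' A B x : 0 < t -> H1fun f f' A B ->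
  `|I (fun xi => f' xi * hv k (sig t x xi))| <=
  Num.sqrt A + 2 * (C * Num.sqrt (2 * A + 2 * B)) + Num.sqrt (B * (2 * C ^+ 2 * kb)).
Proof.
move=> t0 hf; have [hA hB _] := hf.
have t_neq0 : t != 0 by rewrite gt_eqF.
have st0 : 0 < Num.sqrt t by rewrite sqrtr_gt0.
have A0 := L2le_ge0 hA.
pose y := x / t; pose y' := y + t^-1.
have yy' : y <= y' by rewrite lerDl invr_ge0 ltW.
have kC s : 0 <= s -> `|k s| <= C by move=> s0; have [] := fk_k_le K s0.
have mks : measurable_fun setT (fun xi => k (sig t x xi)).
  by apply: measurableT_comp; [exact: continuous_measurable_fun|exact: measurable_sig].
(* [o] is the kernel restricted to the right of [y'], where [t xi - x >= 1]. There
   [k^2 <= C^2 t / (t xi - x)^2], at most twice the same quotient with denominator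
   [1 + (t xi - x)^2], whose integral does not depend on [t]. *)
pose o xi := hv k (sig t x xi) - ind y y' xi * k (sig t x xi).
have mo : measurable_fun setT o.
  apply: measurable_funB.
    by apply: (@measurableT_comp _ _ _ _ _ _ (hv k));
      [exact: measurable_hv|exact: measurable_sig].
  by apply: measurable_funM => //; exact: measurable_ind.
have lw : L1 (fun xi => (1 + (t * xi + - x) ^+ 2)^-1).
  exact: (integrable_affine (- x) t_neq0 L1_oneDsqrV).
have ho : L2le o (2 * C ^+ 2 * kb).
  have -> : 2 * C ^+ 2 * kb = I (fun xi => 2 * C ^+ 2 * t * (1 + (t * xi + - x) ^+ 2)^-1).
    rewrite IZ // (@Rintegral_affine _ (fun s => (1 + s ^+ 2)^-1)) //; last first.
      exact: L1_measurable L1_oneDsqrV.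
    by rewrite gtr0_norm // -/kb; field.
  apply: L2le_sqr_le => //; first exact: L1Z.
  move=> xi; have w1 : 0 < 1 + (t * xi + - x) ^+ 2 by rewrite ltr_wpDr ?sqr_ge0.
  have r0 : 0 <= 2 * C ^+ 2 * t * (1 + (t * xi + - x) ^+ 2)^-1.
    by rewrite !mulr_ge0 ?sqr_ge0 ?invr_ge0 ?(ltW t0) ?(ltW w1).
  rewrite /o /hv (sig_ge0 t0) /ind -/y; case: (boolP (y <= xi)) => yxi /=; last first.
    by rewrite !mul0r subrr expr0n.
  case: (leP xi y') => xiy'; first by rewrite subrr expr0n.
  rewrite mul1r mul0r subr0 ler_pdivlMr //.
  have w : 1 <= t * xi + - x.
    have E : t * y' = x + 1 by rewrite /y' /y; field.
    have : t * y' <= t * xi by rewrite ler_pM2l // ltW.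
    by rewrite E; lra.
  have s0 : 0 <= sig t x xi by rewrite (sig_ge0 t0).
  have [_ h] := fk_k_le K s0.
  have : (sig t x xi * k (sig t x xi)) ^+ 2 <= C ^+ 2.
    by apply: sqr_le_norm; rewrite normrM ger0_norm.
  rewrite exprMn {1}/sig expr_div_n sqr_sqrtr ?(ltW t0) // mulrAC ler_pdivrMr //.
  move: (k (sig t x xi)) => kk h2.
  have w2 : 1 <= (t * xi + - x) ^+ 2 by rewrite expr_ge1 // (le_trans _ w).
  have := ler_wpM2l (sqr_ge0 kk) w2.
  move: h2; rewrite mulr1; move: ((t * xi - x) ^+ 2) (kk ^+ 2) => P Q h2 h3.
  lra.
have [lo io] := L2le_mul hB ho.
have [lin _] := L2le_ind_L1 yy' hB.
have lf' : L1 (fun xi => ind y y' xi * (f' xi * k (sig t x xi))).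
  have cks : continuous (fun xi => k (sig t x xi)).
    by move=> xi; apply: continuous_comp; [exact: continuous_sig|exact: ck].
  have [M kM] := continuous_itv_bounded y y' cks.
  apply: (L1_le _ _ (L1Z M (L1_abs lin))).
    apply: measurable_funM; first exact: measurable_ind.
    by apply: measurable_funM => //; exact: hB.1.
  move=> xi; have := kM xi; rewrite /ind; case: (_ <= _ <= _) => [/(_ isT) h|_].
    by rewrite !mul1r normrM mulrC ler_wpM2r.
  by rewrite !mul0r normr0 mulr0.
have -> : I (fun xi => f' xi * hv k (sig t x xi)) =
    I (fun xi => ind y y' xi * (f' xi * k (sig t x xi))) + I (fun xi => f' xi * o xi).
  by rewrite -ID //; apply: eq_Rintegral => xi _; rewrite /o; ring.
apply: (le_trans (ler_normD _ _)); apply: lerD; last first.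
  by apply: le_trans io; apply: I_norm_le => //; exact: L1_abs.
have H := ibp_sig t0 (fk_k K) (fk_cont K) x hf yy'.
have -> : I (fun xi => ind y y' xi * (f' xi * k (sig t x xi))) =
   Num.sqrt t * I (fun xi => ind y y' xi * (f xi * c (sig t x xi)))
   + (f y' * k (sig t x y') - f y * k (sig t x y)).
  by rewrite H; ring.
apply: (le_trans (ler_normD _ _)); apply: lerD.
  have mcs : measurable_fun setT (fun xi => c (sig t x xi)).
    apply: measurableT_comp; last exact: measurable_sig.
    exact: continuous_measurable_fun (fk_cont K).
  have hfc : L2le (fun xi => f xi * c (sig t x xi)) A.
    by apply: (L2le_Mb hA mcs) => xi; exact: (fk_le1 K).
  have [l i] := L2le_ind_L1 yy' hfc.
  rewrite normrM gtr0_norm //.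
  (* The length [t^-1] of the interval compensates the factor [sqrt t] exactly. *)
  have -> : Num.sqrt A = Num.sqrt t * Num.sqrt ((y' - y) * A).
    rewrite -sqrtrM ?(ltW t0) //; congr Num.sqrt; rewrite /y'; field; exact: t_neq0.
  apply: ler_wpM2l; first exact: ltW.
  by apply: le_trans i; apply: I_norm_le => //; exact: L1_abs.
have S z := h1_bounded z hf.
have P z : y <= z -> `|f z * k (sig t x z)| <= C * Num.sqrt (2 * A + 2 * B).
  move=> yz; rewrite normrM mulrC; apply: ler_pM => //.
  by apply: kC; rewrite (sig_ge0 t0).
apply: (le_trans (ler_normB _ _)); have := P y (lexx _); have := P y' yy'.
lra.
Qed.

(** [hv_sup] is used on both half lines, on the left one after reflection. *)
Lemma fresE_sup_small t f f' A B x : 0 < t -> H1fun f f' A B ->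
  fresE t k f' x ^+ 2 <= 48 * (1 + 8 * C ^+ 2 + 2 * C ^+ 2 * kb) * (A + B).
Proof.
move=> t0 hf; have [hA hB _] := hf.
have A0 := L2le_ge0 hA; have B0 := L2le_ge0 hB.
have kb0 := @kb_ge0 R.
have h1 := hv_sup x t0 hf.
have := hv_sup (- x) t0 (h1_reflect hf).
rewrite (I_hv_reflect t0 (fk_k K) (fk_k_le K) x hB) normrN => h2.
rewrite (fresE_split t0 K x hB).
set Q := Num.sqrt A + _ + _ in h1 h2.
have h : `|I (fun xi => f' xi * hv k (sig t x xi)) - I (fun xi => f' xi * hv k (- sig t x xi))|
    <= 2 * Q by apply: (le_trans (ler_normB _ _)); lra.
apply: (le_trans (sqr_le_norm h)).
have a2 : Num.sqrt A ^+ 2 = A by rewrite sqr_sqrtr.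
have b2 : Num.sqrt (2 * A + 2 * B) ^+ 2 = 2 * A + 2 * B by rewrite sqr_sqrtr // addr_ge0 ?mulr_ge0.
have c2 : Num.sqrt (B * (2 * C ^+ 2 * kb)) ^+ 2 = B * (2 * C ^+ 2 * kb).
  by rewrite sqr_sqrtr // !mulr_ge0 ?sqr_ge0.
have sum3 (u v w : R) : (u + v + w) ^+ 2 <= 3 * (u ^+ 2 + v ^+ 2 + w ^+ 2).
  have := sqr_ge0 (u - v); have := sqr_ge0 (v - w); have := sqr_ge0 (u - w); nra.
rewrite exprMn; apply: (le_trans (ler_wpM2l (sqr_ge0 2) (sum3 _ _ _))).
rewrite !exprMn a2 b2 c2.
have e1 : 0 <= C ^+ 2 * A by rewrite mulr_ge0 ?sqr_ge0.
have e2 : 0 <= C ^+ 2 * B by rewrite mulr_ge0 ?sqr_ge0.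
have e3 : 0 <= C ^+ 2 * kb * A by rewrite !mulr_ge0 ?sqr_ge0.
have e4 : 0 <= C ^+ 2 * kb * B by rewrite !mulr_ge0 ?sqr_ge0.
have -> : B * (2 * C ^+ 2 * kb) = 2 * (C ^+ 2 * kb * B) by ring.
have -> : 48 * (1 + 8 * C ^+ 2 + 2 * C ^+ 2 * kb) * (A + B) = 48 * A + 48 * B +
  384 * (C ^+ 2 * A) + 384 * (C ^+ 2 * B) + 96 * (C ^+ 2 * kb * A) + 96 * (C ^+ 2 * kb * B).
  by ring.
have -> : C ^+ 2 * (2 * A + 2 * B) = 2 * (C ^+ 2 * A) + 2 * (C ^+ 2 * B) by ring.
lra.
Qed.

End Bounds.
End FresnelBounds.

(** * Weak derivatives *)

Section TestFunctions.
Context {R : realType}.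
Local Notation mu := (@lebesgue_measure R).
Local Notation L1 f := (mu.-integrable setT (EFin \o f)).
Local Notation I f := (Rintegral mu setT f).
Implicit Types (f g h F G : R -> R) (a b c s t x y : R) (n m : nat).

(** Iterated differentiability by recursion, so that sums, products and affine substitutions are
    handled by induction; smooth means [Ck n] for all [n]. *)
Fixpoint Ck n f : Prop :=
  if n is n'.+1 then (forall x, derivable f x 1) /\ Ck n' (derive1 f) else True.

Lemma CkW n f : Ck n.+1 f -> Ck n f.
Proof.
elim: n f => [//|n IH] f [df cf]; split => //; exact: IH.
Qed.

Lemma CkD n f g : Ck n f -> Ck n g -> Ck n (fun x => f x + g x).
Proof.
elim: n f g => [//|n IH] f g [df cf] [dg cg]; split.
  by move=> x; exact: derivableD.
have -> : derive1 (fun x => f x + g x) = (fun x => derive1 f x + derive1 g x).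
  by apply/funext => x; rewrite !derive1E deriveD.
exact: IH.
Qed.

Lemma CkZ n c f : Ck n f -> Ck n (fun x => c * f x).
Proof.
elim: n f => [//|n IH] f [df cf]; split.
  by move=> x; apply: (@derivableZ _ _ _ f c).
have -> : derive1 (fun x => c * f x) = (fun x => c * derive1 f x).
  by apply/funext => x; rewrite !derive1E (@deriveZ _ _ _ f c).
exact: IH.
Qed.

Lemma CkM n f g : Ck n f -> Ck n g -> Ck n (fun x => f x * g x).
Proof.
elim: n f g => [//|n IH] f g hf hg.
have [df cf] := hf; have [dg cg] := hg; split.
  by move=> x; exact: derivableM.
have -> : derive1 (fun x => f x * g x) = (fun x => f x * derive1 g x + g x * derive1 f x).
  by apply/funext => x; rewrite !derive1E deriveM.
by apply: CkD; apply: IH => //; exact: CkW.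
Qed.

Lemma is_derive_affine_comp f a b x d : is_derive (a * x + b) (1 : R) f d ->
  is_derive x (1 : R) (fun x => f (a * x + b)) (a * d).
Proof.
by move=> h; apply: is_derive_eq; rewrite /GRing.scale /=; ring.
Qed.

Lemma Ck_affine n f a b : Ck n f -> Ck n (fun x => f (a * x + b)).
Proof.
elim: n f => [//|n IH] f [df cf].
have D x : is_derive x (1 : R) (fun x => f (a * x + b)) (a * derive1 f (a * x + b)).
  apply: is_derive_affine_comp; rewrite derive1E; split => //.
split; first by move=> x; case: (D x).
have -> : derive1 (fun x => f (a * x + b)) = (fun x => a * derive1 f (a * x + b)).
  by apply/funext => x; rewrite derive1E; case: (D x).
by apply: CkZ; exact: IH.
Qed.

Lemma Ck_derive1n f : (forall n, Ck n f) -> forall n x, derivable (derive1n n f) x 1.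
Proof.
move=> cf n; move: f cf; elim: n => [|n IH] f cf x; first by case: (cf 1).
by rewrite derive1Sn; apply: IH => k; case: (cf k.+1).
Qed.

(* The functions [x^-n expR (- 1/x)] on the positive half line span a space
   closed under differentiation. *)
Definition flat n x : R := if 0 < x then x ^- n * expR (- x^-1) else 0.

(** The [n]-th power of [y / n <= exp (y / n)]; for [n = 0] the constant is [0 ^ 0 = 1]. *)
Lemma pow_le_exp n y : 0 <= y -> y ^+ n <= n%:R ^+ n * expR y.
Proof.
move=> y0; case: n => [|n]; first by rewrite !expr0 mul1r -expR0 ler_expR.
have n0 : 0 < n.+1%:R :> R by rewrite ltr0n.
rewrite -ler_pdivrMl ?exprn_gt0 // -exprVn -exprMn.
have -> : expR y = expR (n.+1%:R^-1 * y) ^+ n.+1.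
  by rewrite -expRM_natl mulrA mulfV ?mul1r // gt_eqF.
apply: lerXn2r; rewrite ?nnegrE ?expR_ge0 //.
  by rewrite mulr_ge0 ?invr_ge0 // ltW.
by apply: (le_trans _ (expR_ge1Dx _)); rewrite lerDr.
Qed.

Lemma flat_ge0 n x : 0 <= flat n x.
Proof.
rewrite /flat; case: ifP => // x0.
by rewrite mulr_ge0 ?expR_ge0 // invr_ge0 exprn_ge0 // ltW.
Qed.

Lemma flat_le n m x : flat n x * `|x| ^- m <= (n + m)%:R ^+ (n + m).
Proof.
rewrite /flat; case: ifP => x0; last by rewrite mul0r exprn_ge0.
have xi : 0 <= x^-1 by rewrite invr_ge0 ltW.
rewrite gtr0_norm // mulrAC -invfM -exprD addnC -exprVn expRN addnC.
by rewrite ler_pdivrMr ?expR_gt0 // pow_le_exp.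
Qed.

Lemma is_derive_flat n x :
  is_derive x (1 : R) (flat n) (flat n.+2 x - n%:R * flat n.+1 x).
Proof.
case: (ltgtP x 0) => x0.
- apply: (@near_eq_is_derive _ _ _ (cst 0)); last first.
    rewrite /flat ltNge (ltW x0) /= mulr0 subr0; exact: is_derive_cst.
  near=> y; rewrite /flat ifF //; apply/negbTE; rewrite -leNgt ltW //.
  by near: y; apply: lt_nbhsl.
- have xn : x != 0 by rewrite gt_eqF.
  have D1 : is_derive x (1 : R) (fun x => x^-1) (- x ^- 2).
    have := @is_deriveV _ id x 1 1 xn (is_derive_id _ _).
    by rewrite /GRing.scale /= mulr1.
  have D2 : is_derive x (1 : R) (fun x => expR (- x^-1)) (x ^- 2 * expR (- x^-1)).
    have DN : is_derive x (1 : R) (fun x => - x^-1) (x ^- 2).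
      by apply: is_derive_eq; rewrite opprK.
    by apply: is_derive_eq; rewrite /GRing.scale /= mulrC.
  have D3 : is_derive x (1 : R) (fun x => x ^- n) (- n%:R * x ^- n.+1).
    have -> : (fun x : R => x ^- n) = (fun x => (x^-1) ^+ n).
      by apply/funext => y; rewrite exprVn.
    case: n => [|n]; first by rewrite oppr0 mul0r; under eq_fun do rewrite expr0; exact: is_derive_cst.
    have -> : (fun x : R => x^-1 ^+ n.+1) = (fun x : R => x^-1) ^+ n.+1.
      by apply/funext => y; rewrite exprfctE.
    apply: is_derive_eq; rewrite /GRing.scale /=.
    by rewrite exprVn mulrN -mulrA -invfM -exprD addn2 mulNr.
  apply: (@near_eq_is_derive _ _ _ (fun x => x ^- n * expR (- x^-1))).
    near=> y; rewrite /flat ifT //.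
    by near: y; apply: lt_nbhsr.
  apply: is_derive_eq; rewrite /GRing.scale /= /flat x0.
  rewrite mulrA -invfM -exprD addn2; congr (_ + _).
  by rewrite mulrC !mulNr mulrA.
- rewrite x0.
  have -> : flat n.+2 0 - n%:R * flat n.+1 0 = 0 :> R by rewrite /flat ltxx mulr0 subrr.
  have H : h^-1 * (flat n h) @[h --> 0^'] --> (0 : R).
    apply/cvgr0Pnorm_le => e e0.
    pose M : R := (n + 2)%:R ^+ (n + 2) + 1.
    have M0 : 0 < M by rewrite ltr_wpDl // exprn_ge0.
    near=> h.
    have h0 : h != 0 by near: h; exact: nbhs_dnbhs_neq.
    have hM : `|h| <= e / M.
      by near: h; apply: dnbhs0_le; rewrite divr_gt0.
    (* Two powers of [h] are available, one more than the difference quotient consumes. *)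
    have := flat_le n 2 h.
    have nh : 0 < `|h| by rewrite normr_gt0.
    rewrite ler_pdivrMr ?exprn_gt0 // => hf.
    rewrite normrM normfV ler_pdivrMl // (ger0_norm (flat_ge0 _ _)).
    apply: (le_trans hf); rewrite expr2 mulrA.
    apply: (@le_trans _ _ (M * `|h| * `|h|)).
      by rewrite -!mulrA ler_wpM2r ?mulr_ge0 // /M lerDl.
    rewrite [X in _ <= X]mulrC ler_wpM2r //.
    by rewrite mulrC -ler_pdivlMr.
  have H' : h^-1 *: (((flat n) \o shift 0) (h *: (1 : R)) - flat n 0) @[h --> 0^'] --> (0 : R).
    apply: cvg_trans H; apply: near_eq_cvg; apply: nearW => h /=.
    by rewrite /GRing.scale /= mulr1 addr0 [flat n 0]/flat ltxx subr0.
  split; first by apply/cvg_ex; exists 0.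
  exact: (cvg_lim _ H').
Unshelve. all: end_near. Qed.

Lemma Ck_flat k n : Ck k (flat n).
Proof.
elim: k n => [//|k IH] n; split; first by move=> x; case: (is_derive_flat n x).
have -> : derive1 (flat n) = (fun x => flat n.+2 x + - n%:R * flat n.+1 x).
  by apply/funext => x; rewrite derive1E mulNr; case: (is_derive_flat n x).
by apply: CkD => //; exact: CkZ.
Qed.

Lemma continuous_flat n : continuous (flat n).
Proof.
move=> x; apply: differentiable_continuous; apply/derivable1_diffP.
by case: (is_derive_flat n x).
Qed.

Lemma flat0_le1 x : flat 0 x <= 1.
Proof.
rewrite /flat; case: ifP => // x0; rewrite expr0 invr1 mul1r -expR0 ler_expR.
by rewrite oppr_le0 invr_ge0 ltW.
Qed.

Lemma cvg_flat0 (u : nat -> R) : (forall M : R, \forall n \near \oo, M <= u n) ->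
  flat 0 (u n) @[n --> \oo] --> (1 : R).
Proof.
move=> hu; have cv : (u n)^-1 @[n --> \oo] --> (0 : R).
  apply/cvgr0Pnorm_le => e e0; near=> n.
  have h : e^-1 <= u n by near: n; exact: hu.
  have u0 : 0 < u n by apply: lt_le_trans h; rewrite invr_gt0.
  by rewrite gtr0_norm ?invr_gt0 // -[e]invrK lef_pV2 // posrE // invr_gt0.
have : expR (- (u n)^-1) @[n --> \oo] --> expR (- (0 : R)).
  apply: (@cvg_comp _ _ _ (fun n => - (u n)^-1) expR); last exact: continuous_expR.
  exact: cvgN.
rewrite oppr0 expR0; apply: cvg_trans; apply: near_eq_cvg; near=> n.
have h : 1 <= u n by near: n; exact: hu.
by rewrite /flat (lt_le_trans ltr01 h) expr0 invr1 mul1r.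
Unshelve. all: end_near. Qed.

(** [flat 2] is the derivative of [flat 0], which climbs from 0 to 1 on the positive half line;
    rescaled, it serves as an approximate identity. *)
Lemma I_flat2 : L1 (flat 2) /\ I (flat 2) = 1.
Proof.
have mf := continuous_measurable_fun (@continuous_flat 2).
have l : L1 (flat 2).
  apply: (L1_le mf (g := fun x => 260 * (1 + x ^+ 2)^-1)); last first.
    by apply: L1Z; exact: L1_oneDsqrV.
  move=> x; rewrite ger0_norm ?flat_ge0 // ler_pdivlMr; last by rewrite ltr_wpDr ?sqr_ge0.
  have h1 := flat_le 2 0 x; rewrite expr0 invr1 mulr1 in h1.
  have h2 : flat 2 x * x ^+ 2 <= 1.
    rewrite /flat; case: ifP => x0; last by rewrite mul0r.
    have xn : x != 0 by rewrite gt_eqF.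
    rewrite mulrAC mulVf ?mul1r ?expf_neq0 // -expR0 ler_expR oppr_le0 invr_ge0 ltW //.
  have e : (2 + 0)%:R ^+ (2 + 0) = 4 :> R by rewrite addn0 -natrX.
  rewrite e in h1; lra.
split => //.
have D x : is_derive x (1 : R) (flat 0) (flat 2 x).
  by have := is_derive_flat 0 x; rewrite mul0r subr0.
have lW : mu.-integrable `[(0:R), +oo[ (EFin \o flat 2) by exact: integrableS l.
have c : flat 0 n%:R @[n --> \oo] --> (1 : R).
  by apply: cvg_flat0 => M; exact: nbhs_infty_ger.
have := Rintegral_ftc_pinfty D (@continuous_flat 2) lW c.
rewrite [flat 0 0]/flat ltxx subr0 Rintegral_mkcond => <-.
apply: eq_Rintegral => x _; rewrite patchE mem_setE /= in_itv /= andbT.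
by case: (leP 0 x) => // x0; rewrite /flat ltNge (ltW x0).
Qed.

Lemma flat_le0 n x : x <= 0 -> flat n x = 0.
Proof. by move=> x0; rewrite /flat ltNge x0. Qed.

Section FlatAverage.
Variables (phi : R -> R) (c e L : R).
Hypotheses (cphi : continuous phi) (e1 : `|e| <= 1) (L0 : 0 < L).

(** One edge of the integral of [phi] against the derivative of a bump lying to the right of [c]
    ([e = 1]) or to its left ([e = -1]), with length [L], in the rescaled variable [s] measured from
    that edge. The last factor is the opposite edge of the bump. *)
Definition flat_avg n s :=
  flat 2 s * (phi (c + e * (s / n.+1%:R)) * flat 0 (n.+1%:R * L - s)).

Lemma measurable_flat_avg n : measurable_fun setT (flat_avg n).
Proof.
apply: measurable_funM; first by case: I_flat2 => l _; exact: L1_measurable.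
apply: measurable_funM.
  apply: measurableT_comp; first exact: continuous_measurable_fun.
  apply: measurable_funD => //; apply: measurable_funM => //.
  by under eq_fun do rewrite mulrC; exact: measurable_funM.
apply: measurableT_comp; first exact: continuous_measurable_fun (@continuous_flat 0).
exact: measurable_funB.
Qed.

(** The factor [flat 0] vanishes once [s] reaches [n.+1%:R * L], so only values of [phi] within
    distance [L] of [c] matter, where it is bounded. *)
Lemma flat_avg_le : exists M, forall n s, `|flat_avg n s| <= M * flat 2 s.
Proof.
have [M hM] := continuous_itv_bounded (c - L) (c + L) cphi; exists M => n s.
have n0 : 0 < n.+1%:R :> R by rewrite ltr0n.
have M0 : 0 <= M.
  by apply: (le_trans (normr_ge0 (phi c))); apply: hM; rewrite gerBl lerDl (ltW L0).
rewrite normrM ger0_norm ?flat_ge0 // mulrC.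
case: (leP s 0) => s0; first by rewrite (flat_le0 _ s0) !mulr0.
rewrite ler_wpM2r ?flat_ge0 //.
case: (leP (n.+1%:R * L) s) => sL.
  by rewrite flat_le0 ?mulr0 ?normr0 // subr_le0.
rewrite normrM -[M]mulr1 ler_pM //; last by rewrite ger0_norm ?flat_ge0 // flat0_le1.
apply: hM; rewrite -ler_distl addrAC subrr add0r normrM.
rewrite -[L]mul1r ler_pM // ger0_norm ?divr_ge0 // ?(ltW s0) //.
by rewrite ler_pdivrMr // mulrC ltW.
Qed.

Lemma L1_flat_avg n : L1 (flat_avg n).
Proof.
have [M hM] := flat_avg_le.
apply: (L1_le (measurable_flat_avg n) (hM n)); apply: L1Z; by case: I_flat2.
Qed.

Lemma cvg_flat_avg : I (flat_avg n) @[n --> \oo] --> phi c.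
Proof.
have [M hM] := flat_avg_le; have [l2 i2] := I_flat2.
have -> : phi c = I (fun s => phi c * flat 2 s) by rewrite IZ // i2 mulr1.
apply: (I_dominated (g := fun s => M * flat 2 s)) => //.
- exact: measurable_flat_avg.
- by apply: measurable_funM => //; exact: L1_measurable.
- exact: L1Z.
- move=> s; have cs : phi (c + e * (s / n.+1%:R)) @[n --> \oo] --> phi c.
    apply: (@cvg_comp _ _ _ (fun n => c + e * (s / n.+1%:R)) phi); last exact: cphi.
    have -> : nbhs c = nbhs (c + e * (s * 0)) by rewrite !mulr0 addr0.
    apply: cvgD; first exact: cvg_cst.
    apply: cvgM; first exact: cvg_cst.
    by apply: cvgM; [exact: cvg_cst|exact: cvg_harmonic].
  have c0 : flat 0 (n.+1%:R * L - s) @[n --> \oo] --> (1 : R).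
    apply: cvg_flat0 => K; near=> n.
    rewrite lerBrDr -ler_pdivrMr //; apply: (@le_trans _ _ n%:R); last by rewrite ler_nat.
    by near: n; exact: nbhs_infty_ger.
  have -> : phi c * flat 2 s = flat 2 s * (phi c * 1) by rewrite mulr1 mulrC.
  by apply: cvgM; [exact: cvg_cst|exact: cvgM].
Unshelve. all: end_near. Qed.

End FlatAverage.

Section Bump.
Variables (a b : R) (n : nat).
Local Notation j := (n.+1%:R : R).

Definition bump x : R := flat 0 (j * x + - (j * a)) * flat 0 (- j * x + j * b).
Definition bump' x : R :=
  j * flat 2 (j * x + - (j * a)) * flat 0 (- j * x + j * b) -
  j * flat 0 (j * x + - (j * a)) * flat 2 (- j * x + j * b).

Lemma is_derive_flat0 x : is_derive x (1 : R) (flat 0) (flat 2 x).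
Proof. by have := is_derive_flat 0 x; rewrite mul0r subr0. Qed.

Lemma derive1_bump x : derive1 bump x = bump' x.
Proof.
have D1 : is_derive x (1 : R) (fun x => flat 0 (j * x + - (j * a)))
   (j * flat 2 (j * x + - (j * a))).
  by apply: is_derive_affine_comp; exact: is_derive_flat0.
have D2 : is_derive x (1 : R) (fun x => flat 0 (- j * x + j * b))
   (- j * flat 2 (- j * x + j * b)).
  by apply: is_derive_affine_comp; exact: is_derive_flat0.
have D : is_derive x (1 : R) bump (bump' x).
  by apply: is_derive_eq; rewrite /bump' /GRing.scale /=; ring.
by rewrite derive1E; case: D.
Qed.

Lemma flat_bump k l x : flat k (j * x + - (j * a)) * flat l (- j * x + j * b) != 0 ->
  a < x < b.
Proof.
have j0 : 0 < j by rewrite ltr0n.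
move=> h; apply/andP; split; rewrite ltNge; apply/negP => hx; move: h.
  by rewrite flat_le0 ?mul0r ?eqxx // -mulrBr pmulr_rle0 // subr_le0.
by rewrite mulrC flat_le0 ?mul0r ?eqxx // mulNr addrC -mulrBr pmulr_rle0 // subr_le0.
Qed.

Lemma test_bump : test_function setT bump.
Proof.
have sub : closure [set x | bump x != 0] `<=` `[a, b]%classic.
  have cl : closed (`[a, b]%classic : set R) by exact: itv_closed.
  rewrite [X in _ `<=` X](proj1 (closure_id _) cl).
  apply: closureS => x /= /flat_bump /andP[h1 h2].
  by rewrite in_itv /= !ltW.
split => //.
  by apply: Ck_derive1n => k; apply: CkM; apply: Ck_affine; exact: Ck_flat.
apply: (subclosed_compact _ (@segment_compact _ a b) sub); exact: closed_closure.
Qed.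

End Bump.

(* Tested against bumps that rise from 0 to 1 just after [a] and fall back to
   0 just before [b]; their derivatives concentrate unit mass at [a] and [b]. *)
Lemma weak_ftc (phi psi : R -> R) A : continuous phi -> L2le psi A ->
  (forall eta, test_function setT eta ->
    I (fun x => phi x * derive1 eta x) = - I (fun x => psi x * eta x)) ->
  forall a b, a <= b -> phi b - phi a = I (fun x => ind a b x * psi x).
Proof.
move=> cphi hpsi H a b; rewrite le_eqVlt => /orP[/eqP <-|ab].
  rewrite subrr (@I_eq_off1 _ (fun x => ind a a x * psi x) (fun=> 0) a) //.
  - by rewrite /Rintegral integral0.
  - by apply: measurable_funM; [exact: measurable_ind|case: hpsi].
  - move=> x xa; by rewrite /ind -eq_le eq_sym (negbTE xa) mul0r.
have L0 : 0 < b - a by rewrite subr_gt0.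
have e1 : `|1 : R| <= 1 by rewrite normr1.
have e2 : `|- 1 : R| <= 1 by rewrite normrN1.
have cA := @cvg_flat_avg phi a 1 _ cphi e1 L0.
have cB := @cvg_flat_avg phi b (- 1) _ cphi e2 L0.
have [lpsi _] := L2le_ind_L1 (ltW ab) hpsi.
have E n : I (flat_avg phi b (- 1) (b - a) n) - I (flat_avg phi a 1 (b - a) n)
    = I (fun x => psi x * bump a b n x).
  have n0 : n.+1%:R != 0 :> R by rewrite pnatr_eq0.
  have n1 : - n.+1%:R != 0 :> R by rewrite oppr_eq0.
  have lA := @L1_flat_avg phi a 1 _ cphi e1 L0 n; have lB := @L1_flat_avg phi b (- 1) _ cphi e2 L0 n.
  apply: oppr_inj; rewrite [LHS]opprB; apply: (etrans _ (H _ (test_bump a b n))).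
  rewrite (_ : (fun x => phi x * derive1 (bump a b n) x) = (fun x =>
     n.+1%:R * flat_avg phi a 1 (b - a) n (n.+1%:R * x + - (n.+1%:R * a)) -
     n.+1%:R * flat_avg phi b (- 1) (b - a) n (- n.+1%:R * x + n.+1%:R * b))); last first.
    apply/funext => x; rewrite derive1_bump /bump' /flat_avg.
    have -> : a + 1 * ((n.+1%:R * x + - (n.+1%:R * a)) / n.+1%:R) = x by field.
    have -> : b + - 1 * ((- n.+1%:R * x + n.+1%:R * b) / n.+1%:R) = x by field.
    have -> : n.+1%:R * (b - a) - (n.+1%:R * x + - (n.+1%:R * a)) =
      - n.+1%:R * x + n.+1%:R * b by ring.
    have -> : n.+1%:R * (b - a) - (- n.+1%:R * x + n.+1%:R * b) =
      n.+1%:R * x + - (n.+1%:R * a) by ring.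
    ring.
  rewrite IB; [|by apply: L1Z; exact: integrable_affine|by apply: L1Z; exact: integrable_affine].
  rewrite IZ; last exact: integrable_affine.
  rewrite IZ; last exact: integrable_affine.
  rewrite !Rintegral_affine //; try exact: L1_measurable.
  by rewrite normrN ger0_norm // !mulrA !mulfV // !mul1r.
have cL : I (fun x => psi x * bump a b n x) @[n --> \oo] --> phi b - phi a.
  by under eq_fun do rewrite -E; exact: cvgB.
(* The pointwise limit of the bumps is the indicator of the open interval; it is turned into the
   closed one at the end, one endpoint at a time. *)
pose psi0 x := \1_(`]a, b[ : set (measurableTypeR R)) x * psi x.
have mpsi : measurable_fun setT psi by case: hpsi.
have mpsi0 : measurable_fun setT psi0 by apply: measurable_funM.
have cR : I (fun x => psi x * bump a b n x) @[n --> \oo] --> I psi0.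
  apply: (I_dominated (g := fun x => `|ind a b x * psi x|)) => //.
  - move=> n; apply: measurable_funM => //.
    by apply: measurable_funM; apply: (measurableT_comp
      (continuous_measurable_fun (@continuous_flat 0))); exact: measurable_affine.
  - exact: L1_abs.
  - move=> n x; have [->|/flat_bump] := eqVneq (bump a b n x) 0.
      by rewrite mulr0 normr0.
    move=> /andP[h1 h2].
    rewrite /ind (ltW h1) (ltW h2) mul1r normrM -[X in _ <= X]mulr1 ler_wpM2l //.
    rewrite ger0_norm ?mulr_ge0 ?flat_ge0 // -[X in _ <= X]mulr1.
    by rewrite ler_pM ?flat_ge0 ?flat0_le1.
  - move=> x; rewrite /psi0 indicE mem_setE /= in_itv /=.
    have [/andP[ax xb]|/negbTE hx] := boolP (a < x < b).
      rewrite mul1r -[X in _ --> X]mulr1; apply: cvgM; first exact: cvg_cst.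
      rewrite -[1]mulr1; apply: cvgM.
        apply: cvg_flat0 => K; near=> n.
        rewrite -mulrBr -ler_pdivrMr ?subr_gt0 //.
        apply: (@le_trans _ _ n%:R); last by rewrite ler_nat.
        by near: n; exact: nbhs_infty_ger.
      apply: cvg_flat0 => K; near=> n.
      rewrite mulNr addrC -mulrBr -ler_pdivrMr ?subr_gt0 //.
      apply: (@le_trans _ _ n%:R); last by rewrite ler_nat.
      by near: n; exact: nbhs_infty_ger.
    rewrite mul0r; have -> : (fun n => psi x * bump a b n x) = (fun=> 0).
      apply/funext => n; have [->|/flat_bump] := eqVneq (bump a b n x) 0.
        by rewrite mulr0.
      by rewrite hx.
    exact: cvg_cst.
rewrite (cvgn_unique cL cR).
rewrite (@I_eq_off1 _ psi0 (fun x => \1_(`[a, b[ : set (measurableTypeR R)) x * psi x) a) //.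
- apply: (@I_eq_off1 _ _ _ b).
  + by apply: measurable_funM.
  + by apply: measurable_funM => //; exact: measurable_ind.
  + move=> x xb; congr (_ * _); rewrite /ind indicE mem_setE /= in_itv /=.
    by rewrite [x <= b]le_eqVlt (negbTE xb).
- by apply: measurable_funM.
- move=> x xa; congr (_ * _); rewrite !indicE !mem_setE /= !in_itv /=.
  by rewrite [a <= x]le_eqVlt eq_sym (negbTE xa).
Unshelve. all: end_near. Qed.

End TestFunctions.

(** * Complex-valued functions *)

Section ComplexL2.
Context {R : realType}.
Local Notation mu := (@lebesgue_measure R).
Local Notation L1 f := (mu.-integrable setT (EFin \o f)).
Local Notation I f := (Rintegral mu setT f).
Local Notation normc := ComplexField.Normc.normc.
Local Notation Re := complex.Re.
Local Notation Im := complex.Im.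
Implicit Types (u v : R -> R[i]) (z w : R[i]) (a b c A B M : R).

Lemma ReD z w : Re (z + w) = Re z + Re w. Proof. by case: z; case: w. Qed.
Lemma ImD z w : Im (z + w) = Im z + Im w. Proof. by case: z; case: w. Qed.
Lemma ReN z : Re (- z) = - Re z. Proof. by case: z. Qed.
Lemma ImN z : Im (- z) = - Im z. Proof. by case: z. Qed.
Lemma ReM z w : Re (z * w) = Re z * Re w - Im z * Im w.
Proof. by case: z; case: w. Qed.
Lemma ImM z w : Im (z * w) = Re z * Im w + Im z * Re w.
Proof. by case: z => a b; case: w => c d /=; rewrite mulrC [b * c]mulrC; ring. Qed.
Definition reim := (ReD, ImD, ReN, ImN, ReM, ImM).

Lemma complex_eqP z w : Re z = Re w -> Im z = Im w -> z = w.
Proof. by case: z => a b; case: w => c d /= -> ->. Qed.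

Lemma normc_sqr z : normc z ^+ 2 = Re z ^+ 2 + Im z ^+ 2.
Proof. by case: z => a b /=; rewrite sqr_sqrtr // addr_ge0 ?sqr_ge0. Qed.

Lemma normc_ge0 z : 0 <= normc z.
Proof. by case: z => a b /=; exact: sqrtr_ge0. Qed.

Lemma normc_sqr_le z M : 0 <= M -> Re z ^+ 2 + Im z ^+ 2 <= M ^+ 2 -> normc z <= M.
Proof. by move=> M0; rewrite -normc_sqr ler_sqr // nnegrE // normc_ge0. Qed.

Lemma Re_le_normc z : `|Re z| <= normc z.
Proof.
by case: z => a b /=; rewrite -sqrtr_sqr ler_sqrt ?lerDl ?addr_ge0 ?sqr_ge0.
Qed.

Lemma Im_le_normc z : `|Im z| <= normc z.
Proof.
by case: z => a b /=; rewrite -sqrtr_sqr ler_sqrt ?lerDr ?addr_ge0 ?sqr_ge0.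
Qed.

Lemma normcR a : normc a%:C = `|a|.
Proof. by rewrite /= expr0n addr0 sqrtr_sqr. Qed.

Lemma normc_expi a : normc (expi a) = 1.
Proof. by rewrite /= cos2Dsin2 sqrtr1. Qed.

Lemma expiD a b : expi (a + b) = expi a * expi b.
Proof. by apply: complex_eqP; rewrite !reim /= ?cosD ?sinD //; ring. Qed.

Lemma cmeasurableD u v : cmeasurable u -> cmeasurable v -> cmeasurable (fun x => u x + v x).
Proof.
move=> [ur ui] [vr vi]; split; under eq_fun do rewrite reim; exact: measurable_funD.
Qed.

Lemma cmeasurableM u v : cmeasurable u -> cmeasurable v -> cmeasurable (fun x => u x * v x).
Proof.
move=> [ur ui] [vr vi]; split; under eq_fun do rewrite reim.
  by apply: measurable_funB; exact: measurable_funM.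
by apply: measurable_funD; exact: measurable_funM.
Qed.

Lemma cmeasurable_cst z : cmeasurable (fun _ : R => z).
Proof. by split; exact: measurable_cst. Qed.

Lemma measurable_normc u : cmeasurable u -> measurable_fun setT (fun x => normc (u x)).
Proof.
move=> [mr mi]; have -> : (fun x => normc (u x)) =
    (fun x => Num.sqrt (Re (u x) ^+ 2 + Im (u x) ^+ 2)).
  by apply/funext => x; case: (u x).
apply: measurableT_comp; first exact: continuous_measurable_fun (@sqrt_continuous R).
by apply: measurable_funD; exact: measurable_funX.
Qed.

Lemma Lpnorm_ge0 p u : (0 <= Lpnorm p u)%E.
Proof. exact: Lnorm_ge0. Qed.

Lemma nsq_normc u : cmeasurable u ->
  nsq (fun x => normc (u x)) = (nsq (fun x => Re (u x)) + nsq (fun x => Im (u x)))%E.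
Proof.
move=> [mr mi]; rewrite /nsq -ge0_integralD //.
- by apply: eq_integral => x _; rewrite normc_sqr EFinD.
- by move=> x _; rewrite lee_fin sqr_ge0.
- exact: measurable_sqE.
- by move=> x _; rewrite lee_fin sqr_ge0.
- exact: measurable_sqE.
Qed.

Lemma Lpnorm2_le u A : 0 <= A ->
  (Lpnorm 2%:E u <= A%:E)%E = (nsq (fun x => normc (u x)) <= (A ^+ 2)%:E)%E.
Proof. by move=> A0; rewrite -Lnorm2_le. Qed.

Lemma L2le_Lpnorm u A B : L2le (fun x => Re (u x)) A -> L2le (fun x => Im (u x)) B ->
  (Lpnorm 2%:E u <= (Num.sqrt (A + B))%:E)%E.
Proof.
move=> hA hB; have A0 := L2le_ge0 hA; have B0 := L2le_ge0 hB.
have [mr hr] := hA; have [mi hi] := hB.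
by rewrite Lpnorm2_le ?sqrtr_ge0 // sqr_sqrtr ?addr_ge0 // nsq_normc // EFinD leeD.
Qed.

Lemma Lpnorm_L2le u M : cmeasurable u -> 0 <= M -> (Lpnorm 2%:E u <= M%:E)%E ->
  L2le (fun x => Re (u x)) (M ^+ 2) /\ L2le (fun x => Im (u x)) (M ^+ 2).
Proof.
move=> mu0 M0; rewrite Lpnorm2_le // nsq_normc // => h; case: mu0 => mr mi.
by split; split => //; apply: le_trans h; rewrite ?leeDl ?leeDr ?nsq_ge0.
Qed.

Lemma L2_of_L2le u A B : L2le (fun x => Re (u x)) A -> L2le (fun x => Im (u x)) B -> L2 u.
Proof.
move=> hA hB; split; first by case: hA => ? _; case: hB.
exact: le_lt_trans (L2le_Lpnorm hA hB) (ltry _).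
Qed.

(** Real-valued L^2 norm; [fine] makes it 0 when the norm is infinite, which is why its properties
    are stated for functions in [L2]. *)
Definition n2 u : R := fine (Lpnorm 2%:E u).

Lemma n2_ge0 u : 0 <= n2 u. Proof. exact: fine_ge0 (Lpnorm_ge0 _ _). Qed.

Lemma n2E u : L2 u -> Lpnorm 2%:E u = (n2 u)%:E.
Proof. by move=> [_ h]; rewrite fineK // ge0_fin_numE // Lpnorm_ge0. Qed.

Lemma L2_L2le u : L2 u ->
  L2le (fun x => Re (u x)) (n2 u ^+ 2) /\ L2le (fun x => Im (u x)) (n2 u ^+ 2).
Proof. by move=> hu; apply: Lpnorm_L2le; rewrite ?n2_ge0 ?n2E //; case: hu. Qed.

Lemma L2D u v : L2 u -> L2 v -> L2 (fun x => u x + v x).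
Proof.
move=> /L2_L2le[ur ui] /L2_L2le[vr vi]; apply: L2_of_L2le.
  by under eq_fun do rewrite reim; exact: L2leD ur vr.
by under eq_fun do rewrite reim; exact: L2leD ui vi.
Qed.

Lemma L2Z z u : L2 u -> L2 (fun x => z * u x).
Proof.
move=> /L2_L2le[ur ui]; apply: L2_of_L2le.
  by under eq_fun do rewrite reim; exact: L2leB (L2leZ _ ur) (L2leZ _ ui).
by under eq_fun do rewrite reim; exact: L2leD (L2leZ _ ui) (L2leZ _ ur).
Qed.

Lemma L2B u v : L2 u -> L2 v -> L2 (fun x => u x - v x).
Proof.
move=> hu hv; have := L2D hu (L2Z (- 1) hv).
by under eq_fun do rewrite mulN1r.
Qed.

Lemma n2D u v : L2 u -> L2 v -> n2 (fun x => u x + v x) <= n2 u + n2 v.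
Proof.
move=> hu hv; have huv := L2D hu hv.
rewrite -lee_fin EFinD -!n2E //; have [mu_ _] := hu; have [mv _] := hv.
set f := fun x => normc (u x); set g := fun x => normc (v x).
have mf : measurable_fun setT f by exact: measurable_normc.
have mg : measurable_fun setT g by exact: measurable_normc.
have h2 : ('N[mu]_2%:E[EFin \o (f \+ g)%R] <= Lpnorm 2%:E u + Lpnorm 2%:E v)%E.
  by apply: minkowski_EFin => //; rewrite ler1n.
apply: (le_trans _ h2); have := Lnorm_ge0 mu 2%:E (EFin \o (f \+ g)).
case E : ('N[mu]_2%:E[EFin \o (f \+ g)%R])%E => [r| |] //; last by move=> _; exact: leey.
rewrite lee_fin => r0; rewrite Lpnorm2_le //.
apply: (@le_trans _ _ (nsq (fun x => f x + g x))); last by rewrite -Lnorm2_le // -E.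
apply: nsq_le; [|exact: measurable_funD|].
  by apply: measurable_normc; exact: cmeasurableD.
move=> x; rewrite !ger0_norm ?addr_ge0 ?normc_ge0 //.
exact: le_normcD.
Qed.

Lemma n2Z z u : L2 u -> n2 (fun x => z * u x) = normc z * n2 u.
Proof.
have le w v : L2 v -> n2 (fun x => w * v x) <= normc w * n2 v.
  move=> hv; have hwv := L2Z w hv; have [mv _] := hv; have [mwv _] := hwv.
  have m := measurable_normc mv.
  rewrite -lee_fin -n2E // Lpnorm2_le ?mulr_ge0 ?normc_ge0 ?n2_ge0 //.
  under eq_fun do rewrite ComplexField.Normc.normcM.
  rewrite nsqZ // exprMn [X in (_ <= X)%E]EFinM lee_wpmul2l ?lee_fin ?sqr_ge0 //.
  by rewrite -Lpnorm2_le ?n2_ge0 // n2E.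
move=> hu; apply/eqP; rewrite eq_le le //=.
have [->|z0] := eqVneq z 0.
  by rewrite ComplexField.Normc.normc0 mul0r n2_ge0.
have nz : 0 < normc z.
  by rewrite lt_def normc_ge0 andbT; apply: contra_neq z0; exact: ComplexField.Normc.eq0_normc.
(* The reverse inequality is the direct one for the factor [z^-1]. *)
rewrite -ler_pdivlMl // -ComplexField.Normc.normcV; apply: le_trans (le _ _ (L2Z z hu)).
rewrite le_eqVlt; apply/orP; left; apply/eqP; congr n2.
by apply/funext => x; rewrite mulrA mulVf // mul1r.
Qed.

Lemma aeS (P Q : R -> Prop) : (forall x, P x -> Q x) ->
  {ae mu, forall x, P x} -> {ae mu, forall x, Q x}.
Proof. by move=> PQ; apply: filterS => //; exact: (ae_filter_ringOfSetsType mu). Qed.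

Lemma Lpnorm_ae p u v : (0 < p)%E -> cmeasurable u -> cmeasurable v -> u = v %[ae mu] ->
  Lpnorm p u = Lpnorm p v.
Proof.
move=> p0 mu_ mv uv; rewrite /Lpnorm unlock /Lnorm; case: p p0 => [r| |//] r0.
  have m (w : R -> R[i]) : cmeasurable w ->
    measurable_fun setT (fun x => (`|(normc (w x))%:E| `^ r)%E).
    move=> hw; apply: (measurableT_comp (measurable_poweR r)).
    by apply: measurableT_comp => //; apply/measurable_EFinP; exact: measurable_normc.
  have E : (\int[mu]_x `|(normc (u x))%:E| `^ r = \int[mu]_x `|(normc (v x))%:E| `^ r)%E.
    apply: ae_eq_integral; [exact: measurableT|exact: m|exact: m|].
    by apply: aeS uv => x /= h _; rewrite h.
  by rewrite E.
by case: ifP => // _; apply: ess_sup_inf.eq_ess_sup; apply: aeS uv => x /= h; rewrite h.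
Qed.

Lemma n2_eq u v : L2 u -> L2 v -> u = v %[ae mu] -> n2 u = n2 v.
Proof. by move=> [mu_ _] [mv _] uv; rewrite /n2 (Lpnorm_ae _ mu_ mv uv) // lte_fin. Qed.

Lemma n2_eq0 u : L2 u -> n2 u = 0 -> u = cst 0 %[ae mu].
Proof.
move=> hu h; have [mu_ _] := hu.
have h0 : Lpnorm 2%:E u = 0%E by rewrite n2E // h.
have m : measurable_fun setT (fun x => (normc (u x))%:E).
  by apply/measurable_EFinP; exact: measurable_normc.
have := @Lnorm_eq0_eq0 _ _ _ mu (fun x => (normc (u x))%:E) 2%:E m _ h0.
rewrite lte_fin => /(_ (ltr0n _ 2)).
by apply: aeS => x /= /[apply] -[] /ComplexField.Normc.eq0_normc.
Qed.

Lemma n2_le u A B : L2le (fun x => Re (u x)) A -> L2le (fun x => Im (u x)) B ->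
  n2 u <= Num.sqrt (A + B).
Proof.
move=> hA hB; rewrite -lee_fin -n2E; last exact: L2_of_L2le hA hB.
exact: L2le_Lpnorm.
Qed.

Lemma n2B u v : L2 u -> L2 v -> n2 (fun x => u x - v x) = n2 (fun x => v x - u x).
Proof.
move=> hu hv; rewrite -[RHS]mul1r.
have -> : 1 = normc (- 1) :> R by rewrite normcN ComplexField.Normc.normc1.
rewrite -n2Z; last exact: L2B.
by congr n2; apply/funext => x; rewrite mulN1r opprB.
Qed.

Lemma n2_triangle u v (w : R -> R[i]) : L2 u -> L2 v -> L2 w ->
  n2 (fun x => u x - w x) <= n2 (fun x => u x - v x) + n2 (fun x => v x - w x).
Proof.
move=> hu hv hw; apply: le_trans (n2D (L2B hu hv) (L2B hv hw)).
rewrite le_eqVlt; apply/orP; left; apply/eqP; congr n2.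
by apply/funext => x; rewrite addrA subrK.
Qed.

Lemma cintegrableD u v : cintegrable u -> cintegrable v -> cintegrable (fun x => u x + v x).
Proof.
move=> [ur ui] [vr vi]; split; under eq_fun do rewrite reim.
  exact: (L1D ur vr).
exact: (L1D ui vi).
Qed.

Lemma cintegrableZ z u : cintegrable u -> cintegrable (fun x => z * u x).
Proof.
move=> [ur ui]; split; under eq_fun do rewrite reim.
  exact: (L1B (L1Z (Re z) ur) (L1Z (Im z) ui)).
exact: (L1D (L1Z (Re z) ui) (L1Z (Im z) ur)).
Qed.

Lemma cintegralD u v : cintegrable u -> cintegrable v ->
  cintegral (fun x => u x + v x) = cintegral u + cintegral v.
Proof.
move=> [ur ui] [vr vi]; apply: complex_eqP; rewrite reim /=;
  under eq_fun do rewrite reim.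
  exact: (ID ur vr).
exact: (ID ui vi).
Qed.

Lemma cintegralZ z u : cintegrable u -> cintegral (fun x => z * u x) = z * cintegral u.
Proof.
move=> [ur ui]; apply: complex_eqP; rewrite reim /=; under eq_fun do rewrite reim.
  by rewrite (IB (L1Z (Re z) ur) (L1Z (Im z) ui)) (IZ _ ur) (IZ _ ui).
by rewrite (ID (L1Z (Re z) ui) (L1Z (Im z) ur)) (IZ _ ur) (IZ _ ui).
Qed.

Lemma normc_le_norm z : normc z <= `|Re z| + `|Im z|.
Proof.
apply: normc_sqr_le; first by rewrite addr_ge0.
rewrite -(real_normK (num_real (Re z))) -(real_normK (num_real (Im z))).
by rewrite sqrrD lerD2r lerDl mulrn_wge0 // mulr_ge0.
Qed.

Lemma complex_cvg T (F : set_system T) (FF : Filter F) (f g : T -> R) a b :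
  f x @[x --> F] --> a -> g x @[x --> F] --> b ->
  (f x +i* g x : R[i]^o) @[x --> F] --> (a +i* b : R[i]^o).
Proof.
move=> fa gb; apply/cvgrPdist_lt => -[e e'] /=; rewrite ltcE /= => /andP[/eqP -> e0].
have e2 : 0 < e / 2 by rewrite divr_gt0.
near=> x.
have h1 : `|a - f x| < e / 2 by near: x; move/cvgrPdist_lt : fa; exact.
have h2 : `|b - g x| < e / 2 by near: x; move/cvgrPdist_lt : gb; exact.
rewrite normc_def ltcE /= eqxx /=.
apply: (le_lt_trans (normc_le_norm ((a - f x) +i* (b - g x)))) => /=.
by rewrite [e]splitr ltrD.
Unshelve. all: end_near. Qed.

Lemma continuous_ReIm u : continuous (u : R -> R[i]^o) ->
  continuous (fun x => Re (u x)) /\ continuous (fun x => Im (u x)).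
Proof.
move=> cu; split => x; apply/cvgrPdist_lt => e e0.
  near=> y; have : `|u x - u y| < e%:C.
    by near: y; have /cvgrPdist_lt := cu x; apply; rewrite ltcR.
  rewrite normc_def ltcE /= eqxx /=; apply: le_lt_trans.
  by move: (Re_le_normc (u x - u y)); rewrite ReD ReN; case: (u x); case: (u y).
near=> y; have : `|u x - u y| < e%:C.
  by near: y; have /cvgrPdist_lt := cu x; apply; rewrite ltcR.
rewrite normc_def ltcE /= eqxx /=; apply: le_lt_trans.
by move: (Im_le_normc (u x - u y)); rewrite ImD ImN; case: (u x); case: (u y).
Unshelve. all: end_near. Qed.

End ComplexL2.

(** * Components of the distorted transform *)

Section DistortedComponents.
Context {R : realType}.
Local Notation mu := (@lebesgue_measure R).
Local Notation L1 f := (mu.-integrable setT (EFin \o f)).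
Local Notation I f := (Rintegral mu setT f).
Local Notation normc := ComplexField.Normc.normc.
Local Notation Re := complex.Re.
Local Notation Im := complex.Im.
Variable q : R.
Implicit Types (a b x xi eta : R) (f g : R -> R) (u v : R -> R[i]).

(* [chi1 + i chi2] is the conjugate of [rq]. *)
Definition chi1 xi : R := - (q ^+ 2 / (q ^+ 2 + xi ^+ 2)).
Definition chi2 xi : R := q * xi / (q ^+ 2 + xi ^+ 2).

Lemma chi_den xi : q ^+ 2 + xi ^+ 2 = 0 -> q = 0 /\ xi = 0.
Proof.
move=> /eqP; rewrite paddr_eq0 ?sqr_ge0 // !sqrf_eq0 => /andP[/eqP -> /eqP ->]; split => //.
Qed.

Lemma iBq eta : 'i%C * eta%:C - q%:C = (- q) +i* eta :> R[i].
Proof. by apply: complex_eqP => /=; ring. Qed.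

Lemma conjc_rq eta : conjc (rq q eta) = chi1 eta +i* chi2 eta.
Proof.
rewrite /rq iBq /chi1 /chi2; apply: complex_eqP => /=; rewrite sqrrN; first ring.
by rewrite mul0r addr0 mulrN opprK mulrA.
Qed.

Lemma iBq_neq0 eta : q != 0 -> 'i%C * eta%:C - q%:C != 0 :> R[i].
Proof.
by move=> q0; rewrite iBq; apply: contra_neq q0 => -[/eqP]; rewrite oppr_eq0 => /eqP.
Qed.

Lemma tq_rq eta : tq q eta = 1 + rq q eta.
Proof.
rewrite /tq /rq; have [->|q0] := eqVneq q 0.
  by rewrite mul0r addr0.
have d0 := iBq_neq0 eta q0.
by apply: (mulIf d0); rewrite mulrDl !mulfVK // mul1r subrK.
Qed.

Lemma tq_neq0 eta : eta != 0 -> tq q eta != 0.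
Proof.
move=> e0; rewrite /tq; have [_|q0] := eqVneq q 0; first exact: oner_neq0.
rewrite mulf_neq0 ?invr_eq0 ?iBq_neq0 // mulf_neq0 //.
  by apply/eqP => -[/eqP]; rewrite oner_eq0.
by apply: contra_neq e0 => -[].
Qed.

Lemma conjc_expi a : conjc (expi a) = expi (- a).
Proof. by rewrite /expi cosN sinN. Qed.

Lemma chi1N xi : chi1 (- xi) = chi1 xi. Proof. by rewrite /chi1 sqrrN. Qed.

(** When [x] and [xi] have opposite signs the two exponentials coincide and [1 + rq = tq] merges
    them; when they have the same sign, multiplication by [tq] clears the denominators. *)
Lemma conjc_Psi x xi : conjc (Psi q x (- xi)) =
  expi (x * xi) + (chi1 xi +i* chi2 `|xi|) * expi (- `|x * xi|).
Proof.
have E1 (t A B r : R[i]) : t != 0 -> t * (t^-1 * A + r / t * B) = A + r * B.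
  by move=> t0; field.
have cD (z w : R[i]) : conjc (z + w) = conjc z + conjc w by rewrite rmorphD.
have cM (z w : R[i]) : conjc (z * w) = conjc z * conjc w by rewrite rmorphM.
have c1 : conjc (1 : R[i]) = 1 by exact: conjc1.
have e0 : expi (0 : R) = 1 by rewrite /expi cos0 sin0.
rewrite /Psi oppr_ge0; have [xi0|xi0|->] := ltgtP xi 0.
- have n0 : tq q (- xi) != 0 by apply: tq_neq0; rewrite oppr_eq0 lt_eqF.
  rewrite ltr0_norm // -chi1N -conjc_rq /fplus normrM (ltr0_norm xi0).
  have [x0|x0] := leP 0 x.
    rewrite ger0_norm // tq_rq cM cD c1 conjc_expi mulrDl mul1r.
    by rewrite !mulrN !opprK.
  by rewrite E1 // cD cM !conjc_expi ltr0_norm // !mulrN mulNr !opprK.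
- have n0 : tq q xi != 0 by apply: tq_neq0; rewrite gt_eqF.
  rewrite opprK gtr0_norm // -conjc_rq /fminus normrM (gtr0_norm xi0).
  have [x0|x0] := leP 0 x.
    by rewrite ger0_norm // E1 // cD cM !conjc_expi opprK.
  by rewrite ltr0_norm // tq_rq cM cD c1 conjc_expi mulrDl mul1r mulNr !opprK.
(* At [xi = 0] with [q != 0], [tq q 0] is 0 and so is its inverse by convention; both sides vanish,
   since [1 + rq q 0 = tq q 0]. *)
- rewrite oppr0 /fplus !mulr0 !normr0 oppr0 e0 -conjc_rq.
  have -> : 1 + conjc (rq q 0) * 1 = conjc (tq q 0) by rewrite tq_rq cD c1 mulr1.
  congr conjc.
  have [_|_] := leP 0 x; first by rewrite mulr1.
  have [t0|t0] := eqVneq (tq q 0) 0; first by rewrite t0 mul0r.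
  by rewrite E1 // mulr1 tq_rq.
Qed.

Lemma chi_q0 : q = 0 -> chi1 = cst 0 /\ chi2 = cst 0.
Proof.
by move=> q0; split; apply/funext => x; rewrite /chi1 /chi2 q0 ?expr0n /= !mul0r ?oppr0.
Qed.

Definition chi1' xi : R := 2 * q ^+ 2 * xi / (q ^+ 2 + xi ^+ 2) ^+ 2.
Definition chi2' xi : R := q * (q ^+ 2 - xi ^+ 2) / (q ^+ 2 + xi ^+ 2) ^+ 2.

Lemma is_derive_chi xi : q != 0 ->
  is_derive xi (1 : R) chi1 (chi1' xi) /\ is_derive xi (1 : R) chi2 (chi2' xi).
Proof.
move=> q0; have d0 y : q ^+ 2 + y ^+ 2 != 0.
  by rewrite gt_eqF // ltr_wpDr ?sqr_ge0 // exprn_even_gt0.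
have D0 : is_derive xi (1 : R) (fun y => q ^+ 2 + y ^+ 2) (2 * xi).
  by apply: is_derive_eq; rewrite /GRing.scale /=; ring.
have D : is_derive xi (1 : R) (fun y => (q ^+ 2 + y ^+ 2)^-1)
    (- (2 * xi / (q ^+ 2 + xi ^+ 2) ^+ 2)).
  have := @is_deriveV _ (fun y => q ^+ 2 + y ^+ 2) xi _ 1 (d0 xi) D0.
  by rewrite /GRing.scale /= mulNr mulrC.
split.
  apply: is_derive_eq; rewrite /chi1' /GRing.scale /=; ring.
apply: is_derive_eq; rewrite /chi2' /GRing.scale /=; field; exact: d0.
Qed.

(** Folds an integral over the line onto the positive half line ([I_fold_even]), where [|x * xi|] is
    linear in [xi] and the absolute value inside [chi2] disappears. *)
Definition fold_even f xi : R := (0 < xi)%R%:R * (f xi + f (- xi)).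

Lemma measurable_pos : measurable_fun setT (fun xi : R => ((0 < xi)%R%:R : R)).
Proof.
rewrite (_ : (fun _ => _) = \1_(`]0, +oo[ : set (measurableTypeR R))) //.
by apply/funext => xi; rewrite indicE mem_setE /= in_itv /= andbT.
Qed.

Lemma pos_norm xi : `|((0 < xi)%R%:R : R)| <= 1.
Proof. by case: (0 < xi); rewrite ?normr1 ?normr0. Qed.

Lemma L1_reflect f : L1 f -> L1 (fun xi => f (- xi)).
Proof.
move=> l; have := @integrable_affine _ f (- 1) 0 _ l; rewrite oppr_eq0 oner_eq0 => /(_ isT).
by under eq_fun do rewrite mulN1r addr0.
Qed.

Lemma L1_fold_even f : L1 f -> L1 (fold_even f).
Proof.
move=> l; rewrite /fold_even; under eq_fun do rewrite mulrC.
apply: (L1_Ml (M := 1)); [|exact: measurable_pos|exact: pos_norm].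
by apply: L1D => //; exact: L1_reflect.
Qed.

Lemma I_fold_even f : L1 f -> I (fold_even f) = I f.
Proof.
move=> l; have lr := L1_reflect l.
have mf := L1_measurable l; have mr := L1_measurable lr.
have lp g : L1 g -> L1 (fun xi => (0 < xi)%R%:R * g xi).
  move=> lg; under eq_fun do rewrite mulrC.
  by apply: (L1_Ml (M := 1)); [|exact: measurable_pos|exact: pos_norm].
transitivity (I (fun xi => (0 < xi)%R%:R * f xi) + I (fun xi => (0 < xi)%R%:R * f (- xi))).
  by rewrite -ID; [|exact: lp|exact: lp]; congr Rintegral; apply/funext => xi;
    rewrite /fold_even mulrDr.
have mpr : measurable_fun setT (fun xi : R => (((0 < - xi)%R)%:R : R)).
  by apply: (measurableT_comp measurable_pos); exact: measurable_funN.
rewrite -[X in _ + X]I_reflect; last exact: L1_measurable (lp _ lr).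
under [X in _ + Rintegral _ _ X]eq_fun do rewrite opprK.
rewrite -ID; [|exact: lp|]; last first.
  under eq_fun do rewrite mulrC; apply: (L1_Ml (M := 1)) => // xi.
  by case: (_ < _); rewrite ?normr1 ?normr0.
apply: (@I_eq_off1 _ _ _ 0) => //.
  by apply: measurable_funD; apply: measurable_funM => //; exact: measurable_pos.
by move=> x x0; rewrite oppr_gt0; case: (ltgtP x 0) x0 => //= _ _;
  rewrite mul1r mul0r ?add0r ?addr0.
Qed.

Lemma L2le_fold_even f A : L2le f A -> L2le (fold_even f) (4 * A).
Proof.
move=> h; rewrite /fold_even; under eq_fun do rewrite mulrC.
apply: L2le_Mb; [|exact: measurable_pos|exact: pos_norm].
rewrite (_ : 4 * A = 2 * A + 2 * A); last by ring.
by apply: L2leD => //; exact: L2le_reflect.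
Qed.

(* Real and imaginary parts of the profile
   [h xi = (chi1 xi + i chi2 xi) (u xi + u (- xi))] on [xi > 0], where
   [u = f + i g]: the transform of [u] is the sum of the Fourier integrals of
   [u] at [x] and of [h] at [- |x|]. *)
Definition refl1 f g xi : R := chi1 xi * fold_even f xi - chi2 xi * fold_even g xi.
Definition refl2 f g xi : R := chi1 xi * fold_even g xi + chi2 xi * fold_even f xi.

Lemma measurable_chi : measurable_fun setT chi1 /\ measurable_fun setT chi2.
Proof.
have [/chi_q0[-> ->]|q0] := eqVneq q 0; first by split; exact: measurable_cst.
by split; apply: continuous_measurable_fun => x; apply: differentiable_continuous;
  apply/derivable1_diffP; have [[h _] [h' _]] := is_derive_chi x q0.
Qed.

Lemma chi_sqr_le1 xi : chi1 xi ^+ 2 + chi2 xi ^+ 2 <= 1.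
Proof.
have [/chi_q0[-> ->]|q0] := eqVneq q 0; first by rewrite expr0n addr0.
have q2 : 0 < q ^+ 2 by rewrite exprn_even_gt0.
have d0 : 0 < q ^+ 2 + xi ^+ 2 by rewrite ltr_wpDr ?sqr_ge0.
have -> : chi1 xi ^+ 2 + chi2 xi ^+ 2 = q ^+ 2 / (q ^+ 2 + xi ^+ 2).
  by rewrite /chi1 /chi2; field; rewrite gt_eqF.
by rewrite ler_pdivrMr // mul1r lerDl sqr_ge0.
Qed.

Lemma chi1_le1 xi : `|chi1 xi| <= 1.
Proof.
rewrite -ler_sqr ?nnegrE // expr1n real_normK ?num_real //.
by apply: le_trans (chi_sqr_le1 xi); rewrite lerDl sqr_ge0.
Qed.

Lemma chi2_le1 xi : `|chi2 xi| <= 1.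
Proof.
rewrite -ler_sqr ?nnegrE // expr1n real_normK ?num_real //.
by apply: le_trans (chi_sqr_le1 xi); rewrite lerDr sqr_ge0.
Qed.

Lemma L1_refl f g : L1 f -> L1 g -> L1 (refl1 f g) /\ L1 (refl2 f g).
Proof.
move=> /L1_fold_even lf /L1_fold_even lg; have [m1 m2] := measurable_chi.
have L (c h : R -> R) : measurable_fun setT c -> (forall xi, `|c xi| <= 1) -> L1 h ->
    L1 (fun xi => c xi * h xi).
  by move=> mc c1 lh; under eq_fun do rewrite mulrC; exact: L1_Ml mc c1.
split; [apply: L1B|apply: L1D]; apply: L => //; solve [exact: chi1_le1|exact: chi2_le1].
Qed.

Lemma L2le_refl f g A : L2le f A -> L2le g A ->
  L2le (refl1 f g) (16 * A) /\ L2le (refl2 f g) (16 * A).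
Proof.
move=> /L2le_fold_even lf /L2le_fold_even lg; have [m1 m2] := measurable_chi.
have L (c h : R -> R) : measurable_fun setT c -> (forall xi, `|c xi| <= 1) -> L2le h (4 * A) ->
    L2le (fun xi => c xi * h xi) (4 * A).
  by move=> mc c1 lh; under eq_fun do rewrite mulrC; exact: L2le_Mb.
rewrite (_ : 16 * A = 2 * (4 * A) + 2 * (4 * A)); last by ring.
split; [apply: L2leB|apply: L2leD]; apply: L => //; solve [exact: chi1_le1|exact: chi2_le1].
Qed.

(** [FR f g + i FI f g] is the Fourier integral of [f + i g], without normalisation. *)
Definition FR f g x : R := CT f x - ST g x.
Definition FI f g x : R := CT g x + ST f x.

Local Notation N := ((Num.sqrt (2 * pi))^-1 : R).

Definition DR f g x : R := N * (FR f g x + FR (refl1 f g) (refl2 f g) (- `|x|)).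
Definition DI f g x : R := N * (FI f g x + FI (refl1 f g) (refl2 f g) (- `|x|)).

Lemma distorted_iftE u x : cintegrable u ->
  cintegrable (fun xi => conjc (Psi q x (- xi)) * u xi) /\
  distorted_ift_integral q u x =
    DR (fun xi => Re (u xi)) (fun xi => Im (u xi)) x +i*
    DI (fun xi => Re (u xi)) (fun xi => Im (u xi)) x.
Proof.
move=> [lf lg]; set f := fun xi => Re (u xi); set g := fun xi => Im (u xi).
have {}lf : L1 f by []; have {}lg : L1 g by [].
have [mf mg] := (L1_measurable lf, L1_measurable lg).
have [m1 m2] := measurable_chi.
have Lc (c h : R -> R) : measurable_fun setT c -> (forall xi, `|c xi| <= 1) -> L1 h ->
    L1 (fun xi => c xi * h xi).
  by move=> mc c1 lh; under eq_fun do rewrite mulrC; exact: L1_Ml mc c1.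
pose k2 xi := chi2 `|xi|.
have mk2 : measurable_fun setT k2 by apply: (measurableT_comp m2);
  exact: continuous_measurable_fun (@norm_continuous _ R).
have k21 xi : `|k2 xi| <= 1 by exact: chi2_le1.
pose G1 xi := chi1 xi * f xi - k2 xi * g xi.
pose G2 xi := chi1 xi * g xi + k2 xi * f xi.
have lG1 : L1 G1 by apply: L1B; apply: Lc => //; exact: chi1_le1.
have lG2 : L1 G2 by apply: L1D; apply: Lc => //; exact: chi1_le1.
have mab : measurable_fun setT (fun xi => `|x * xi|).
  by apply: measurableT_comp; [exact: continuous_measurable_fun (@norm_continuous _ R)|exact: measurable_funM].
have lcos h : L1 h -> L1 (fun xi => h xi * cos `|x * xi|).
  move=> lh; apply: (L1_Ml (M := 1)) => // [|xi]; last exact: cos_norm_le1.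
  exact: measurableT_comp (@measurable_cos R) mab.
have lsin h : L1 h -> L1 (fun xi => h xi * sin `|x * xi|).
  move=> lh; apply: (L1_Ml (M := 1)) => // [|xi]; last exact: sin_norm_le1.
  exact: measurableT_comp (@measurable_sin R) mab.
have [lc1 ls1] := (lcos _ lG1, lsin _ lG1); have [lc2 ls2] := (lcos _ lG2, lsin _ lG2).
have [lcf lsf] := (L1_Mcos x lf, L1_Msin x lf); have [lcg lsg] := (L1_Mcos x lg, L1_Msin x lg).
have ER xi : Re (conjc (Psi q x (- xi)) * u xi) =
   (f xi * cos (x * xi) - g xi * sin (x * xi)) +
   (G1 xi * cos `|x * xi| + G2 xi * sin `|x * xi|).
  rewrite conjc_Psi !reim /= cosN sinN -/(f xi) -/(g xi) /G1 /G2 /k2; ring.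
have EI xi : Im (conjc (Psi q x (- xi)) * u xi) =
   (g xi * cos (x * xi) + f xi * sin (x * xi)) +
   (G2 xi * cos `|x * xi| - G1 xi * sin `|x * xi|).
  rewrite conjc_Psi !reim /= cosN sinN -/(f xi) -/(g xi) /G1 /G2 /k2; ring.
have [lr1 lr2] := L1_refl lf lg.
(* After folding, the reflected term is a plain Fourier integral of the profile, taken at
   [- |x|]. *)
have FRE : I (fun xi => G1 xi * cos `|x * xi| + G2 xi * sin `|x * xi|) =
    FR (refl1 f g) (refl2 f g) (- `|x|).
  rewrite -I_fold_even; last exact: L1D.
  rewrite /FR /CT /ST -IB; [|exact: L1_Mcos|exact: L1_Msin].
  congr Rintegral; apply/funext => xi; rewrite /fold_even /refl1 /refl2 /fold_even /G1 /G2 /k2.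
  case: (ltP 0 xi) => xi0; last by rewrite !mul0r !mulr0 !(subr0, addr0) !mul0r subr0.
  have -> : - `|x| * xi = - `|x * xi| by rewrite normrM (gtr0_norm xi0) mulNr.
  rewrite [x * - xi]mulrN !normrN (gtr0_norm xi0) cosN sinN chi1N; ring.
have FIE : I (fun xi => G2 xi * cos `|x * xi| - G1 xi * sin `|x * xi|) =
    FI (refl1 f g) (refl2 f g) (- `|x|).
  rewrite -I_fold_even; last exact: L1B.
  rewrite /FI /CT /ST -ID; [|exact: L1_Mcos|exact: L1_Msin].
  congr Rintegral; apply/funext => xi; rewrite /fold_even /refl1 /refl2 /fold_even /G1 /G2 /k2.
  case: (ltP 0 xi) => xi0; last by rewrite !mul0r !mulr0 !(subr0, addr0) !mul0r addr0.
  have -> : - `|x| * xi = - `|x * xi| by rewrite normrM (gtr0_norm xi0) mulNr.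
  rewrite [x * - xi]mulrN !normrN (gtr0_norm xi0) cosN sinN chi1N; ring.
split.
  split; [under eq_fun do rewrite ER|under eq_fun do rewrite EI].
    by apply: (L1D (L1B lcf lsg) (L1D lc1 ls2)).
  by apply: (L1D (L1D lcg lsf) (L1B lc2 ls1)).
rewrite /distorted_ift_integral; apply: complex_eqP; rewrite ?ReM ?ImM /= !mul0r ?subr0 ?addr0.
  rewrite /DR -FRE /FR /CT /ST -IB // -ID //; [|exact: L1B|exact: L1D].
  by under eq_fun do rewrite ER.
rewrite /DI -FIE /FI /CT /ST -ID // -ID //; [|exact: L1D|exact: L1B].
by under eq_fun do rewrite EI.
Qed.

Lemma L2le_abs h A : L2le h A -> L2le (fun x => `|h x|) A.
Proof.
move=> hk; apply: (L2le_le _ _ hk) => [|x]; last by rewrite normr_id.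
by apply: measurableT_comp; [exact: continuous_measurable_fun (@norm_continuous _ R)|case: hk].
Qed.

(** The value at [- |x|] is one of [h x] and [h (- x)], hence dominated by the sum of their
    moduli. *)
Lemma L2le_reflect_abs h A : L2le h A -> L2le (fun x => h (- `|x|)) (4 * A).
Proof.
move=> ha; have hr := L2le_reflect ha; have [mh _] := ha.
have := L2leD (L2le_abs ha) (L2le_abs hr); rewrite (_ : 2 * A + 2 * A = 4 * A); last by ring.
apply: L2le_le.
  apply: (measurableT_comp mh); apply: measurable_funN; exact: continuous_measurable_fun (@norm_continuous _ R).
move=> x; rewrite [X in _ <= X]ger0_norm ?addr_ge0 //.
have [x0|x0] := leP 0 x; first by rewrite (ger0_norm x0) lerDr.
by rewrite (ltr0_norm x0) opprK lerDl.
Qed.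

Lemma L2le_D f g A : L1 f -> L1 g -> L2le f A -> L2le g A ->
  L2le (DR f g) (N ^+ 2 * (65 * (8 * (16 * kb)) * A)) /\
  L2le (DI f g) (N ^+ 2 * (65 * (8 * (16 * kb)) * A)).
Proof.
move=> lf lg hf hg; have [lr1 lr2] := L1_refl lf lg; have [hr1 hr2] := L2le_refl hf hg.
have [cf sf] := plancherel lf hf; have [cg sg] := plancherel lg hg.
have [cr1 sr1] := plancherel lr1 hr1; have [cr2 sr2] := plancherel lr2 hr2.
(* [65 = 1 + 64]: the reflected term loses a factor 16 for the profile and 4 for the substitution of
   [- |x|]. *)
have E : 65 * (8 * (16 * kb)) * A = 2 * (2 * (16 * kb * A) + 2 * (16 * kb * A)) +
   2 * (4 * (2 * (16 * kb * (16 * A)) + 2 * (16 * kb * (16 * A)))) by ring.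
by rewrite E; split; apply: L2leZ; apply: L2leD; do ?[exact: L2leB|exact: L2leD|apply: L2le_reflect_abs];
  solve [exact: L2leB|exact: L2leD].
Qed.

(** This bound is what allows comparing transforms of different approximants of the same profile in
    L^2. *)
Lemma n2_distorted_ift : exists2 C, 0 <= C & forall u, L2 u -> cintegrable u ->
  L2 (distorted_ift_integral q u) /\ n2 (distorted_ift_integral q u) <= C * n2 u.
Proof.
exists (Num.sqrt (2 * (N ^+ 2 * (65 * (8 * (16 * kb)))))); first exact: sqrtr_ge0.
move=> u hu lu; have [hr hi] := L2_L2le hu.
have [lr li] := lu; have [h1 h2] := L2le_D lr li hr hi.
set f := (fun xi => Re (u xi)) in h1 h2; set g := (fun xi => Im (u xi)) in h1 h2.
have eR : (fun x => Re (distorted_ift_integral q u x)) = DR f g.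
  by apply/funext => x; rewrite (distorted_iftE x lu).2.
have eI : (fun x => Im (distorted_ift_integral q u x)) = DI f g.
  by apply/funext => x; rewrite (distorted_iftE x lu).2.
rewrite -eR in h1; rewrite -eI in h2.
split; first exact: (L2_of_L2le h1 h2).
have h := @n2_le _ (distorted_ift_integral q u) _ _ h1 h2.
apply: (le_trans h).
have c0 : 0 <= 2 * (N ^+ 2 * (65 * (8 * (16 * kb)))) :> R.
  by do !apply: mulr_ge0; rewrite ?ler0n ?invr_ge0 ?sqrtr_ge0 ?kb_ge0.
have n0 := n2_ge0 u.
have -> : N ^+ 2 * (65 * (8 * (16 * kb)) * n2 u ^+ 2) + N ^+ 2 * (65 * (8 * (16 * kb)) * n2 u ^+ 2) =
    2 * (N ^+ 2 * (65 * (8 * (16 * kb)))) * n2 u ^+ 2 by ring.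
by rewrite sqrtrM // sqrtr_sqr ger0_norm.
Qed.

Lemma distorted_iftD (z : R[i]) u v x : cintegrable u -> cintegrable v ->
  distorted_ift_integral q (fun xi => z * u xi + v xi) x =
  z * distorted_ift_integral q u x + distorted_ift_integral q v x.
Proof.
move=> lu lv; have [ku _] := distorted_iftE x lu; have [kv _] := distorted_iftE x lv.
rewrite /distorted_ift_integral.
have -> : (fun xi => conjc (Psi q x (- xi)) * (z * u xi + v xi)) =
    (fun xi => z * (conjc (Psi q x (- xi)) * u xi) + conjc (Psi q x (- xi)) * v xi).
  by apply/funext => xi; rewrite mulrDr mulrCA.
rewrite (cintegralD (cintegrableZ z ku) kv) (cintegralZ z ku) mulrDr.
by rewrite [X in X + _]mulrCA.
Qed.

End DistortedComponents.

(** * The domain of the Hamiltonian *)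

Section CompactSupport.
Context {R : realType}.
Local Notation mu := (@lebesgue_measure R).
Local Notation L1 f := (mu.-integrable setT (EFin \o f)).
Local Notation I f := (Rintegral mu setT f).
Implicit Types (a b x xi c K M : R) (f g : R -> R).

(** Continuity is left out because truncated profiles jump; boundedness and compact support survive
    multiplication by powers of [xi], as differentiating the transform requires. *)
Definition cpt f : Prop := measurable_fun setT f /\
  exists K M, [/\ 0 <= K, 0 <= M & forall x, `|f x| <= M * ind (- K) K x].

Lemma cpt_L1 f : cpt f -> L1 f.
Proof.
move=> [mf [K [M [K0 M0 h]]]]; apply: (L1_le mf h); apply: L1Z; exact: L1_ind.
Qed.

Lemma cpt_L2le f : cpt f -> exists A, L2le f A.
Proof.
move=> [mf [K [M [K0 M0 h]]]]; exists (M ^+ 2 * (K - - K)).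
apply: (L2le_le mf _ (L2leZ M (L2le_ind _))); last by lra.
by move=> x; rewrite [X in _ <= X]ger0_norm // mulr_ge0 ?ind_ge0.
Qed.

Lemma cptMb f g : cpt f -> measurable_fun setT g ->
  (forall K, exists M, forall x, - K <= x <= K -> `|g x| <= M) -> cpt (fun x => g x * f x).
Proof.
move=> [mf [K [M [K0 M0 h]]]] mg bg; split; first exact: measurable_funM.
have [M' h'] := bg K; exists K, (`|M'| * M); split=> // [|x]; first exact: mulr_ge0.
have := h x; rewrite /ind; case: (boolP (- K <= x <= K)) => [xK|_].
  rewrite !mulr1 normrM => hx; apply: ler_pM => //.
  exact: le_trans (h' x xK) (ler_norm _).
by rewrite !mulr0 normr_le0 => /eqP ->; rewrite mulr0 normr0.
Qed.

Lemma cptM1 f g : cpt f -> measurable_fun setT g -> (forall x, `|g x| <= 1) ->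
  cpt (fun x => g x * f x).
Proof. by move=> cf mg g1; apply: cptMb => // K; exists 1. Qed.

Lemma cptZ c f : cpt f -> cpt (fun x => c * f x).
Proof. by move=> cf; apply: cptMb => // K; exists `|c|. Qed.

Lemma cptX f : cpt f -> cpt (fun x => x * f x).
Proof. by move=> cf; apply: cptMb => // K; exists K => x; rewrite ler_norml. Qed.

Lemma cptD f g : cpt f -> cpt g -> cpt (fun x => f x + g x).
Proof.
move=> [mf [K [M [K0 M0 h]]]] [mg [K' [M' [K0' M0' h']]]].
split; first exact: measurable_funD.
exists (Num.max K K'), (M + M'); split => [||x]; rewrite ?le_max ?K0 ?addr_ge0 //.
apply: (le_trans (ler_normD _ _)); rewrite mulrDl.
have ind_max L L' : 0 <= L -> L <= L' -> ind (- L) L x <= ind (- L') L' x.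
  move=> L0 LL; rewrite /ind ler_nat; case: (boolP (- L <= x <= L)) => // /andP[h1 h2].
  by rewrite (le_trans _ h1) ?lerN2 // (le_trans h2).
by apply: lerD; [apply: (le_trans (h x))|apply: (le_trans (h' x))];
  rewrite ler_wpM2l // ind_max // le_max lexx ?orbT.
Qed.

Lemma cptN f : cpt f -> cpt (fun x => - f x).
Proof. by move=> /(cptZ (-1)); under eq_fun do rewrite mulN1r. Qed.

Lemma cptB f g : cpt f -> cpt g -> cpt (fun x => f x - g x).
Proof. by move=> cf cg; apply: cptD => //; exact: cptN. Qed.

Lemma cpt_reflect f : cpt f -> cpt (fun x => f (- x)).
Proof.
move=> [mf [K [M [K0 M0 h]]]]; split.
  by apply: (measurableT_comp mf); exact: measurable_funN.
exists K, M; split => // x; apply: (le_trans (h _)).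
by rewrite /ind lerN2 lerNl andbC.
Qed.

Lemma cpt_fold_even f : cpt f -> cpt (fold_even f).
Proof.
move=> cf; apply: cptM1; [|exact: measurable_pos|exact: pos_norm].
by apply: cptD => //; exact: cpt_reflect.
Qed.

Lemma cpt_refl q f g : cpt f -> cpt g -> cpt (refl1 q f g) /\ cpt (refl2 q f g).
Proof.
move=> /cpt_fold_even cf /cpt_fold_even cg; have [m1 m2] := measurable_chi q.
by split; [apply: cptB|apply: cptD]; apply: cptM1 => // xi; solve [exact: chi1_le1|exact: chi2_le1].
Qed.

Lemma CTZ c f x : L1 f -> CT (fun xi => c * f xi) x = c * CT f x.
Proof.
by move=> lf; rewrite /CT -IZ; [under eq_fun do rewrite -mulrA|exact: L1_Mcos].
Qed.

Lemma STZ c f x : L1 f -> ST (fun xi => c * f xi) x = c * ST f x.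
Proof.
by move=> lf; rewrite /ST -IZ; [under eq_fun do rewrite -mulrA|exact: L1_Msin].
Qed.

Lemma is_derive_CT f x : cpt f -> is_derive x (1 : R) (CT f) (- ST (fun xi => xi * f xi) x).
Proof.
move=> cf; have lf := cpt_L1 cf; have lx := cpt_L1 (cptX cf).
rewrite /ST -IN; last exact: L1_Msin.
apply: (@is_derive_under_integral _ (fun x xi => f xi * cos (x * xi))
  (fun x xi => - (xi * f xi * sin (x * xi))) setT x (x - 1) (x + 1)
  (fun xi => `|xi * f xi|)) => //.
- by rewrite ltrBlDr !ltrDl ltr01.
- by move=> y _; exact: L1_Mcos.
- by move=> y xi _ _; apply: is_derive_eq; rewrite /GRing.scale /=; ring.
- exact: L1_abs.
- by move=> y xi _ _; rewrite normrN normrM ler_piMr // sin_norm_le1.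
Qed.

Lemma is_derive_ST f x : cpt f -> is_derive x (1 : R) (ST f) (CT (fun xi => xi * f xi) x).
Proof.
move=> cf; have lf := cpt_L1 cf; have lx := cpt_L1 (cptX cf).
apply: (@is_derive_under_integral _ (fun x xi => f xi * sin (x * xi))
  (fun x xi => xi * f xi * cos (x * xi)) setT x (x - 1) (x + 1)
  (fun xi => `|xi * f xi|)) => //.
- by rewrite ltrBlDr !ltrDl ltr01.
- by move=> y _; exact: L1_Msin.
- by move=> y xi _ _; apply: is_derive_eq; rewrite /GRing.scale /=; ring.
- exact: L1_abs.
- by move=> y xi _ _; rewrite normrM ler_piMr // cos_norm_le1.
Qed.

Local Notation X f := (fun xi : R => xi * f xi).

Lemma is_derive_FR f g x : cpt f -> cpt g -> is_derive x (1 : R) (FR f g) (- FI (X f) (X g) x).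
Proof.
move=> cf cg; have D1 := is_derive_CT x cf; have D2 := is_derive_ST x cg.
by apply: is_derive_eq; rewrite /FI; ring.
Qed.

Lemma is_derive_FI f g x : cpt f -> cpt g -> is_derive x (1 : R) (FI f g) (FR (X f) (X g) x).
Proof.
move=> cf cg; have D1 := is_derive_CT x cg; have D2 := is_derive_ST x cf.
by apply: is_derive_eq; rewrite /FR; ring.
Qed.

Lemma L2le_F f g : cpt f -> cpt g -> exists A, L2le (FR f g) A /\ L2le (FI f g) A.
Proof.
move=> cf cg; have [A hf] := cpt_L2le cf; have [B hg] := cpt_L2le cg.
have [cf' sf] := plancherel (cpt_L1 cf) hf; have [cg' sg] := plancherel (cpt_L1 cg) hg.
exists (2 * (16 * kb * A) + 2 * (16 * kb * B)); split; first exact: L2leB.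
by rewrite addrC; exact: L2leD.
Qed.

Lemma F0 f g : FR f g 0 = I f /\ FI f g 0 = I g.
Proof.
have c (k : R -> R) : CT k 0 = I k by rewrite /CT; under eq_fun do rewrite mul0r cos0 mulr1.
have s (k : R -> R) : ST k 0 = 0.
  by rewrite /ST; under eq_fun do rewrite mul0r sin0 mulr0; rewrite /Rintegral integral0.
by rewrite /FR /FI !c !s subr0 addr0.
Qed.

End CompactSupport.

(** * Functions with two smooth branches meeting at 0 *)

Section Piecewise.
Context {R : realType}.
Local Notation mu := (@lebesgue_measure R).
Local Notation L1 f := (mu.-integrable setT (EFin \o f)).
Local Notation I f := (Rintegral mu setT f).
Implicit Types (a b x c K M A : R) (fp fm gp gm : R -> R).

Definition pw fp fm x : R := if 0 < x then fp x else fm x.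

Lemma measurable_pw fp fm : continuous fp -> continuous fm -> measurable_fun setT (pw fp fm).
Proof.
move=> cp cm; have mp := continuous_measurable_fun cp; have mm := continuous_measurable_fun cm.
rewrite (_ : pw fp fm = fun x => (0 < x)%R%:R * (fp x - fm x) + fm x).
  apply: measurable_funD => //; apply: measurable_funM; first exact: measurable_pos.
  exact: measurable_funB.
by apply/funext => x; rewrite /pw; case: (0 < x); rewrite ?mul1r ?subrK // mul0r add0r.
Qed.

Lemma L2le_pw fp fm A : continuous fp -> continuous fm -> L2le fp A -> L2le fm A ->
  L2le (pw fp fm) (4 * A).
Proof.
move=> cp cm hp hm.
have := L2leD (L2le_abs hp) (L2le_abs hm); rewrite (_ : 2 * A + 2 * A = 4 * A); last by ring.
apply: L2le_le; first exact: measurable_pw.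
move=> x; rewrite [X in _ <= X]ger0_norm ?addr_ge0 // /pw.
by case: (0 < x); rewrite ?lerDl ?lerDr.
Qed.

Lemma pw_cvg fp fm : continuous fp -> continuous fm ->
  [/\ forall x, x != 0 -> {for x, continuous (pw fp fm)},
      pw fp fm x @[x --> 0^'+] --> fp 0 & pw fp fm x @[x --> 0^'-] --> fm 0].
Proof.
move=> cp cm; split.
- move=> x x0; have [x_gt0|x_lt0|x00] := ltgtP x 0; last by rewrite x00 eqxx in x0.
    rewrite /prop_for /continuous_at {2}/pw ltNge (ltW x_gt0) /=.
    apply: cvg_trans (cm x); apply: near_eq_cvg; near=> y.
    rewrite /pw ifF //; apply/negbTE; rewrite -leNgt ltW //.
    by near: y; apply: lt_nbhsl.
  rewrite /prop_for /continuous_at {2}/pw x_lt0.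
  apply: cvg_trans (cp x); apply: near_eq_cvg; near=> y.
  by rewrite /pw ifT //; near: y; apply: lt_nbhsr.
- apply: (@cvg_trans _ (fp x @[x --> 0^'+])); last exact: cvg_at_right_filter (cp 0).
  apply: near_eq_cvg; near=> y; rewrite /pw ifT //.
- apply: (@cvg_trans _ (fm x @[x --> 0^'-])); last exact: cvg_at_left_filter (cm 0).
  apply: near_eq_cvg; near=> y; rewrite /pw ifF //; apply/negbTE; rewrite -leNgt ltW //.
Unshelve. all: end_near. Qed.

Lemma test_function_bounded D (eta : R -> R) : test_function D eta ->
  exists2 K, 0 < K & forall x, K <= `|x| -> eta x = 0 /\ derive1 eta x = 0.
Proof.
move=> [dn cpt _]; have [K [K0 hK]] : exists K, 0 < K /\ forall x, eta x != 0 -> `|x| <= K.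
  have := compact_bounded cpt => /pinfty_ex_gt0[K K0 hK]; exists K; split => // x ex.
  by apply: hK; exact: subset_closure.
(* The margin puts every such point inside the open set where [eta] vanishes, so the derivative
   vanishes too. *)
exists (K + 1); first by rewrite addr_gt0.
move=> x xK; have z y : K < `|y| -> eta y = 0.
  by move=> yK; apply/eqP; apply: contraTT yK => /hK; rewrite leNgt.
have Kx : K < `|x| by apply: lt_le_trans xK; rewrite ltrDl.
split; first exact: z.
rewrite derive1E.
have D0 : is_derive x (1 : R) eta 0.
  apply: (@near_eq_is_derive _ _ _ (cst 0)).
    have : \forall y \near x, K < `|y|.
      by apply: (cvgr_gt _ (@norm_continuous _ R x)).
    by apply: filterS => y /z ->.
by case: D0.
Qed.

(** Integration by parts on each side of 0 leaves the boundary term [(fp 0 - fm 0) * eta 0]. It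
    vanishes by continuity at 0, or because the test function avoids 0; both cases occur below. *)
Lemma pw_weak D (eta : R -> R) fp fm gp gm :
  (forall x, is_derive x (1 : R) fp (gp x)) -> (forall x, is_derive x (1 : R) fm (gm x)) ->
  continuous gp -> continuous gm -> test_function D eta -> (fp 0 - fm 0) * eta 0 = 0 ->
  I (fun x => pw fp fm x * derive1 eta x) = - I (fun x => pw gp gm x * eta x).
Proof.
move=> dp dm cgp cgm te j0; have [K K0 hK] := test_function_bounded te.
have de x : is_derive x (1 : R) eta (derive1 eta x).
  by rewrite derive1E; case: te => /(_ 0 x) h _ _; exact: DeriveDef.
have dc (f g : R -> R) : (forall x, is_derive x (1 : R) f (g x)) -> continuous f.
  by move=> df x; apply: differentiable_continuous; apply/derivable1_diffP; case: (df x).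
have ce := dc _ _ de.
have ce' : continuous (derive1 eta).
  move=> x; apply: differentiable_continuous; apply/derivable1_diffP.
  by case: te => /(_ 1%N x).
have me := continuous_measurable_fun ce; have me' := continuous_measurable_fun ce'.
have cfp := dc _ _ dp; have cfm := dc _ _ dm.
have split2 (hp hm e : R -> R) : continuous hp -> continuous hm -> continuous e ->
    (forall x, K <= `|x| -> e x = 0) ->
    I (fun x => pw hp hm x * e x) =
    I (fun x => ind 0 K x * (hp x * e x)) + I (fun x => ind (- K) 0 x * (hm x * e x)).
  move=> chp chm che e0.
  have c1 : continuous (fun x => hp x * e x) by move=> x; exact: cvgM (chp x) (che x).
  have c2 : continuous (fun x => hm x * e x) by move=> x; exact: cvgM (chm x) (che x).
  rewrite -ID; [|exact: L1_ind_continuous|exact: L1_ind_continuous].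
  apply: (@I_eq_off1 _ _ _ 0).
  - by apply: measurable_funM; [exact: measurable_pw|exact: continuous_measurable_fun].
  - by apply: measurable_funD; apply: measurable_funM; (exact: measurable_ind ||
      exact: continuous_measurable_fun).
  - move=> x x0; rewrite /pw /ind; have [xK|xK] := leP K `|x|.
      by rewrite e0 // !mulr0 addr0.
    move: xK; rewrite ltr_norml => /andP[xK1 xK2].
    by case: (ltgtP x 0) x0 => // _ _; rewrite ?(ltW xK1) ?(ltW xK2) /= ?mul1r ?mul0r ?add0r ?addr0.
have IB1 (f g : R -> R) a b : a <= b -> (forall x, is_derive x (1 : R) f (g x)) -> continuous g ->
    I (fun x => ind a b x * (f x * derive1 eta x)) =
    f b * eta b - f a * eta a - I (fun x => ind a b x * (g x * eta x)).
  move=> ab df cg; apply: ibp => //; first exact: continuous_measurable_fun (dc _ _ df).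
  - exact: continuous_measurable_fun.
  - exact: L1_ind_continuous.
  - by move=> u v uv; rewrite (I_ind_ftc df).
rewrite !split2 //; try by move=> x /hK[].
rewrite !IB1 // ?oppr_le0 ?(ltW K0) //.
have [eK _] : eta K = 0 /\ derive1 eta K = 0 by apply: hK; rewrite ger0_norm // ltW.
have [eNK _] : eta (- K) = 0 /\ derive1 eta (- K) = 0.
  by apply: hK; rewrite normrN ger0_norm // ltW.
rewrite eK eNK !mulr0; move: j0; rewrite mulrBl => /eqP; rewrite subr_eq0 => /eqP ->; ring.
Qed.

End Piecewise.

(** * Transforms of compactly supported profiles and the Hamiltonian *)

Section Domain.
Context {R : realType}.
Local Notation mu := (@lebesgue_measure R).
Local Notation L1 f := (mu.-integrable setT (EFin \o f)).
Local Notation I f := (Rintegral mu setT f).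
Local Notation Re := complex.Re.
Local Notation Im := complex.Im.
Local Notation X f := (fun xi : R => xi * f xi).
Local Notation N := ((Num.sqrt (2 * pi))^-1 : R).
Implicit Types (x xi : R) (f g h k : R -> R).

(** One branch of the transform: [c] is -1 for [x > 0] and 1 otherwise, so that [c * x = - |x|],
    while [s] collects the factors [c] produced by successive derivatives. *)
Definition refl_sum (F : (R -> R) -> (R -> R) -> R -> R) f g h k (s c x : R) : R :=
  N * (F f g x + s * F h k (c * x)).

Lemma is_derive_refl_sumR f g h k s c x : cpt f -> cpt g -> cpt h -> cpt k ->
  is_derive x (1 : R) (refl_sum (@FR R) f g h k s c)
    (- refl_sum (@FI R) (X f) (X g) (X h) (X k) (s * c) c x).
Proof.
move=> cf cg ch ck; have D1 := is_derive_FR x cf cg.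
have D2 : is_derive x (1 : R) (fun x => FR h k (c * x)) (- (c * FI (X h) (X k) (c * x))).
  have := @is_derive_affine_comp _ (FR h k) c 0 x _ (is_derive_FR (c * x + 0) ch ck).
  by under eq_fun do rewrite addr0; rewrite addr0 mulrN.
by apply: is_derive_eq; rewrite /refl_sum /GRing.scale /=; ring.
Qed.

Lemma is_derive_refl_sumI f g h k s c x : cpt f -> cpt g -> cpt h -> cpt k ->
  is_derive x (1 : R) (refl_sum (@FI R) f g h k s c)
    (refl_sum (@FR R) (X f) (X g) (X h) (X k) (s * c) c x).
Proof.
move=> cf cg ch ck; have D1 := is_derive_FI x cf cg.
have D2 : is_derive x (1 : R) (fun x => FI h k (c * x)) (c * FR (X h) (X k) (c * x)).
  have := @is_derive_affine_comp _ (FI h k) c 0 x _ (is_derive_FI (c * x + 0) ch ck).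
  by under eq_fun do rewrite addr0; rewrite addr0.
by apply: is_derive_eq; rewrite /refl_sum /GRing.scale /=; ring.
Qed.

Lemma derive_continuous f g : (forall x, is_derive x (1 : R) f (g x)) -> continuous f.
Proof.
by move=> df x; apply: differentiable_continuous; apply/derivable1_diffP; case: (df x).
Qed.

Lemma continuous_refl_sum f g h k s c : cpt f -> cpt g -> cpt h -> cpt k ->
  continuous (refl_sum (@FR R) f g h k s c) /\ continuous (refl_sum (@FI R) f g h k s c).
Proof.
by move=> cf cg ch ck; split; apply: derive_continuous => x;
  [exact: is_derive_refl_sumR|exact: is_derive_refl_sumI].
Qed.

Lemma L2le_refl_sum f g h k s c : cpt f -> cpt g -> cpt h -> cpt k -> c != 0 ->
  exists A, L2le (refl_sum (@FR R) f g h k s c) A /\ L2le (refl_sum (@FI R) f g h k s c) A.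
Proof.
move=> cf cg ch ck c0; have [A [r i]] := L2le_F cf cg; have [B [r' i']] := L2le_F ch ck.
have P F F' : L2le F A -> L2le F' B ->
    L2le (fun x => N * (F x + s * F' (c * x))) (N ^+ 2 * (2 * A + 2 * (s ^+ 2 * (`|c|^-1 * B)))).
  move=> hF hF'; apply: L2leZ; apply: L2leD => //; apply: L2leZ.
  by have := L2le_affine 0 c0 hF'; under eq_fun do rewrite addr0.
by exists (N ^+ 2 * (2 * A + 2 * (s ^+ 2 * (`|c|^-1 * B)))); split; exact: P.
Qed.

(* The identity [- i xi rho = q (1 + rho)] with [rho = chi1 + i chi2], which
   becomes the jump condition at 0. *)
Lemma refl_jump q f g : cpt f -> cpt g ->
  I (X (refl2 q f g)) = q * (I f + I (refl1 q f g)) /\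
  - I (X (refl1 q f g)) = q * (I g + I (refl2 q f g)).
Proof.
move=> cf cg; have [c1 c2] := cpt_refl q cf cg.
have [ef eg] := (cpt_fold_even cf, cpt_fold_even cg).
have J xi a b : a = 0 \/ 0 < xi -> b = 0 \/ 0 < xi ->
   xi * (chi1 q xi * b + chi2 q xi * a) = q * (a + (chi1 q xi * a - chi2 q xi * b)).
  move=> ha hb; have [[_ x0]|d0] := pselect (q = 0 /\ xi = 0).
    by case: ha => [->|]; case: hb => [->|]; rewrite ?x0 ?ltxx // !(mulr0, subr0, addr0).
  have {}d0 : q ^+ 2 + xi ^+ 2 != 0 by apply/eqP => /chi_den.
  by rewrite /chi1 /chi2; field.
have fe0 k xi : fold_even k xi = 0 \/ 0 < xi.
  by rewrite /fold_even; case: (ltP 0 xi) => _; [right|left; rewrite mul0r].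
rewrite -(I_fold_even (cpt_L1 cf)) -(I_fold_even (cpt_L1 cg)); split.
  rewrite -ID; [|exact: cpt_L1|exact: cpt_L1].
  rewrite -IZ; last by apply: cpt_L1; exact: cptD.
  by congr Rintegral; apply/funext => xi; rewrite /refl1 /refl2 J.
rewrite -ID; [|exact: cpt_L1|exact: cpt_L1].
rewrite -IZ; last by apply: cpt_L1; exact: cptD.
rewrite -IN; last by apply: cpt_L1; exact: cptX.
congr Rintegral; apply/funext => xi; rewrite /refl1 /refl2.
(* The second identity is the first one for [- i (f + i g)], whose components are [g] and [- f]. *)
have := J xi (fold_even g xi) (- fold_even f xi) (fe0 _ _) _.
rewrite mulrN => H; rewrite -mulrN opprB addrC H ?mulrN ?opprK //.
by case: (fe0 f xi) => [->|]; [left; rewrite oppr0|right].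
Qed.

(** [xi^2] is even and therefore commutes with the folding, unlike a single factor [xi]. *)
Lemma refl_X2 q f g : refl1 q (X (X f)) (X (X g)) = X (X (refl1 q f g)) /\
  refl2 q (X (X f)) (X (X g)) = X (X (refl2 q f g)).
Proof.
by split; apply/funext => xi; rewrite /refl1 /refl2 /fold_even; ring.
Qed.

Lemma reflZ q c f g : refl1 q (fun xi => c * f xi) (fun xi => c * g xi) =
    (fun xi => c * refl1 q f g xi) /\
  refl2 q (fun xi => c * f xi) (fun xi => c * g xi) = (fun xi => c * refl2 q f g xi).
Proof.
by split; apply/funext => xi; rewrite /refl1 /refl2 /fold_even; ring.
Qed.

Lemma FZ c f g x : cpt f -> cpt g ->
  FR (fun xi => c * f xi) (fun xi => c * g xi) x = c * FR f g x /\
  FI (fun xi => c * f xi) (fun xi => c * g xi) x = c * FI f g x.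
Proof.
move=> /cpt_L1 lf /cpt_L1 lg; rewrite /FR /FI !CTZ // !STZ //; split; ring.
Qed.

Lemma D_pw q f g :
  DR q f g = pw (refl_sum (@FR R) f g (refl1 q f g) (refl2 q f g) 1 (- 1))
                (refl_sum (@FR R) f g (refl1 q f g) (refl2 q f g) 1 1) /\
  DI q f g = pw (refl_sum (@FI R) f g (refl1 q f g) (refl2 q f g) 1 (- 1))
                (refl_sum (@FI R) f g (refl1 q f g) (refl2 q f g) 1 1).
Proof.
split; apply/funext => x; rewrite /pw /DR /DI /refl_sum !mul1r mulN1r;
  by case: ltP => x0; rewrite ?(gtr0_norm x0) // ler0_norm // opprK.
Qed.

Definition ccpt (u : R -> R[i]) := cpt (fun xi => Re (u xi)) /\ cpt (fun xi => Im (u xi)).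

Lemma ccpt_cintegrable u : ccpt u -> cintegrable u.
Proof. by move=> [/cpt_L1 ? /cpt_L1]. Qed.

Lemma ccpt_L2 u : ccpt u -> L2 u.
Proof.
move=> [/cpt_L2le[A hA] /cpt_L2le[B hB]].
exact: (L2_of_L2le hA hB).
Qed.

(** Both branches of the transform are differentiated under the integral, each derivative inserting
    a factor [xi]. The first weak derivative is taken on the whole line because the branches agree
    at 0, the second only off 0. Two factors [i xi] make [- u'' / 2] the transform of [xi^2 / 2]
    times the profile. *)
Lemma domain q u : ccpt u ->
  delta_hamiltonian q (distorted_ift_integral q u)
    (distorted_ift_integral q (fun xi => (xi ^+ 2 / 2)%:C * u xi)).
Proof.
move=> hu; have [cf cg] := hu.
set f := fun xi => Re (u xi) in cf; set g := fun xi => Im (u xi) in cg.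
have [cr1 cr2] := cpt_refl q cf cg.
set r1 := refl1 q f g in cr1; set r2 := refl2 q f g in cr2.
have [cXf cXg] := (cptX cf, cptX cg); have [cXr1 cXr2] := (cptX cr1, cptX cr2).
have [cXXf cXXg] := (cptX cXf, cptX cXg); have [cXXr1 cXXr2] := (cptX cXr1, cptX cXr2).
pose u0 (c : R) : R -> R[i] := fun x => refl_sum (@FR R) f g r1 r2 1 c x +i*
  refl_sum (@FI R) f g r1 r2 1 c x.
pose a1 c := (fun x => - refl_sum (@FI R) (X f) (X g) (X r1) (X r2) (1 * c) c x).
pose b1 c := refl_sum (@FR R) (X f) (X g) (X r1) (X r2) (1 * c) c.
pose a2 c := (fun x => - refl_sum (@FR R) (X (X f)) (X (X g)) (X (X r1)) (X (X r2)) (1 * c * c) c x).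
pose b2 c := (fun x => - refl_sum (@FI R) (X (X f)) (X (X g)) (X (X r1)) (X (X r2)) (1 * c * c) c x).
pose u1 x := pw (a1 (- 1)) (a1 1) x +i* pw (b1 (- 1)) (b1 1) x.
pose u2 x := pw (a2 (- 1)) (a2 1) x +i* pw (b2 (- 1)) (b2 1) x.
have dR c x : is_derive x (1 : R) (refl_sum (@FR R) f g r1 r2 1 c) (a1 c x).
  exact: is_derive_refl_sumR.
have dI c x : is_derive x (1 : R) (refl_sum (@FI R) f g r1 r2 1 c) (b1 c x).
  exact: is_derive_refl_sumI.
have da c x : is_derive x (1 : R) (a1 c) (a2 c x).
  by apply: is_deriveN; exact: is_derive_refl_sumI.
have db c x : is_derive x (1 : R) (b1 c) (b2 c x) by exact: is_derive_refl_sumR.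
have cR c := derive_continuous (dR c); have cI c := derive_continuous (dI c).
have ca c := derive_continuous (da c); have cb c := derive_continuous (db c).
have [ca2 cb2] : (forall c, continuous (a2 c)) /\ (forall c, continuous (b2 c)).
  by split => c x; apply: cvgN; have [h1 h2] := continuous_refl_sum (1 * c * c) c cXXf cXXg cXXr1 cXXr2;
    [exact: h1|exact: h2].
have [eR eI] := D_pw q f g; rewrite -/r1 -/r2 in eR eI.
have uE x : distorted_ift_integral q u x = DR q f g x +i* DI q f g x.
  exact: (distorted_iftE q x (ccpt_cintegrable hu)).2.
have weak (D : set R) (U V : R -> R[i]) :
  (forall eta, test_function D eta ->
    I (fun x => Re (U x) * derive1 eta x) = - I (fun x => Re (V x) * eta x)) ->
  (forall eta, test_function D eta ->
    I (fun x => Im (U x) * derive1 eta x) = - I (fun x => Im (V x) * eta x)) ->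
  weak_derivative D U V.
  have ReR (z : R[i]) a : Re (z * a%:C) = Re z * a by rewrite ReM /= mulr0 subr0.
  have ImR (z : R[i]) a : Im (z * a%:C) = Im z * a by rewrite ImM /= mulr0 add0r.
  move=> hRe hIm eta te; apply: complex_eqP; rewrite ?ReN ?ImN /=.
    have -> : (fun x => Re (V x * (eta x)%:C)) = (fun x => Re (V x) * eta x).
      by apply/funext => x; exact: ReR.
    by under eq_fun do rewrite ReR; exact: hRe.
  have -> : (fun x => Im (V x * (eta x)%:C)) = (fun x => Im (V x) * eta x).
    by apply/funext => x; exact: ImR.
  by under eq_fun do rewrite ImR; exact: hIm.
have n1 : - 1 != 0 :> R by rewrite oppr_eq0 oner_eq0.
have n0 : 1 != 0 :> R by rewrite oner_eq0.
have L2pw (p1 m1 p2 m2 : R -> R) A B : continuous p1 -> continuous m1 -> continuous p2 ->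
    continuous m2 -> L2le p1 A /\ L2le p2 A -> L2le m1 B /\ L2le m2 B ->
    L2 (fun x => pw p1 m1 x +i* pw p2 m2 x).
  move=> cp1 cm1 cp2 cm2 [h1 h2] [h3 h4].
  have W (k : R -> R) : L2le k A -> L2le k (Num.max A B) by apply: L2leW; rewrite le_max lexx.
  have W' (k : R -> R) : L2le k B -> L2le k (Num.max A B).
    by apply: L2leW; rewrite le_max lexx orbT.
  apply: (@L2_of_L2le _ _ (4 * Num.max A B) (4 * Num.max A B)) => /=.
    by apply: L2le_pw => //; [exact: W|exact: W'].
  by apply: L2le_pw => //; [exact: W|exact: W'].
have L2u1 : L2 u1.
  have [A [hA hB]] := L2le_refl_sum (1 * -1) cXf cXg cXr1 cXr2 n1.
  have [A' [hA' hB']] := L2le_refl_sum (1 * 1) cXf cXg cXr1 cXr2 n0.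
  by apply: (L2pw _ _ _ _ A A') => //; split => //; exact: L2leN.
have L2u2 : L2 u2.
  have [A [hA hB]] := L2le_refl_sum (1 * -1 * -1) cXXf cXXg cXXr1 cXXr2 n1.
  have [A' [hA' hB']] := L2le_refl_sum (1 * 1 * 1) cXXf cXXg cXXr1 cXXr2 n0.
  by apply: (L2pw _ _ _ _ A A') => //; split => //; exact: L2leN.
have eta0 (eta : R -> R) : test_function (~` [set 0]) eta -> eta 0 = 0.
  move=> [_ _ sub]; apply/eqP; apply/negPn/negP => e0.
  have h : closure [set x | eta x != 0] 0 by apply: subset_closure.
  by have := sub 0 h; apply.
have [pa pap pam] := pw_cvg (ca (-1)) (ca 1); have [pb pbp pbm] := pw_cvg (cb (-1)) (cb 1).
exists u1, u2; split.
- split => //.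
    have [C _ hC] := n2_distorted_ift q.
    by have [] := hC u (ccpt_L2 hu) (ccpt_cintegrable hu).
  apply: weak => eta te.
    under eq_fun do rewrite uE /= eR.
    apply: (pw_weak (dR (-1)) (dR 1) (ca (-1)) (ca 1) te).
    by rewrite /refl_sum !mulr0 subrr mul0r.
  under eq_fun do rewrite uE /= eI.
  apply: (pw_weak (dI (-1)) (dI 1) (cb (-1)) (cb 1) te).
  by rewrite /refl_sum !mulr0 subrr mul0r.
- split => //; apply: weak => eta te.
    apply: (pw_weak (da (-1)) (da 1) (ca2 (-1)) (ca2 1) te).
    by rewrite (eta0 _ te) mulr0.
  apply: (pw_weak (db (-1)) (db 1) (cb2 (-1)) (cb2 1) te).
  by rewrite (eta0 _ te) mulr0.
- exists (distorted_ift_integral q u), u1, (a1 (-1) 0 +i* b1 (-1) 0), (a1 1 0 +i* b1 1 0); split.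
  + split; last exact: aeW.
    have cn : continuous (fun x : R => - `|x|).
      by move=> x; apply: cvgN; exact: norm_continuous.
    have [cFR cFI] : continuous (FR f g) /\ continuous (FI f g).
      by split; apply: derive_continuous => x; [exact: is_derive_FR|exact: is_derive_FI].
    have [cRR cRI] : continuous (FR r1 r2) /\ continuous (FI r1 r2).
      by split; apply: derive_continuous => x; [exact: is_derive_FR|exact: is_derive_FI].
    have cD (k k' : R -> R) : continuous k -> continuous k' ->
        continuous (fun x => N * (k x + k' (- `|x|))).
      move=> ck ck' x; apply: cvgM; first exact: cvg_cst.
      apply: cvgD; first exact: ck.
      exact: (@cvg_comp _ _ _ (fun x => - `|x|) k' _ _ _ (cn x) (ck' _)).
    have -> : distorted_ift_integral q u = (fun x => DR q f g x +i* DI q f g x).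
      by apply/funext.
    by move=> x; apply: complex_cvg; [exact: (cD _ _ cFR cRR x)|exact: (cD _ _ cFI cRI x)].
  + split; last exact: aeW.
    move=> x; rewrite inE /= => /eqP x0; apply: complex_cvg; [exact: pa|exact: pb].
  + exact: complex_cvg.
  + exact: complex_cvg.
  (* The terms in [X f] and [X g] are common to both sides and cancel; the reflected terms enter
     with opposite signs, which gives the factor 2 of the jump condition. *)
  + have [j1 j2] := refl_jump q cf cg; rewrite -/r1 -/r2 in j1 j2.
    have F0 := F0; have e k k' : FR k k' 0 = I k /\ FI k k' 0 = I k' := F0 _ k k'.
    rewrite uE; apply: complex_eqP => /=; rewrite ?mul0r ?subr0 ?addr0.
      rewrite /a1 /DR /refl_sum normr0 oppr0 !mulr0 !(e _ _).1 !(e _ _).2 -/r1 -/r2.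
      by rewrite j1; ring.
    rewrite /b1 /DI /refl_sum normr0 oppr0 !mulr0 !(e _ _).1 !(e _ _).2 -/r1 -/r2.
    by rewrite -[I (X r1)]opprK j2; ring.
- apply: aeW => x _.
  have eRe : (fun xi => Re ((xi ^+ 2 / 2)%:C * u xi)) = (fun xi => 2^-1 * (X (X f)) xi).
    by apply/funext => xi; rewrite ReM /= mul0r subr0 /f; ring.
  have eIm : (fun xi => Im ((xi ^+ 2 / 2)%:C * u xi)) = (fun xi => 2^-1 * (X (X g)) xi).
    by apply/funext => xi; rewrite ImM /= mul0r addr0 /g; ring.
  have cw : cintegrable (fun xi => (xi ^+ 2 / 2)%:C * u xi).
    by apply: ccpt_cintegrable; split; [rewrite eRe|rewrite eIm]; exact: cptZ.
  rewrite (distorted_iftE q x cw).2 eRe eIm.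
  have [z1 z2] := reflZ q 2^-1 (X (X f)) (X (X g)); have [y1 y2] := refl_X2 q f g.
  rewrite /DR /DI z1 z2 y1 y2 -/r1 -/r2.
  rewrite !(FZ _ _ cXXf cXXg).1 !(FZ _ _ cXXf cXXg).2 !(FZ _ _ cXXr1 cXXr2).1 !(FZ _ _ cXXr1 cXXr2).2.
  rewrite /u2 /pw /a2 /b2 /refl_sum.
  have -> : - 2^-1 = (- 2^-1)%:C :> R[i] by rewrite rmorphN fmorphV rmorph_nat.
  case: (ltP 0 x) => x0; rewrite ?(gtr0_norm x0) ?(ler0_norm x0) ?opprK !mul1r ?mulN1r.
    by apply: complex_eqP => /=; ring.
  by apply: complex_eqP => /=; ring.
Qed.

End Domain.

(** * Evolution *)

Section Taylor.
Context {R : realType}.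
Implicit Types (y : R) (f df : R -> R).

Lemma increment_le f df y M : 0 <= y -> (forall c, is_derive c (1 : R) f (df c)) ->
  (forall c, 0 <= c <= y -> `|df c| <= M) -> `|f y - f 0| <= y * M.
Proof.
rewrite le_eqVlt => /orP[/eqP <-|y0] dF hM; first by rewrite subrr normr0 mul0r.
have cf : {within `[0, y], continuous f}.
  apply: continuous_subspaceT => x; apply: differentiable_continuous; apply/derivable1_diffP.
  by case: (dF x).
have [c + ->] := MVT y0 (fun x _ => dF x) cf.
rewrite in_itv /= => /andP[c0 cy]; rewrite subr0 normrM mulrC (ger0_norm (ltW y0)).
by rewrite ler_wpM2l ?(ltW y0) // hM // (ltW c0) (ltW cy).
Qed.

(** Successive mean value estimates: [|sin c| <= c] yields the bound on [cos y - 1], and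
    [|1 - cos c| <= c] the one on [y - sin y]. *)
Lemma trigo_taylor y : `|cos y - 1| <= y ^+ 2 /\ `|y - sin y| <= y ^+ 2.
Proof.
wlog y0 : y / 0 <= y.
  move=> H; have [|y0] := leP 0 y; first exact: H.
  have := H (- y); rewrite oppr_ge0 (ltW y0) cosN sinN sqrrN => /(_ isT)[h1 h2].
  by split => //; rewrite -normrN opprB addrC -[sin y]opprK.
have s (c : R) : 0 <= c -> `|sin c| <= c.
  move=> c0; have := @increment_le sin cos c 1 c0 _ (fun d _ => cos_norm_le1 d).
  by rewrite sin0 subr0 mulr1; apply => d; exact: is_derive_sin.
have D (d : R) : is_derive d (1 : R) cos (- sin d) by exact: is_derive_cos.
have co (c : R) : 0 <= c -> `|cos c - 1| <= c ^+ 2.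
  move=> c0; have := increment_le c0 D; rewrite cos0 expr2; apply => d /andP[d0 dc].
  by rewrite normrN (le_trans (s _ d0)).
have co1 (c : R) : 0 <= c -> `|1 - cos c| <= c.
  move=> c0; have := increment_le (M := 1) c0 D; rewrite distrC cos0 mulr1; apply => d _.
  by rewrite normrN sin_norm_le1.
have D' (d : R) : is_derive d (1 : R) (fun d => d - sin d) (1 - cos d) by exact: is_deriveB.
split; first exact: co.
have := increment_le y0 D'; rewrite sin0 subr0 subr0 expr2; apply => d /andP[d0 dc].
by rewrite (le_trans (co1 _ d0)).
Qed.

End Taylor.

Section Dynamics.
Context {R : realType}.
Local Notation mu := (@lebesgue_measure R).
Local Notation Re := complex.Re.
Local Notation Im := complex.Im.
Local Notation normc := ComplexField.Normc.normc.
Variables (q : R) (U : R -> (R -> R[i]) -> (R -> R[i])).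
Hypothesis hU : unitary_group_of (delta_hamiltonian q) U.
Implicit Types (u v : R -> R[i]) (s t h : R).
Local Notation T := (distorted_ift_integral q).

Lemma U_L2 t u : L2 u -> L2 (U t u).
Proof. by case: hU => -[h _ _ _] _ _ _; exact: h. Qed.

Lemma U_dist t u v : L2 u -> L2 v ->
  n2 (fun x => U t u x - U t v x) = n2 (fun x => u x - v x).
Proof.
case: hU => -[_ _ lin iso] _ _ _ hu hv.
have huv := L2B hu hv; have hvu := L2D (L2Z (-1) hv) hu.
have hU1 := U_L2 t hu; have hU2 := U_L2 t hv.
transitivity (n2 (U t (fun x => -1 * v x + u x))).
  apply: n2_eq; [exact: L2B|exact: U_L2|].
  apply: aeS (lin t (-1) _ _ hv hu) => x /= h /h ->.
  by rewrite mulN1r addrC.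
rewrite /n2 iso //; congr (fine (Lpnorm _ _)); apply/funext => x.
by rewrite mulN1r addrC.
Qed.

(** The expected action of the group on the distorted Fourier side, confirmed by [U_evolve]. *)
Definition evolve t (u : R -> R[i]) xi : R[i] := expi (- (t * (xi ^+ 2 / 2))) * u xi.

Lemma ccptM (k : R -> R[i]) u : cmeasurable k ->
  (forall K, exists M, forall x, - K <= x <= K -> normc (k x) <= M) ->
  ccpt u -> ccpt (fun x => k x * u x).
Proof.
move=> [mr mi] bk [cr ci].
have br K : exists M, forall x, - K <= x <= K -> `|Re (k x)| <= M.
  by have [M hM] := bk K; exists M => x /hM; apply: le_trans; exact: Re_le_normc.
have bi K : exists M, forall x, - K <= x <= K -> `|Im (k x)| <= M.
  by have [M hM] := bk K; exists M => x /hM; apply: le_trans; exact: Im_le_normc.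
split; under eq_fun do rewrite ?ReM ?ImM.
  by apply: cptB; exact: cptMb.
by apply: cptD; exact: cptMb.
Qed.

Lemma cmeasurable_phase t : cmeasurable (fun xi : R => expi (- (t * (xi ^+ 2 / 2)))).
Proof.
have m : measurable_fun setT (fun xi : R => - (t * (xi ^+ 2 / 2))).
  apply: measurable_funN; apply: measurable_funM => //.
  by apply: measurable_funM => //; exact: measurable_funX.
by split; [exact: (measurableT_comp (@measurable_cos R))|exact: (measurableT_comp (@measurable_sin R))].
Qed.

Lemma ccpt_evolve t u : ccpt u -> ccpt (evolve t u).
Proof.
apply: ccptM => [|K]; first exact: cmeasurable_phase.
by exists 1 => x _; rewrite normc_expi.
Qed.

Lemma ccptZ (z : R[i]) u : ccpt u -> ccpt (fun x => z * u x).
Proof. by apply: ccptM => [|K]; [exact: cmeasurable_cst|exists (normc z)]. Qed.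

Lemma ccptD u v : ccpt u -> ccpt v -> ccpt (fun x => u x + v x).
Proof.
by move=> [ur ui] [vr vi]; split; under eq_fun do rewrite reim; exact: cptD.
Qed.

Lemma evolveD s t u : evolve (s + t) u = evolve s (evolve t u).
Proof.
by apply/funext => xi; rewrite /evolve mulrA -expiD mulrDl opprD.
Qed.

Lemma ccpt_T u : ccpt u -> L2 (T u).
Proof.
by move=> cu; have [C _ /(_ u (ccpt_L2 cu) (ccpt_cintegrable cu))[]] := n2_distorted_ift q.
Qed.

Lemma ccpt_pow n c u : ccpt u -> ccpt (fun xi => (xi ^+ n / c)%:C * u xi).
Proof.
apply: ccptM => [|K].
  split; last exact: measurable_cst.
  by apply: measurable_funM => //; exact: measurable_funX.
exists (`|K| ^+ n * `|c^-1|) => x xK; rewrite normcR normrM ler_wpM2r // normrX.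
apply: lerXn2r; rewrite ?nnegrE //; apply: (@le_trans _ _ K); last exact: ler_norm.
by rewrite ler_norml.
Qed.

Lemma n2_mono u v : L2 u -> L2 v -> (forall x, normc (u x) <= normc (v x)) -> n2 u <= n2 v.
Proof.
move=> hu hv uv; have [[mu_ _] [mv _]] := (hu, hv).
rewrite -lee_fin -n2E // Lpnorm2_le ?n2_ge0 //.
apply: (@le_trans _ _ (nsq (fun x => normc (v x)))).
  apply: nsq_le; try exact: measurable_normc.
  by move=> x; rewrite !ger0_norm ?normc_ge0.
by rewrite -Lpnorm2_le ?n2_ge0 // n2E.
Qed.

(** [|exp (- i y) - 1 + i y| <= 2 y^2] at [y = h xi^2 / 2] bounds the second-order remainder by
    [h^2 xi^4 / 2] times [u], which is square integrable by compact support. *)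
Lemma taylor_evolve u : ccpt u -> exists C, forall h,
  n2 (fun x => T (evolve h u) x - (T u x - 'i%C * h%:C * T (fun xi => (xi ^+ 2 / 2)%:C * u xi) x))
  <= C * h ^+ 2.
Proof.
move=> cu; have [C C0 hC] := n2_distorted_ift q.
have c2 := ccpt_pow 2 2 cu; have c4 := ccpt_pow 4 2 cu.
exists (C * n2 (fun xi => (xi ^+ 4 / 2)%:C * u xi)) => h.
have ce := ccpt_evolve h cu.
pose psi xi := 'i%C * h%:C * ((xi ^+ 2 / 2)%:C * u xi) + (-1 * u xi + evolve h u xi).
have c1 : ccpt (fun xi => -1 * u xi + evolve h u xi) by apply: ccptD => //; exact: ccptZ.
have cpsi : ccpt psi by apply: ccptD => //; exact: ccptZ.
have -> : (fun x => T (evolve h u) x -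
    (T u x - 'i%C * h%:C * T (fun xi => (xi ^+ 2 / 2)%:C * u xi) x)) = T psi.
  apply/funext => x; rewrite /psi distorted_iftD; try exact: ccpt_cintegrable.
  rewrite distorted_iftD; try exact: ccpt_cintegrable.
  by rewrite mulN1r; ring.
apply: (le_trans (hC _ (ccpt_L2 cpsi) (ccpt_cintegrable cpsi)).2).
rewrite -mulrA ler_wpM2l //.
have h2 : normc (h ^+ 2)%:C = h ^+ 2 by rewrite normcR ger0_norm // sqr_ge0.
rewrite mulrC -[X in _ <= X * _]h2 -n2Z; last exact: ccpt_L2.
apply: n2_mono; [exact: ccpt_L2|by apply: L2Z; exact: ccpt_L2|move=> xi].
have -> : psi xi = (expi (- (h * (xi ^+ 2 / 2))) - 1 + 'i%C * (h * (xi ^+ 2 / 2))%:C) * u xi.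
  by rewrite /psi /evolve rmorphM; ring.
rewrite [X in _ <= normc X](_ : _ = (h ^+ 2 * (xi ^+ 4 / 2))%:C * u xi); last first.
  by rewrite (rmorphM (real_complex R) (h ^+ 2)) mulrA.
rewrite !ComplexField.Normc.normcM ler_wpM2r ?normc_ge0 //.
have [t1 t2] := trigo_taylor (h * (xi ^+ 2 / 2)).
apply: (le_trans (normc_le_norm _)); rewrite normcR !reim /= !(mul0r, mul1r, mulr0, subr0, addr0).
rewrite cosN sinN add0r [- sin _ + _]addrC.
have -> : `|h ^+ 2 * (xi ^+ 4 / 2)| = (h * (xi ^+ 2 / 2)) ^+ 2 + (h * (xi ^+ 2 / 2)) ^+ 2.
  rewrite ger0_norm; first by field.
  by rewrite mulr_ge0 ?sqr_ge0 // divr_ge0 // exprn_even_ge0.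
exact: lerD.
Qed.

(** By [domain] the transform of [u] lies in the domain of the generator, so both evolutions have
    the same first-order term [- i h T v]. *)
Lemma evolve_defect u : ccpt u ->
  (`|h|^-1 * n2 (fun x => T (evolve h u) x - U h (T u) x)) @[h --> (0 : R)^'] --> (0 : R).
Proof.
move=> cu; set v := fun xi => (xi ^+ 2 / 2)%:C * u xi.
have cv : ccpt v by exact: ccpt_pow.
have [hu hv] := (ccpt_T cu, ccpt_T cv).
have [C hC] := taylor_evolve cu.
have := hU => -[_ _ _ /(_ _ _ hu hv)[/(_ (domain q cu)) cvH _]].
have {}cvH : n2 (fun x => (U h (T u) x - T u x) / h%:C - - 'i%C * T v x) @[h --> (0 : R)^'] --> (0 : R).
  by move/fine_cvgP : cvH => -[].
have B : \forall h \near (0 : R)^', 0 <= `|h|^-1 * n2 (fun x => T (evolve h u) x - U h (T u) x)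
    <= C * `|h| + n2 (fun x => (U h (T u) x - T u x) / h%:C - - 'i%C * T v x).
  near=> h.
  have h0 : h != 0 by near: h; exact: nbhs_dnbhs_neq.
  have nh : 0 < `|h| by rewrite normr_gt0.
  rewrite mulr_ge0 ?invr_ge0 ?n2_ge0 //= ler_pdivrMl // mulrDr.
  have hw := ccpt_T (ccpt_evolve h cu); have hUu := U_L2 h hu.
  have hm : L2 (fun x => T u x - 'i%C * h%:C * T v x) by apply: L2B => //; exact: L2Z.
  apply: (le_trans (n2_triangle hw hm hUu)); apply: lerD.
    by apply: (le_trans (hC h)); rewrite [X in _ <= X]mulrCA -normrM ger0_norm // -expr2 sqr_ge0.
  have hd : L2 (fun x => (U h (T u) x - T u x) / h%:C - - 'i%C * T v x).
    apply: L2B; last exact: L2Z.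
    by under eq_fun do rewrite mulrC; apply: L2Z; exact: L2B.
  rewrite n2B // -[`|h| in X in _ <= X](normcR h) -n2Z //.
  rewrite le_eqVlt; apply/orP; left; apply/eqP; congr n2; apply/funext => x.
  have hc : h%:C != 0 :> R[i] by apply: contra_neq h0 => /complexI.
  by field.
apply: (squeeze_cvgr B); first exact: cvg_cst.
rewrite -[X in _ --> X](addr0 0); apply: cvgD cvH.
rewrite -[X in _ --> X](mulr0 C); apply: cvgM; first exact: cvg_cst.
apply/cvgr0Pnorm_le => e e0; near=> x; rewrite normr_id.
by near: x; apply: dnbhs0_le.
Unshelve. all: end_near. Qed.

(* As [U] is isometric, the increments over [h] of the distance between the two
   sides are at most the defect [evolve_defect], which is [o(h)]. *)
Lemma U_evolve u t : ccpt u -> n2 (fun x => T (evolve t u) x - U t (T u) x) = 0.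
Proof.
move=> cu; pose w t := T (evolve t u).
pose E t := n2 (fun x => w t x - U t (T u) x).
have hu := ccpt_T cu; have ct s := ccpt_evolve s cu.
have hw s : L2 (w s) by exact: ccpt_T.
(* Transported by the isometry [U h], [E s] is the distance from [U h (w s)] to [U (h + s) (T u)],
   and [E (s + h)] is the distance from [w (h + s)] to the same point; the triangle inequality
   compares them. *)
have key s h : `|E (s + h) - E s| <= n2 (fun x => T (evolve h (evolve s u)) x - U h (w s) x).
  have -> : evolve h (evolve s u) = evolve (h + s) u by rewrite evolveD.
  rewrite [s + h]addrC -/(w (h + s)).
  have hUs := U_L2 s hu; have hUw := U_L2 h (hw s); have hUU := U_L2 h hUs.
  have -> : E (h + s) = n2 (fun x => w (h + s) x - U h (U s (T u)) x).
    apply: n2_eq; [by apply: L2B => //; exact: U_L2|exact: L2B|].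
    have [_ [_ UD] _ _] := hU.
    by apply: aeS (UD h s _ hu) => x /= H /H ->.
  have <- : n2 (fun x => U h (w s) x - U h (U s (T u)) x) = E s by exact: U_dist.
  rewrite ler_norml lerBlDr lerBrDl addrC; apply/andP; split.
    by rewrite addrC lerBlDl (n2B (hw _) hUw); exact: n2_triangle.
  by exact: n2_triangle.
have D s : is_derive s (1 : R) E 0.
  have H : h^-1 *: ((E \o shift s) (h *: (1 : R)) - E s) @[h --> 0^'] --> (0 : R).
    apply/cvgr0Pnorm_le => e e0; near=> h.
    rewrite /= /GRing.scale /= mulr1 [h + s]addrC normrM normfV.
    apply: (@le_trans _ _ (`|h|^-1 * n2 (fun x => T (evolve h (evolve s u)) x - U h (w s) x))).
      by rewrite ler_wpM2l ?invr_ge0.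
    apply: (le_trans (ler_norm _)).
    near: h; have /cvgr0Pnorm_le := evolve_defect (ct s); exact.
  split; first by apply/cvg_ex; exists 0.
  exact: (cvg_lim _ H).
have [_ [U0 _] _ _] := hU.
rewrite -/(E t) (is_derive_0_is_cst t 0 D).
have -> : E 0 = n2 (fun x => 0 * T u x).
  apply: n2_eq; [by apply: L2B => //; exact: U_L2|exact: L2Z|].
  apply: aeS (U0 _ hu) => x /= H /H ->.
  rewrite /w (_ : evolve 0 u = u) ?subrr ?mul0r //.
  by apply/funext => xi; rewrite /evolve mul0r oppr0 /expi cos0 sin0 mul1r.
by rewrite n2Z // ComplexField.Normc.normc0 mul0r.
Unshelve. all: end_near. Qed.

End Dynamics.

(** * Asymptotics *)

Section ReflectedProfile.
Context {R : realType}.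
Local Notation mu := (@lebesgue_measure R).
Local Notation L1 f := (mu.-integrable setT (EFin \o f)).
Local Notation I f := (Rintegral mu setT f).
Implicit Types (f g : R -> R) (a b x xi A B D E M q : R).

Lemma h1W f f' A B A' B' : A <= A' -> B <= B' -> H1fun f f' A B -> H1fun f f' A' B'.
Proof.
by move=> AA BB [hA hB ftc]; split => //; [exact: L2leW hA|exact: L2leW hB].
Qed.

Lemma h1_add f f' g g' A B A' B' : H1fun f f' A B -> H1fun g g' A' B' ->
  H1fun (fun x => f x + g x) (fun x => f' x + g' x) (2 * A + 2 * A') (2 * B + 2 * B').
Proof.
move=> hf hg; have := h1_sub hf (h1_scale (-1) hg); rewrite sqrrN expr1n !mul1r.
by under eq_fun do rewrite mulN1r opprK; under [X in H1fun _ X]eq_fun do rewrite mulN1r opprK.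
Qed.

(** The cut function is [f (Num.max x 0)] because [f 0 = 0]; otherwise it would jump. This is where
    the vanishing of [phi] at 0 enters. *)
Lemma h1_cut f f' A B : H1fun f f' A B -> f 0 = 0 ->
  H1fun (fun x => (0 < x)%R%:R * f x) (fun x => (0 < x)%R%:R * f' x) A B.
Proof.
move=> [hA hB ftc] f0.
have P (g : R -> R) D : L2le g D -> L2le (fun x => (0 < x)%R%:R * g x) D.
  move=> hg; under eq_fun do rewrite mulrC.
  by apply: L2le_Mb => //; [exact: measurable_pos|exact: pos_norm].
split; [exact: P|exact: P|move=> a b ab].
have E x : (0 < x)%R%:R * f x = f (Num.max x 0).
  by case: (ltP 0 x) => x0; rewrite ?mul1r // mul0r f0.
rewrite !E ftc; last by rewrite ge_max !le_max ab lexx !orbT.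
apply: (@I_eq_off1 _ _ _ 0).
- by apply: measurable_funM; [exact: measurable_ind|case: hB].
- by apply: measurable_funM; [exact: measurable_ind|by case: (P _ _ hB)].
- move=> x x0; rewrite mulrA; congr (_ * _); rewrite /ind ge_max le_max.
  by case: (ltgtP x 0) x0 => // x0 _; rewrite ?mulr0 ?mulr1 ?andbF ?andbT ?orbF //= mulr0.
Qed.

(** The product rule is [ibp] with [G := chi], solved for the boundary terms. *)
Lemma h1_mul f f' (chi chi' : R -> R) A B M : H1fun f f' A B ->
  (forall x, is_derive x (1 : R) chi (chi' x)) -> continuous chi' ->
  (forall x, `|chi x| <= 1) -> (forall x, `|chi' x| <= M) ->
  H1fun (fun x => chi x * f x) (fun x => chi' x * f x + chi x * f' x)
    A (2 * (M ^+ 2 * A) + 2 * B).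
Proof.
move=> [hA hB ftc] dchi cchi' chi1 chiM.
have cchi := derive_continuous dchi.
have mchi := continuous_measurable_fun cchi; have mchi' := continuous_measurable_fun cchi'.
have hM (g : R -> R) D : L2le g D -> L2le (fun x => chi x * g x) D.
  by move=> hg; under eq_fun do rewrite mulrC; exact: L2le_Mb.
have hM' : L2le (fun x => chi' x * f x) (M ^+ 2 * A).
  apply: (L2le_le _ _ (L2leZ M hA)); first by apply: measurable_funM => //; case: hA.
  by move=> x; rewrite !normrM ler_wpM2r // (le_trans (chiM x)) // ler_norm.
split; [exact: hM|by apply: L2leD => //; exact: hM|move=> a b ab].
have [l1 _] := L2le_ind_L1 ab hM'; have [l2 _] := L2le_ind_L1 ab (hM _ _ hB).
have [lf' _] := L2le_ind_L1 ab hB.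
have := ibp ab hA.1 hB.1 lf' ftc dchi cchi'.
have -> : (fun x => ind a b x * (chi' x * f x + chi x * f' x)) =
    (fun x => ind a b x * (chi' x * f x) + ind a b x * (chi x * f' x)).
  by apply/funext => x; rewrite mulrDr.
rewrite ID //.
have -> : (fun x => ind a b x * (f x * chi' x)) = (fun x => ind a b x * (chi' x * f x)).
  by apply/funext => x; rewrite [f x * _]mulrC.
have -> : (fun x => ind a b x * (f' x * chi x)) = (fun x => ind a b x * (chi x * f' x)).
  by apply/funext => x; rewrite [f' x * _]mulrC.
by move=> ->; ring.
Qed.

(** For [q = 0] all four functions vanish and [q^-1] is 0 by convention, so one bound covers both
    cases. *)
Lemma chi_C1 q : 0 <= q ->
  [/\ forall x, is_derive x (1 : R) (chi1 q) (chi1' q x),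
      forall x, is_derive x (1 : R) (chi2 q) (chi2' q x),
      continuous (chi1' q), continuous (chi2' q) &
      forall x, `|chi1' q x| <= q^-1 /\ `|chi2' q x| <= q^-1].
Proof.
rewrite le_eqVlt => /orP[/eqP q0|q0].
  have [e1 e2] := chi_q0 (esym q0).
  have e1' : chi1' q = cst 0 by apply/funext => x; rewrite /chi1' -q0 expr0n /= !(mulr0, mul0r).
  have e2' : chi2' q = cst 0 by apply/funext => x; rewrite /chi2' -q0 !(mulr0, mul0r).
  rewrite e1 e2 e1' e2' -q0 invr0.
  by split=> x; rewrite ?normr0 //; solve [exact: is_derive_cst|exact: cvg_cst].
have qn : q != 0 by rewrite gt_eqF.
have d0 x : 0 < q ^+ 2 + x ^+ 2 by rewrite ltr_wpDr ?sqr_ge0 // exprn_gt0.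
have cd : continuous (fun x => ((q ^+ 2 + x ^+ 2) ^+ 2)^-1).
  move=> x; apply: cvgV; first by rewrite expf_neq0 // gt_eqF.
  by apply: (@cvg_comp _ _ _ (fun x => q ^+ 2 + x ^+ 2) (fun y => y ^+ 2)); [apply: cvgD;
    [exact: cvg_cst|exact: exprn_continuous]|exact: exprn_continuous].
split.
- by move=> x; case: (is_derive_chi x qn).
- by move=> x; case: (is_derive_chi x qn).
- move=> x; apply: cvgM (cd x); apply: cvgM; [exact: cvg_cst|exact: cvg_id].
- move=> x; apply: cvgM (cd x); apply: cvgM; first exact: cvg_cst.
  by apply: cvgB; [exact: cvg_cst|exact: exprn_continuous].
- move=> x; have dx := d0 x.
  (* Both numerators are at most [q * (q^2 + x^2)], and [q / (q^2 + x^2) <= q^-1]. *)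
  have key y : `|y| <= q * (q ^+ 2 + x ^+ 2) -> `|y / (q ^+ 2 + x ^+ 2) ^+ 2| <= q^-1.
    move=> hy; rewrite normrM [`|_^-1|]ger0_norm ?invr_ge0 ?exprn_ge0 ?(ltW dx) //.
    rewrite ler_pdivrMr ?exprn_gt0 //; apply: (le_trans hy).
    rewrite expr2 mulrA ler_wpM2r ?(ltW dx) // mulrDr expr2 mulKf // lerDl.
    by rewrite mulr_ge0 ?invr_ge0 ?sqr_ge0 // ltW.
  split; apply: key.
    rewrite expr2 mulrCA mulrA -!mulrA normrM gtr0_norm // ler_wpM2l ?(ltW q0) //.
    rewrite ler_norml; apply/andP; split.
      have := sqr_ge0 (q + x); nra.
    have := sqr_ge0 (q - x); nra.
  rewrite normrM gtr0_norm // ler_wpM2l ?(ltW q0) // ler_norml; apply/andP; split.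
    have := sqr_ge0 q; nra.
  have := sqr_ge0 x; nra.
Qed.

Lemma h1_fold_even f f' A B : H1fun f f' A B -> f 0 = 0 ->
  H1fun (fold_even f) (fun x => (0 < x)%R%:R * (f' x - f' (- x))) (4 * A) (4 * B).
Proof.
move=> hf f0; have E (X : R) : 4 * X = 2 * X + 2 * X by ring.
by rewrite !E; apply: h1_cut; [exact: h1_add hf (h1_reflect hf)|rewrite oppr0 f0 addr0].
Qed.

Lemma h1_refl q f f' g g' A : 0 <= q -> H1fun f f' A A -> H1fun g g' A A ->
  f 0 = 0 -> g 0 = 0 -> let K := 32 * (1 + q ^- 2) in
  exists r1' r2', H1fun (refl1 q f g) r1' (K * A) (K * A) /\
    H1fun (refl2 q f g) r2' (K * A) (K * A).
Proof.
move=> q0 hf hg f0 g0 K; have [D1 D2 c1 c2 M] := chi_C1 q0.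
have hef := h1_fold_even hf f0; have heg := h1_fold_even hg g0.
have A0 := L2le_ge0 (h1_f hf).
have p1f := h1_mul hef D1 c1 (chi1_le1 q) (fun x => (M x).1).
have p1g := h1_mul heg D1 c1 (chi1_le1 q) (fun x => (M x).1).
have p2f := h1_mul hef D2 c2 (chi2_le1 q) (fun x => (M x).2).
have p2g := h1_mul heg D2 c2 (chi2_le1 q) (fun x => (M x).2).
have e0 : 0 <= q ^- 2 * A by rewrite mulr_ge0 // invr_ge0 exprn_ge0.
have w1 : 2 * (4 * A) + 2 * (4 * A) <= K * A by rewrite /K -mulrA mulrDl; nra.
(* An equality: the value of [K] comes from this bound on the derivatives. *)
have w2 : 2 * (2 * (q^-1 ^+ 2 * (4 * A)) + 2 * (4 * A)) +
  2 * (2 * (q^-1 ^+ 2 * (4 * A)) + 2 * (4 * A)) <= K * A.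
  by rewrite /K exprVn le_eqVlt; apply/orP; left; apply/eqP; ring.
eexists; eexists; split.
  exact: (h1W w1 w2 (h1_sub p1f p2g)).
exact: (h1W w1 w2 (h1_add p1g p2f)).
Qed.

Lemma refl_le0 q f g x : x <= 0 -> refl1 q f g x = 0 /\ refl2 q f g x = 0.
Proof.
by move=> x0; rewrite /refl1 /refl2 /fold_even ltNge x0 !mul0r !mulr0 subrr addr0.
Qed.

End ReflectedProfile.

(** * Pointwise limit and error bounds for the truncated evolution *)

Section Asymptotics.
Context {R : realType}.
Local Notation mu := (@lebesgue_measure R).
Local Notation L1 f := (mu.-integrable setT (EFin \o f)).
Local Notation I f := (Rintegral mu setT f).
Local Notation N := ((Num.sqrt (2 * pi))^-1 : R).
Implicit Types (f g : R -> R) (x y xi A q s : R).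

Section Time.
Variable t : R.
Hypothesis t0 : 0 < t.

(** [ev1 + i ev2] is [exp (- i t xi^2 / 2) (f + i g)] cut to [[-n, n]]; the cut makes its Fourier
    integral absolutely convergent. *)
Definition ev1 n f g xi : R := ind (- n%:R) n%:R xi *
  (cos (t * (xi ^+ 2 / 2)) * f xi + sin (t * (xi ^+ 2 / 2)) * g xi).
Definition ev2 n f g xi : R := ind (- n%:R) n%:R xi *
  (cos (t * (xi ^+ 2 / 2)) * g xi - sin (t * (xi ^+ 2 / 2)) * f xi).

(** The phase and the cut are even in [xi], hence pass through the folding. *)
Lemma refl_ev q n f g :
  refl1 q (ev1 n f g) (ev2 n f g) = ev1 n (refl1 q f g) (refl2 q f g) /\
  refl2 q (ev1 n f g) (ev2 n f g) = ev2 n (refl1 q f g) (refl2 q f g).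
Proof.
split; apply/funext => xi; rewrite /refl1 /refl2 /ev1 /ev2 /fold_even sqrrN;
  rewrite (_ : ind (- n%:R) n%:R (- xi) = ind (- n%:R) n%:R xi); [ring| |ring|];
  by rewrite /ind lerN2 lerNl andbC.
Qed.

Section Kernels.
Variables (k1 m1 k2 m2 : R -> R) (C : R).
Hypotheses (K1 : fresnel_kernel (fun s => cos (s ^+ 2 / 2)) k1 m1 C)
  (K2 : fresnel_kernel (fun s => sin (s ^+ 2 / 2)) k2 m2 C).

(** The components of the integral of [f + i g] against [cos - i sin] of the Fresnel phase. In
    [prof1] and [prof2] the main part is [sqrt pi (1 - i) (f + i g)], which is
    [sqrt (2 pi) exp (- i pi / 4) (f + i g)]: this is the origin of the phase [- pi / 4]. *)
Definition err1 f' g' x : R := fresE t k1 f' x + fresE t k2 g' x.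
Definition err2 f' g' x : R := fresE t k1 g' x - fresE t k2 f' x.

Definition prof1 f g f' g' x : R := Num.sqrt pi * (f (x / t) + g (x / t)) + err1 f' g' x.
Definition prof2 f g f' g' x : R := Num.sqrt pi * (g (x / t) - f (x / t)) + err2 f' g' x.

Local Notation theta x := (x ^+ 2 / (2 * t)).

Lemma phase_split x xi : x * xi - t * (xi ^+ 2 / 2) = theta x - sig t x xi ^+ 2 / 2.
Proof.
rewrite /sig exprMn exprVn sqr_sqrtr ?(ltW t0) //; field; exact: lt0r_neq0.
Qed.

(** The phase [x xi - t xi^2 / 2] is [theta x] minus the Fresnel phase; the factor [exp (i theta)]
    comes out, and [cvg_fresnel] is applied to [f] and [g] with both kernels. *)
Lemma cvg_F f g f' g' A B x : H1fun f f' A B -> H1fun g g' A B ->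
  FR (ev1 n f g) (ev2 n f g) x @[n --> \oo] -->
    (Num.sqrt t)^-1 * (cos (theta x) * prof1 f g f' g' x - sin (theta x) * prof2 f g f' g' x) /\
  FI (ev1 n f g) (ev2 n f g) x @[n --> \oo] -->
    (Num.sqrt t)^-1 * (sin (theta x) * prof1 f g f' g' x + cos (theta x) * prof2 f g f' g' x).
Proof.
move=> hf hg.
have C1 := cvg_fresnel (x := x) t0 K1 hf; have C2 := cvg_fresnel (x := x) t0 K1 hg.
have S1 := cvg_fresnel (x := x) t0 K2 hf; have S2 := cvg_fresnel (x := x) t0 K2 hg.
have m1' (c : R -> R) : continuous c -> measurable_fun setT (fun xi => c (sig t x xi)).
  move=> cc; apply: measurableT_comp; first exact: continuous_measurable_fun.
  exact: measurable_sig.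
have LI h h' n : H1fun h h' A B -> L1 (fun xi => ind (- n%:R) n%:R xi * h xi).
  by move=> hh; apply: (L2le_ind_L1 _ (h1_f hh)).1; rewrite -subr_ge0 opprK addr_ge0.
have L c k m h h' n : fresnel_kernel c k m C -> H1fun h h' A B ->
    L1 (fun xi => ind (- n%:R) n%:R xi * (h xi * c (sig t x xi))).
  move=> K hh; under eq_fun do rewrite mulrA.
  by apply: (L1_Ml (LI _ _ n hh) (m1' _ (fk_cont K))) => xi; exact: (fk_le1 K).
have mtau : measurable_fun setT (fun xi : R => t * (xi ^+ 2 / 2)).
  by apply: measurable_funM => //; apply: measurable_funM => //; exact: measurable_funX.
have Lc h h' n : H1fun h h' A B ->
    L1 (fun xi => (ind (- n%:R) n%:R xi * h xi) * cos (t * (xi ^+ 2 / 2))).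
  move=> hh; apply: (L1_Ml (LI _ _ n hh)); last by move=> xi; exact: cos_norm_le1.
  exact: (measurableT_comp (@measurable_cos R)).
have Ls h h' n : H1fun h h' A B ->
    L1 (fun xi => (ind (- n%:R) n%:R xi * h xi) * sin (t * (xi ^+ 2 / 2))).
  move=> hh; apply: (L1_Ml (LI _ _ n hh)); last by move=> xi; exact: sin_norm_le1.
  exact: (measurableT_comp (@measurable_sin R)).
have Le1 n : L1 (ev1 n f g).
  rewrite (_ : ev1 n f g = fun xi => ind (- n%:R) n%:R xi * f xi * cos (t * (xi ^+ 2 / 2)) +
    ind (- n%:R) n%:R xi * g xi * sin (t * (xi ^+ 2 / 2))).
    by apply: L1D; [exact: Lc hf|exact: Ls hg].
  by apply/funext => xi; rewrite /ev1; ring.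
have Le2 n : L1 (ev2 n f g).
  rewrite (_ : ev2 n f g = fun xi => ind (- n%:R) n%:R xi * g xi * cos (t * (xi ^+ 2 / 2)) -
    ind (- n%:R) n%:R xi * f xi * sin (t * (xi ^+ 2 / 2))).
    by apply: L1B; [exact: Lc hg|exact: Ls hf].
  by apply/funext => xi; rewrite /ev2; ring.
pose P (c : R -> R) h n := I (fun xi => ind (- n%:R) n%:R xi * (h xi * c (sig t x xi))).
pose c (s : R) := cos (s ^+ 2 / 2); pose s (s : R) := sin (s ^+ 2 / 2).
have tr xi : cos (x * xi) * cos (t * (xi ^+ 2 / 2)) + sin (x * xi) * sin (t * (xi ^+ 2 / 2)) =
     cos (theta x) * c (sig t x xi) + sin (theta x) * s (sig t x xi) /\
   sin (x * xi) * cos (t * (xi ^+ 2 / 2)) - cos (x * xi) * sin (t * (xi ^+ 2 / 2)) =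
     sin (theta x) * c (sig t x xi) - cos (theta x) * s (sig t x xi).
  by rewrite -cosB -sinB -cosB -sinB phase_split.
have ER n : FR (ev1 n f g) (ev2 n f g) x =
    cos (theta x) * (P c f n + P s g n) - sin (theta x) * (P c g n - P s f n).
  rewrite /FR /CT /ST -IB; [|exact: L1_Mcos|exact: L1_Msin].
  rewrite /P -ID; [|exact: L K1 hf|exact: L K2 hg].
  rewrite -IB; [|exact: L K1 hg|exact: L K2 hf].
  rewrite -IZ; last by apply: L1D; [exact: L K1 hf|exact: L K2 hg].
  rewrite -IZ; last by apply: L1B; [exact: L K1 hg|exact: L K2 hf].
  rewrite -IB; first last.
  - by apply: L1Z; apply: L1B; [exact: L K1 hg|exact: L K2 hf].
  - by apply: L1Z; apply: L1D; [exact: L K1 hf|exact: L K2 hg].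
  congr Rintegral; apply/funext => xi; have [h1 h2] := tr xi.
  transitivity (ind (- n%:R) n%:R xi *
    (f xi * (cos (x * xi) * cos (t * (xi ^+ 2 / 2)) + sin (x * xi) * sin (t * (xi ^+ 2 / 2))) -
     g xi * (sin (x * xi) * cos (t * (xi ^+ 2 / 2)) - cos (x * xi) * sin (t * (xi ^+ 2 / 2))))).
    by rewrite /ev1 /ev2; ring.
  by rewrite h1 h2; ring.
have EI n : FI (ev1 n f g) (ev2 n f g) x =
    sin (theta x) * (P c f n + P s g n) + cos (theta x) * (P c g n - P s f n).
  rewrite /FI /CT /ST -ID; [|exact: L1_Mcos|exact: L1_Msin].
  rewrite /P -ID; [|exact: L K1 hf|exact: L K2 hg].
  rewrite -IB; [|exact: L K1 hg|exact: L K2 hf].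
  rewrite -IZ; last by apply: L1D; [exact: L K1 hf|exact: L K2 hg].
  rewrite -IZ; last by apply: L1B; [exact: L K1 hg|exact: L K2 hf].
  rewrite -ID; first last.
  - by apply: L1Z; apply: L1B; [exact: L K1 hg|exact: L K2 hf].
  - by apply: L1Z; apply: L1D; [exact: L K1 hf|exact: L K2 hg].
  congr Rintegral; apply/funext => xi; have [h1 h2] := tr xi.
  transitivity (ind (- n%:R) n%:R xi *
    (g xi * (cos (x * xi) * cos (t * (xi ^+ 2 / 2)) + sin (x * xi) * sin (t * (xi ^+ 2 / 2))) +
     f xi * (sin (x * xi) * cos (t * (xi ^+ 2 / 2)) - cos (x * xi) * sin (t * (xi ^+ 2 / 2))))).
    by rewrite /ev1 /ev2; ring.
  by rewrite h1 h2; ring.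
have cP : P c f n + P s g n @[n --> \oo] --> (Num.sqrt t)^-1 * prof1 f g f' g' x.
  rewrite (_ : _ * _ = (Num.sqrt t)^-1 * (Num.sqrt pi * f (x / t) + fresE t k1 f' x) +
    (Num.sqrt t)^-1 * (Num.sqrt pi * g (x / t) + fresE t k2 g' x)); first exact: cvgD C1 S2.
  by rewrite /prof1 /err1; ring.
have cM : P c g n - P s f n @[n --> \oo] --> (Num.sqrt t)^-1 * prof2 f g f' g' x.
  rewrite (_ : _ * _ = (Num.sqrt t)^-1 * (Num.sqrt pi * g (x / t) + fresE t k1 g' x) -
    (Num.sqrt t)^-1 * (Num.sqrt pi * f (x / t) + fresE t k2 f' x)); first exact: cvgB C2 S1.
  by rewrite /prof2 /err2; ring.
split.
  under eq_fun do rewrite ER.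
  rewrite mulrBr !(mulrCA _ (cos _)) !(mulrCA _ (sin _)).
  by apply: cvgB; apply: cvgM => //; exact: cvg_cst.
under eq_fun do rewrite EI.
rewrite mulrDr !(mulrCA _ (cos _)) !(mulrCA _ (sin _)).
by apply: cvgD; apply: cvgM => //; exact: cvg_cst.
Qed.

End Kernels.

End Time.

(** The four groups of bounds feed the interpolation: in L^2 and uniformly, each in a version suited
    to large [t] and one suited to small [t]. [D] depends on [q] through the H^1 bound on the
    reflected profile. *)
Lemma distorted_asymptotics q : 0 <= q -> exists2 D, 0 < D & forall t, 0 < t ->
  forall f g f' g' A, H1fun f f' A A -> H1fun g g' A A -> f 0 = 0 -> g 0 = 0 ->
  exists e1 e2 : R -> R,
  [/\ forall x, let th := x ^+ 2 / (2 * t) in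
        let a := Num.sqrt pi * (f (x / t) + g (x / t)) + e1 x in
        let b := Num.sqrt pi * (g (x / t) - f (x / t)) + e2 x in
        DR q (ev1 t n f g) (ev2 t n f g) x @[n --> \oo] -->
          N * ((Num.sqrt t)^-1 * (cos th * a - sin th * b)) /\
        DI q (ev1 t n f g) (ev2 t n f g) x @[n --> \oo] -->
          N * ((Num.sqrt t)^-1 * (sin th * a + cos th * b)),
      L2le e1 (D * A) /\ L2le e2 (D * A),
      L2le e1 (D * (t * A)) /\ L2le e2 (D * (t * A)),
      forall x, e1 x ^+ 2 <= D * A /\ e2 x ^+ 2 <= D * A &
      forall x, e1 x ^+ 2 <= D * (A / Num.sqrt t) /\ e2 x ^+ 2 <= D * (A / Num.sqrt t)].
Proof.
move=> q0; have [C [K1 K2]] := exists_fresnel_kernels (R := R).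
set k1 := fres_k1 in K1; set k2 := fres_k2 in K2.
have C0 := fk_ge0 K1; have kb0 := @kb_ge0 R; have pi0 : 0 <= pi :> R := pi_ge0 R.
pose ka := (8 * (4 * C * kb) ^+ 2 + 2 * (2 * C + 2 * pi)) : R.
pose kc := (96 * (1 + 8 * C ^+ 2 + 2 * C ^+ 2 * kb)) : R.
pose k := ka + kc.
have ka0 : 0 <= ka by rewrite /ka addr_ge0 ?mulr_ge0 ?sqr_ge0 ?addr_ge0 ?mulr_ge0.
have kc0 : 0 <= kc.
  by rewrite /kc mulr_ge0 ?addr_ge0 ?mulr_ge0 ?exprn_ge0.
have k0 : 0 <= k by exact: addr_ge0.
have le_k (u X : R) : 0 <= X -> u <= k -> u * X <= k * X by move=> X0 uk; exact: ler_wpM2r.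
have k_a : ka <= k by rewrite /k lerDl.
have k_b : 2 * C + 2 * pi <= k.
  apply: le_trans k_a; rewrite /ka; have := sqr_ge0 (4 * C * kb).
  have : 0 <= 2 * C + 2 * pi by rewrite addr_ge0 ?mulr_ge0.
  by move: (_ ^+ 2) (2 * C + 2 * pi) => u v v0 u0; lra.
have k_c : kc <= k by rewrite /k lerDr.
have k_d : 8 * C ^+ 2 * kb <= k.
  apply: le_trans k_c; rewrite /kc; have := sqr_ge0 C.
  have : 0 <= C ^+ 2 * kb by rewrite mulr_ge0 ?sqr_ge0.
  by rewrite -!mulrA; move: (_ * kb) (_ ^+ 2) => u v u0 v0; lra.
pose K := 32 * (1 + q ^- 2).
have K0 : 0 <= K by rewrite mulr_ge0 // addr_ge0 // invr_ge0 exprn_ge0.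
exists (32 * k * (1 + K) + 1); first by rewrite ltr_wpDl // !mulr_ge0 // addr_ge0.
move=> t t0 f g f' g' A hf hg f0 g0.
have A0 := L2le_ge0 (h1_f hf).
have [r1' [r2' [h1 h2]]] := h1_refl q0 hf hg f0 g0.
rewrite -/K in h1 h2; set r1 := refl1 q f g in h1; set r2 := refl2 q f g in h2.
have st0 : 0 < Num.sqrt t by rewrite sqrtr_gt0.
have KA0 : 0 <= K * A by rewrite mulr_ge0.
pose e1 x := err1 t k1 k2 f' g' x + err1 t k1 k2 r1' r2' (- `|x|).
pose e2 x := err2 t k1 k2 f' g' x + err2 t k1 k2 r1' r2' (- `|x|).
have B (c kk m : R -> R) h h' X : fresnel_kernel c kk m C -> H1fun h h' X X ->
  [/\ L2le (fresE t kk h') (k * X), L2le (fresE t kk h') (k * (t * X)),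
     forall x, fresE t kk h' x ^+ 2 <= k * X & forall x, fresE t kk h' x ^+ 2 <= k * (X / Num.sqrt t)].
  move=> Kk hh; have X0 := L2le_ge0 (h1_f hh); split.
  - by apply: L2leW (fresE_L2 Kk t0 hh); exact: le_k.
  - apply: L2leW (fresE_plancherel_L2 t0 Kk hh); rewrite -mulrA; apply: le_k => //.
    by rewrite mulr_ge0 // ltW.
  - move=> x; apply: (le_trans (fresE_sup_small Kk x t0 hh)).
    apply: le_trans (le_k _ _ X0 k_c); rewrite /kc le_eqVlt; apply/orP; left; apply/eqP; ring.
  - move=> x; apply: (le_trans (fresE_sup_large t0 Kk x (h1_f' hh))).
    by rewrite -mulrA; apply: le_k => //; rewrite divr_ge0 // ltW.
have errL X Y u v u' v' : L2le u X -> L2le v X -> L2le u' Y -> L2le v' Y ->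
    L2le (fun x => (u x + v x) + (u' (- `|x|) + v' (- `|x|))) (8 * X + 32 * Y) /\
    L2le (fun x => (u x - v x) + (u' (- `|x|) - v' (- `|x|))) (8 * X + 32 * Y).
  move=> hu hv hu' hv'.
  have E : 8 * X + 32 * Y = 2 * (2 * X + 2 * X) + 2 * (4 * (2 * Y + 2 * Y)) by ring.
  rewrite E; split; apply: L2leD.
  - exact: L2leD.
  - exact: (L2le_reflect_abs (L2leD hu' hv')).
  - exact: L2leB.
  - exact: (L2le_reflect_abs (L2leB hu' hv')).
have errS (X Y u v u' v' : R) : u ^+ 2 <= X -> v ^+ 2 <= X -> u' ^+ 2 <= Y -> v' ^+ 2 <= Y ->
    ((u + v) + (u' + v')) ^+ 2 <= 8 * X + 32 * Y /\
    ((u - v) + (u' - v')) ^+ 2 <= 8 * X + 32 * Y.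
  move=> hu hv hu' hv'; have s2 (a b : R) : (a + b) ^+ 2 <= 2 * a ^+ 2 + 2 * b ^+ 2.
    have := sqr_ge0 (a - b); nra.
  have Y0 := le_trans (sqr_ge0 _) hu'.
  split.
    have := s2 (u + v) (u' + v'); have := s2 u v; have := s2 u' v'; lra.
  have := s2 (u - v) (u' - v'); have := s2 u (- v); have := s2 u' (- v'); rewrite !sqrrN; lra.
(* The weights 8 and 32 are those of [errL] and [errS]; the reflected profile contributes the factor
   [K]. *)
have fin X Z : 0 <= X -> Z = K * X -> 8 * (k * X) + 32 * (k * Z) <= (32 * k * (1 + K) + 1) * X.
  move=> X0 ->; have : 0 <= k * X by exact: mulr_ge0.
  have -> : (32 * k * (1 + K) + 1) * X = 32 * (k * X) + 32 * (k * (K * X)) + X by ring.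
  by move: (k * X) (k * (K * X)) => u v u0; lra.
have [a1 b1 c1 d1] := B _ _ _ _ _ _ K1 hf; have [a2 b2 c2 d2] := B _ _ _ _ _ _ K2 hg.
have [a3 b3 c3 d3] := B _ _ _ _ _ _ K1 hg; have [a4 b4 c4 d4] := B _ _ _ _ _ _ K2 hf.
have [a1' b1' c1' d1'] := B _ _ _ _ _ _ K1 h1; have [a2' b2' c2' d2'] := B _ _ _ _ _ _ K2 h2.
have [a3' b3' c3' d3'] := B _ _ _ _ _ _ K1 h2; have [a4' b4' c4' d4'] := B _ _ _ _ _ _ K2 h1.
have tA : 0 <= t * A by rewrite mulr_ge0 // ltW.
have sA : 0 <= A / Num.sqrt t by rewrite divr_ge0 // ltW.
have E1 := fin A (K * A) A0 erefl.
have E2 := fin (t * A) (t * (K * A)) tA (mulrCA _ _ _).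
have E3 := fin (A / Num.sqrt t) (K * A / Num.sqrt t) sA (esym (mulrA _ _ _)).
have combB (i c s u v u' v' : R) : i * (c * (u + u') - s * (v + v')) =
    i * (c * u - s * v) + i * (c * u' - s * v') by ring.
have combD (i c s u v u' v' : R) : i * (s * (u + u') + c * (v + v')) =
    i * (s * u + c * v) + i * (s * u' + c * v') by ring.
exists e1, e2; split.
- move=> x th a b; rewrite /DR /DI.
  have ea : a = prof1 t k1 k2 f g f' g' x + err1 t k1 k2 r1' r2' (- `|x|).
    by rewrite /a /e1 /prof1 addrA.
  have eb : b = prof2 t k1 k2 f g f' g' x + err2 t k1 k2 r1' r2' (- `|x|).
    by rewrite /b /e2 /prof2 addrA.
  have [F1 F2] := cvg_F t0 K1 K2 x hf hg; have [F3 F4] := cvg_F t0 K1 K2 (- `|x|) h1 h2.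
  (* The profile vanishes at [- |x| / t], which leaves only its error, and the chirp [th] is the
     same at [- |x|] as at [x]. *)
  have xt : - `|x| / t <= 0 by rewrite mulNr oppr_le0 divr_ge0 // ltW.
  have [z1 z2] := refl_le0 q f g xt.
  have th' : (- `|x|) ^+ 2 / (2 * t) = th by rewrite sqrrN real_normK ?num_real.
  rewrite /prof1 /prof2 th' -/r1 -/r2 /r1 /r2 z1 z2 subr0 addr0 !mulr0 !add0r in F3 F4.
  have eqs n := refl_ev t q n f g.
  split.
    under eq_fun do rewrite (eqs _).1 (eqs _).2.
    apply: cvgM; first exact: cvg_cst.
    rewrite (_ : _^-1 * _ = (Num.sqrt t)^-1 * (cos th * prof1 t k1 k2 f g f' g' x -
      sin th * prof2 t k1 k2 f g f' g' x) + (Num.sqrt t)^-1 *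
      (cos th * err1 t k1 k2 r1' r2' (- `|x|) - sin th * err2 t k1 k2 r1' r2' (- `|x|))).
      exact: cvgD.
    by rewrite ea eb; exact: combB.
  under eq_fun do rewrite (eqs _).1 (eqs _).2.
  apply: cvgM; first exact: cvg_cst.
  rewrite (_ : _^-1 * _ = (Num.sqrt t)^-1 * (sin th * prof1 t k1 k2 f g f' g' x +
    cos th * prof2 t k1 k2 f g f' g' x) + (Num.sqrt t)^-1 *
    (sin th * err1 t k1 k2 r1' r2' (- `|x|) + cos th * err2 t k1 k2 r1' r2' (- `|x|))).
    exact: cvgD.
  by rewrite ea eb; exact: combD.
- split; apply: L2leW E1 _.
    exact: (errL _ _ _ _ _ _ a1 a2 a1' a2').1.
  exact: (errL _ _ _ _ _ _ a3 a4 a3' a4').2.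
- split; apply: L2leW E2 _.
    exact: (errL _ _ _ _ _ _ b1 b2 b1' b2').1.
  exact: (errL _ _ _ _ _ _ b3 b4 b3' b4').2.
- move=> x; split; apply: le_trans E1.
    exact: (errS _ _ _ _ _ _ (c1 x) (c2 x) (c1' _) (c2' _)).1.
  exact: (errS _ _ _ _ _ _ (c3 x) (c4 x) (c3' _) (c4' _)).2.
- move=> x; split; apply: le_trans E3.
    exact: (errS _ _ _ _ _ _ (d1 x) (d2 x) (d1' _) (d2' _)).1.
  exact: (errS _ _ _ _ _ _ (d3 x) (d4 x) (d3' _) (d4' _)).2.
Qed.

End Asymptotics.

(** * Lebesgue norms and passage to the limit *)

Section Interpolation.
Context {R : realType}.
Local Notation mu := (@lebesgue_measure R).
Implicit Types (rho : R -> R) (S Q E beta t : R) (p : \bar R).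

(** For finite [p], [rho^p <= S^(p - 2) * rho^2] pointwise; for [p = +oo], [p^-1] is 0 and the bound
    reduces to [S]. *)
Lemma Lnorm_interpolation p rho S Q : (2%:E <= p)%E -> measurable_fun setT rho -> 0 <= Q ->
  (forall x, 0 <= rho x <= S) -> (nsq rho <= (Q ^+ 2)%:E)%E ->
  ('N[mu]_p[EFin \o rho] <= (S `^ (1 - 2 * fine (p^-1)%E) * Q `^ (2 * fine (p^-1)%E))%:E)%E.
Proof.
move=> p2 mrho Q0 hS hQ.
have S0 : 0 <= S by have /andP[] := hS 0; exact: le_trans.
case: p p2 => [r| |//]; last first.
  move=> _; rewrite invey /= mulr0 subr0 powRr0 mulr1 powRr1 //.
  rewrite unlock /Lnorm; case: ifP => // _.
  apply/ess_sup_inf.ess_supP; apply: aeW => x /=; rewrite lee_fin.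
  by have /andP[h1 h2] := hS x; rewrite ger0_norm.
rewrite lee_fin => r2; rewrite fine_invr.
have r0 : 0 < r by apply: lt_le_trans r2.
have rn : r != 0 by rewrite gt_eqF.
have h : (\int[mu]_x (`|(rho x)%:E| `^ r) <= (S `^ (r - 2) * Q ^+ 2)%:E)%E.
  rewrite EFinM; apply: (@le_trans _ _ ((S `^ (r - 2))%:E * nsq rho)%E); last first.
    by rewrite lee_wpmul2l // lee_fin powR_ge0.
  rewrite /nsq -ge0_integralZl //; last first.
  - by rewrite lee_fin powR_ge0.
  - by move=> x _; rewrite lee_fin sqr_ge0.
  - exact: measurable_sqE.
  apply: ge0_le_integral => //.
  - by move=> x _; exact: poweR_ge0.
  - by apply: (measurableT_comp (measurable_poweR r)); apply: measurableT_comp => //;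
      apply/measurable_EFinP.
  - by apply: emeasurable_funM => //; exact: measurable_sqE.
  - move=> x _; rewrite /= lee_fin; have /andP[h1 h2] := hS x.
    rewrite ger0_norm // (_ : rho x `^ r = rho x `^ (r - 2) * rho x ^+ 2); last first.
      by rewrite -powR_mulrn // -powRD ?subrK // (negbTE rn).
    by rewrite ler_wpM2r ?sqr_ge0 // ge0_ler_powR ?nnegrE // subr_ge0.
rewrite unlock /Lnorm.
apply: (@le_trans _ _ ((S `^ (r - 2) * Q ^+ 2)%:E `^ r^-1)%E).
  apply: gt0_ler_poweR => //; rewrite ?invr_ge0 ?(ltW r0) ?in_itv //= ?leey ?andbT //.
  - by apply: integral_ge0 => x _; rewrite lee_fin powR_ge0.
  - by rewrite lee_fin mulr_ge0 ?powR_ge0 ?sqr_ge0.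
rewrite poweR_EFin lee_fin powRM ?powR_ge0 ?sqr_ge0 // -powR_mulrn // -!powRrM.
by rewrite mulrBl mulfV.
Qed.

(** [(p + 2) / (2 p)] is [1/2 + 1/p], equal to 1 at [p = 2] and to [1/2] at infinity: the cases of
    the definition become one inequality in [i]. *)
Lemma admissible_iota p beta : admissible_exponents p beta ->
  let i := fine (p^-1)%E in [/\ (2%:E <= p)%E, 0 <= beta, 0 <= i, i <= 2^-1 & beta <= 2^-1 + i].
Proof.
move=> [p2 b0 hb]; case: p p2 hb => [r| |//] r2 hb; last first.
  rewrite invey /=; by rewrite addr0 (ltW hb) invr_ge0.
rewrite ?fine_invr; rewrite lee_fin in r2; have r0 : 0 < r by apply: lt_le_trans r2.
split => //; first by rewrite invr_ge0 ltW.
  by rewrite lef_pV2 ?posrE.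
move: hb; case: eqP => [->|_]; first by move=> h; lra.
move=> /ltW /le_trans; apply; rewrite le_eqVlt; apply/orP; left; apply/eqP.
by field; rewrite gt_eqF.
Qed.

(* The sup and L^2 norms of [rho] decay like [t^(-1/2)] and [t^0], and also
   like [t^(-3/4)] and [t^(-1/2)]; the first pair is used for [t <= 1], the
   second for [t > 1], where [beta <= 1/2 + 1/p] is what is needed. *)
Lemma Lnorm_decay p beta t rho E : admissible_exponents p beta -> 0 < t ->
  measurable_fun setT rho -> 0 <= E -> (forall x, 0 <= rho x) ->
  (forall x, rho x ^+ 2 <= E * t^-1) ->
  (forall x, rho x ^+ 2 <= E * (t^-1 / Num.sqrt t)) ->
  L2le rho E -> L2le rho (E * t^-1) ->
  ('N[mu]_p[EFin \o rho] <= (Num.sqrt E * t `^ decay_exponent p beta)%:E)%E.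
Proof.
move=> adm t0 mrho E0 rho0 s1 s2 [_ q1] [_ q2].
have [p2 b0 i0 i1 bi] := admissible_iota adm.
rewrite /decay_exponent; set i := fine _ in i0 i1 bi *.
have sE := sqrtr_ge0 E.
(* [a] and [b] are the powers of [t] in the uniform and in the L^2 bound. *)
have key a b : (forall x, rho x ^+ 2 <= E * t `^ (2 * a)) -> (nsq rho <= (E * t `^ (2 * b))%:E)%E ->
    ('N[mu]_p[EFin \o rho] <= (Num.sqrt E * t `^ (a * (1 - 2 * i) + b * (2 * i)))%:E)%E.
  have sq c : (Num.sqrt E * t `^ c) ^+ 2 = E * t `^ (2 * c).
    by rewrite exprMn sqr_sqrtr // -powR_mulrn ?powR_ge0 // -powRrM [2 * c]mulrC.
  move=> hs hq; have P c : 0 <= Num.sqrt E * t `^ c by rewrite mulr_ge0 ?powR_ge0.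
  have := @Lnorm_interpolation p rho (Num.sqrt E * t `^ a) (Num.sqrt E * t `^ b) p2 mrho (P b).
  rewrite sq => /(_ _ hq); rewrite -/i => h; apply: (le_trans (h _)).
    move=> x; rewrite rho0 -ler_sqr ?nnegrE ?P ?rho0 // sq; exact: hs.
  rewrite lee_fin !powRM ?powR_ge0 // -!powRrM [t `^ (_ + _)]powRD; last first.
    by rewrite (gt_eqF t0) implybT.
  have hE : Num.sqrt E `^ (1 - 2 * i) * Num.sqrt E `^ (2 * i) = Num.sqrt E.
    by rewrite -powRD subrK ?oner_eq0 // powRr1.
  by rewrite mulrACA hE.
have mono x y : t <= 1 -> x >= y -> t `^ x <= t `^ y.
  move=> t1 xy; rewrite /powR gt_eqF // ler_expR ler_wnM2r // ln_le0 //.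
have tV : t^-1 = t `^ (2 * (- 2^-1)) by rewrite mulrN mulfV // powR_inv1 // ltW.
have tV2 : t^-1 / Num.sqrt t = t `^ (2 * (- (3 / 4))).
  rewrite -powR12_sqrt ?ltW // -powRN -[t^-1]powR_inv1 ?ltW // -powRD ?(gt_eqF t0) ?implybT //.
  by congr (_ `^ _); field.
(* The exponent obtained is [- 1/2 + i] for [t <= 1], at least the target since [beta >= 0]; for
   [t > 1] it is [- 3/4 + i / 2], at most the target exactly when [beta <= 1/2 + i]. *)
have [t1|t1] := leP t 1.
  apply: (le_trans (key (- 2^-1) 0 _ _)).
  - by move=> x; rewrite -tV.
  - by rewrite mulr0 powRr0 mulr1.
  - by rewrite lee_fin ler_wpM2l // mono //; lra.
apply: (le_trans (key (- (3 / 4)) (- 2^-1) _ _)).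
- by move=> x; rewrite -tV2.
- by rewrite -tV.
- by rewrite lee_fin ler_wpM2l // ler_powR ?(ltW t1) //; lra.
Qed.

End Interpolation.

(** * Removing the truncation *)

Section Limit.
Context {R : realType}.
Local Notation mu := (@lebesgue_measure R).
Local Notation L1 f := (mu.-integrable setT (EFin \o f)).
Local Notation I f := (Rintegral mu setT f).
Local Notation Re := complex.Re.
Local Notation Im := complex.Im.
Implicit Types (u v g phi : R -> R[i]).

Definition truncate n phi xi : R[i] := (ind (- n%:R) n%:R xi)%:C * phi xi.

Lemma truncate_sqr (f : R -> R) A : L2le f A ->
  exists a : nat -> R, [/\ forall n, 0 <= a n, a n @[n --> \oo] --> (0 : R) &
    forall n, L2le (fun xi => ind (- n%:R) n%:R xi * f xi - f xi) (a n)].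
Proof.
move=> hf; have [l _] := L2le_sqr hf; have [mf _] := hf.
have md n : measurable_fun setT (fun xi => ind (- n%:R) n%:R xi * f xi - f xi).
  by apply: measurable_funB => //; apply: measurable_funM => //; exact: measurable_ind.
have le n xi : `|(ind (- n%:R) n%:R xi * f xi - f xi) ^+ 2| <= f xi ^+ 2.
  rewrite ger0_norm ?sqr_ge0 // /ind.
  by case: (_ <= _ <= _); rewrite ?mul1r ?mul0r ?subrr ?expr0n ?sqr_ge0 // sub0r sqrrN.
have ld n : L1 (fun xi => (ind (- n%:R) n%:R xi * f xi - f xi) ^+ 2).
  by apply: (L1_le _ (le n) l); exact: measurable_funX.
exists (fun n => I (fun xi => (ind (- n%:R) n%:R xi * f xi - f xi) ^+ 2)); split.
- by move=> n; apply: Rintegral_ge0 => x _; exact: sqr_ge0.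
- have -> : (0 : R) = I (fun _ : R => (0 : R)) by rewrite /Rintegral integral0.
  apply: (I_dominated (g := fun xi => f xi ^+ 2)) => //.
    by move=> n; exact: measurable_funX.
  move=> x; apply/cvgr0Pnorm_le => e e0; near=> n.
  have h : `|x| <= n%:R by near: n; exact: nbhs_infty_ger.
  by move: h; rewrite ler_norml /ind => ->; rewrite mul1r subrr expr0n normr0 ltW.
- by move=> n; apply: L2le_I.
Unshelve. all: end_near. Qed.

Lemma truncate_cvg phi : L2 phi ->
  n2 (fun xi => truncate n phi xi - phi xi) @[n --> \oo] --> (0 : R).
Proof.
move=> /L2_L2le[hr hi].
have [a [a0 ca ha]] := truncate_sqr hr; have [b [b0 cb hb]] := truncate_sqr hi.
apply: (@squeeze_cvgr _ _ _ _ (fun=> 0) (fun n => Num.sqrt (a n + b n))).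
- apply: nearW => n; rewrite n2_ge0 /=; apply: n2_le.
    by under eq_fun do rewrite ReD ReN ReM /= mul0r subr0; exact: ha.
  by under eq_fun do rewrite ImD ImN ImM /= mul0r addr0; exact: hb.
- exact: cvg_cst.
- rewrite -[X in _ --> X]sqrtr0.
  apply: (@cvg_comp _ _ _ (fun n => a n + b n) (@Num.sqrt R)); last exact: sqrt_continuous.
  by rewrite -[0]addr0; exact: cvgD.
Qed.

(** The approximants [psi] that define [g] are arbitrary, so they are compared with the truncations
    of [phi] through the boundedness of the transform. The isometry [U t] carries the comparison to
    time [t], and the L^2 limit agrees almost everywhere with the pointwise limit. *)
Lemma U_limit q U phi g t (G1 G2 : R -> R) : unitary_group_of (delta_hamiltonian q) U ->
  distorted_ift q phi g -> (forall n, ccpt (truncate n phi)) ->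
  (forall x, Re (distorted_ift_integral q (evolve t (truncate n phi)) x) @[n --> \oo] --> G1 x) ->
  (forall x, Im (distorted_ift_integral q (evolve t (truncate n phi)) x) @[n --> \oo] --> G2 x) ->
  U t g = (fun x => G1 x +i* G2 x) %[ae mu].
Proof.
move=> hU [hphi hg [psi [hpsi cpsi cTpsi]]] ct c1 c2.
have [C C0 hC] := n2_distorted_ift q.
pose T := distorted_ift_integral q; pose w n := T (evolve t (truncate n phi)).
have hUg : L2 (U t g) by exact (U_L2 hU t hg).
have hw n : L2 (w n) by apply: ccpt_T; exact: ccpt_evolve.
have {}cpsi : n2 (fun xi => psi n xi - phi xi) @[n --> \oo] --> (0 : R).
  by move/fine_cvgP : cpsi => -[].
have {}cTpsi : n2 (fun x => T (psi n) x - g x) @[n --> \oo] --> (0 : R).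
  by move/fine_cvgP : cTpsi => -[].
have le n : n2 (fun x => w n x - U t g x) <=
    C * (n2 (fun xi => truncate n phi xi - phi xi) + n2 (fun xi => psi n xi - phi xi)) +
    n2 (fun x => T (psi n) x - g x).
  have [hp lp] := hpsi n; have cn := ct n.
  have hn := ccpt_L2 cn; have hTn := ccpt_T q cn; have [hTp _] := hC _ hp lp.
  apply: (le_trans (n2_triangle (hw n) (U_L2 hU t hTn) hUg)).
  rewrite (U_evolve hU t cn) add0r (U_dist hU t hTn hg).
  apply: (le_trans (n2_triangle hTn hTp hg)); rewrite lerD2r.
  have -> : (fun x => T (truncate n phi) x - T (psi n) x) =
      T (fun xi => -1 * psi n xi + truncate n phi xi).
    apply/funext => x; rewrite /T distorted_iftD //; last exact: ccpt_cintegrable.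
    by rewrite mulN1r addrC.
  have h1 : L2 (fun xi => -1 * psi n xi + truncate n phi xi) by apply: L2D => //; exact: L2Z.
  have h2 : cintegrable (fun xi => -1 * psi n xi + truncate n phi xi).
    by apply: cintegrableD; [exact: cintegrableZ|exact: ccpt_cintegrable].
  apply: (le_trans (hC _ h1 h2).2); rewrite ler_wpM2l //.
  rewrite [X in _ <= _ + X]n2B //.
  have -> : (fun xi => -1 * psi n xi + truncate n phi xi) = (fun xi => truncate n phi xi - psi n xi).
    by apply/funext => xi; rewrite mulN1r addrC.
  exact: n2_triangle.
have cw : n2 (fun x => w n x - U t g x) @[n --> \oo] --> (0 : R).
  apply: (@squeeze_cvgr _ _ _ _ (fun=> 0) (fun n =>
    C * (n2 (fun xi => truncate n phi xi - phi xi) + n2 (fun xi => psi n xi - phi xi)) +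
    n2 (fun x => T (psi n) x - g x))).
  - by apply: nearW => n; rewrite n2_ge0 le.
  - exact: cvg_cst.
  - rewrite -[X in _ --> X](addr0 0); apply: cvgD => //.
    rewrite -[X in _ --> X](mulr0 C); apply: cvgM; first exact: cvg_cst.
    by rewrite -[X in _ --> X](addr0 0); apply: cvgD => //; exact: truncate_cvg.
pose d x := (G1 x +i* G2 x) - U t g x.
(* Fatou's lemma along the tail of the sequence, shifted by [n0] so that every term is within
   [e]. *)
have hd e : 0 < e -> L2le (fun x => Re (d x)) (e ^+ 2) /\ L2le (fun x => Im (d x)) (e ^+ 2).
  move=> e0; have [n0 _ hn] : \forall n \near \oo, n2 (fun x => w n x - U t g x) <= e.
    have /cvgr0Pnorm_le/(_ e e0) := cw; apply: filterS => n; exact: le_trans (ler_norm _).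
  have hc n : L2le (fun x => Re (w (n + n0)%N x - U t g x)) (e ^+ 2) /\
      L2le (fun x => Im (w (n + n0)%N x - U t g x)) (e ^+ 2).
    have hwn := L2B (hw (n + n0)%N) hUg.
    apply: Lpnorm_L2le; [by case: hwn|exact: ltW|].
    by rewrite n2E // lee_fin; apply: hn => /=; rewrite leq_addl.
  split.
    apply: (L2le_fatou (fun n => (hc n).1)) => x.
    under eq_fun do rewrite ReD ReN; rewrite /d ReD ReN /=.
    by apply: cvgB; [rewrite (cvg_shiftn n0 (fun n => Re (w n x))); exact: c1|exact: cvg_cst].
  apply: (L2le_fatou (fun n => (hc n).2)) => x.
  under eq_fun do rewrite ImD ImN; rewrite /d ImD ImN /=.
  by apply: cvgB; [rewrite (cvg_shiftn n0 (fun n => Im (w n x))); exact: c2|exact: cvg_cst].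
have L2d : L2 d by have [h1 h2] := hd 1 ltr01; exact: (L2_of_L2le h1 h2).
have d0 : n2 d = 0.
  apply/eqP; rewrite eq_le n2_ge0 andbT; apply/ler_addgt0Pr => e e0; rewrite add0r.
  (* Halving covers the real and imaginary parts together: [2 (e / 2)^2 <= e^2]. *)
  have e2 : 0 < e / 2 by rewrite divr_gt0.
  have [h1 h2] := hd _ e2; apply: (le_trans (n2_le h1 h2)).
  rewrite -[X in _ <= X](ger0_norm (ltW e0)) -sqrtr_sqr ler_sqrt ?sqr_ge0 //.
  by have := sqr_ge0 e; lra.
apply: aeS (n2_eq0 L2d d0) => x /= h /h /eqP.
by rewrite /d /cst /= subr_eq0 => /eqP.
Qed.

End Limit.

(** * Cancellation of the main term *)

Section Remainder.
Context {R : realType}.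
Local Notation mu := (@lebesgue_measure R).
Local Notation I f := (Rintegral mu setT f).
Local Notation Re := complex.Re.
Local Notation Im := complex.Im.
Local Notation normc := ComplexField.Normc.normc.
Local Notation N := ((Num.sqrt (2 * pi))^-1 : R).
Implicit Types (u v g phi dphi : R -> R[i]) (a b x A M t : R).

(** [phi] is its own continuous representative, so [weak_ftc] applies to each component. *)
Lemma weak_derivative_h1 phi dphi M : L2 phi -> L2 dphi -> weak_derivative setT phi dphi ->
  continuous (phi : R -> R[i]^o) -> n2 phi <= M -> n2 dphi <= M ->
  H1fun (fun x => Re (phi x)) (fun x => Re (dphi x)) (M ^+ 2) (M ^+ 2) /\
  H1fun (fun x => Im (phi x)) (fun x => Im (dphi x)) (M ^+ 2) (M ^+ 2).
Proof.
move=> hphi hdphi wd cphi h1 h2.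
have sq a b : 0 <= a -> a <= b -> a ^+ 2 <= b ^+ 2.
  by move=> a0 ab; rewrite ler_sqr ?nnegrE ?(le_trans a0).
have W u f : n2 u <= M -> L2le f (n2 u ^+ 2) -> L2le f (M ^+ 2).
  by move=> uM; apply: L2leW; apply: sq => //; exact: n2_ge0.
have [/(W _ _ h1) fr /(W _ _ h1) fi] := L2_L2le hphi.
have [/(W _ _ h2) dr /(W _ _ h2) di] := L2_L2le hdphi.
have [cr ci] := continuous_ReIm cphi.
have ReR (u : R -> R[i]) (e : R -> R) :
    (fun x => Re (u x * (e x)%:C)) = (fun x => Re (u x) * e x).
  by apply/funext => x; rewrite ReM /= mulr0 subr0.
have ImR (u : R -> R[i]) (e : R -> R) :
    (fun x => Im (u x * (e x)%:C)) = (fun x => Im (u x) * e x).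
  by apply/funext => x; rewrite ImM /= mulr0 add0r.
split; split => //.
  apply: (weak_ftc cr dr) => eta te; have /(congr1 (@complex.Re R)) := wd eta te.
  by rewrite ReN /= !ReR.
apply: (weak_ftc ci di) => eta te; have /(congr1 (@complex.Im R)) := wd eta te.
by rewrite ImN /= !ImR.
Qed.

(** Both values are written with the constants of the transform and of the Fresnel integral, so that
    the main term cancels by ring arithmetic. *)
Lemma trigo_pi4 : cos (pi / 4) = N * Num.sqrt pi /\ sin (pi / 4) = N * Num.sqrt pi.
Proof.
have cs : cos (pi / 4) = sin (pi / 4) :> R.
  have -> : pi / 4 = pi / 2 - pi / 4 :> R by field.
  rewrite [LHS]cosB cos_pihalf sin_pihalf mul0r add0r mul1r; congr sin; by field.
have s0 : 0 <= sin (pi / 4) :> R.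
  apply: sin_ge0_pi; have := pi_ge0 R => pi0; apply/andP; split; lra.
have e : sin (pi / 4) = N * Num.sqrt pi.
  apply/eqP; rewrite -(@eqrXn2 _ 2) // ?mulr_ge0 ?invr_ge0 ?sqrtr_ge0 //.
  rewrite exprMn exprVn !sqr_sqrtr ?mulr_ge0 ?pi_ge0 //.
  have := cos2Dsin2 (pi / 4 : R); rewrite cs.
  have pin : pi != 0 :> R by rewrite gt_eqF // pi_gt0.
  have -> : (2 * pi)^-1 * pi = 2^-1 :> R by rewrite invfM -mulrA mulVf // mulr1.
  by move=> h; apply/eqP; lra.
by rewrite cs e.
Qed.

Lemma truncate_ccpt n phi M : cmeasurable phi -> (forall x, normc (phi x) <= M) ->
  ccpt (truncate n phi).
Proof.
move=> [mr mi] hM; have M0 : 0 <= M := le_trans (normc_ge0 _) (hM 0).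
have P (f : R -> R) : measurable_fun setT f -> (forall x, `|f x| <= M) ->
    cpt (fun x => ind (- n%:R) n%:R x * f x).
  move=> mf fM; split; first by apply: measurable_funM => //; exact: measurable_ind.
  exists n%:R, M; split => // x.
  by rewrite normrM mulrC (ger0_norm (ind_ge0 _ _ _)) ler_wpM2r ?ind_ge0.
split.
  rewrite /truncate; under eq_fun do rewrite ReM /= mul0r subr0.
  by apply: P => // x; apply: le_trans (hM x); exact: Re_le_normc.
rewrite /truncate; under eq_fun do rewrite ImM /= mul0r addr0.
by apply: P => // x; apply: le_trans (hM x); exact: Im_le_normc.
Qed.

Lemma evolve_truncate t n phi :
  (fun xi => Re (evolve t (truncate n phi) xi)) =
    ev1 t n (fun xi => Re (phi xi)) (fun xi => Im (phi xi)) /\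
  (fun xi => Im (evolve t (truncate n phi) xi)) =
    ev2 t n (fun xi => Re (phi xi)) (fun xi => Im (phi xi)).
Proof.
split; apply/funext => xi; rewrite /evolve /truncate /ev1 /ev2 !reim /= cosN sinN.
  ring.
ring.
Qed.

(** Since [sqrt pi (1 - i) z] is [sqrt (2 pi) exp (- i pi / 4) z], the main term cancels exactly,
    and what remains is the error [w] times a factor of modulus [N / sqrt t]. *)
Lemma remainderE t x (z w : R[i]) : 0 < t ->
  let th := x ^+ 2 / (2 * t) in
  let a := Num.sqrt pi * (Re z + Im z) + Re w in
  let b := Num.sqrt pi * (Im z - Re z) + Im w in
  (N * ((Num.sqrt t)^-1 * (cos th * a - sin th * b)) +i*
   (N * ((Num.sqrt t)^-1 * (sin th * a + cos th * b)))) -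
  (t `^ (- 2^-1))%:C * z * expi (th - pi / 4) =
  (N * (Num.sqrt t)^-1)%:C * (expi th * w).
Proof.
move=> t0 th a b; have [c4 s4] := trigo_pi4.
rewrite powRN powR12_sqrt ?(ltW t0) // /a /b.
by apply: complex_eqP; rewrite !reim /= cosB sinB c4 s4; ring.
Qed.

End Remainder.

Theorem proposition3p1 (R : realType) (q : R) (p : \bar R) (beta : R)
    (hq : 0 <= q) (hp : admissible_exponents p beta) :
  exists C : R, 0 < C /\
    forall U : R -> (R -> R[i]) -> (R -> R[i]),
      unitary_group_of (delta_hamiltonian q) U ->
    forall phi dphi g : R -> R[i],
      L2 phi -> L2 dphi -> weak_derivative setT phi dphi ->
      continuous (phi : R -> R[i]^o) -> phi 0 = 0 ->
      distorted_ift q phi g ->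
    forall t : R, 0 < t ->
    let Rem : R -> R[i] := fun x =>
      U t g x - (t `^ (- 2^-1))%:C * phi (x / t)
                * expi (x ^+ 2 / (2 * t) - pi / 4) in
    (Lpnorm p Rem <=
       (C * t `^ decay_exponent p beta)%:E
       * (Lpnorm 2%:E phi + Lpnorm 2%:E dphi))%E.
Proof.
have [D D0 hD] := distorted_asymptotics hq.
pose N : R := (Num.sqrt (2 * pi))^-1.
have N0 : 0 < N by rewrite invr_gt0 sqrtr_gt0 mulr_gt0 // pi_gt0.
(* The squared modulus of the remainder is [N^2 / t * (e1^2 + e2^2)], and each of the two squares
   contributes at most [D * M^2] up to a power of [t]. *)
exists (Num.sqrt (2 * N ^+ 2 * D)); split.
  by rewrite sqrtr_gt0 !mulr_gt0 // exprn_gt0.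
move=> U hU phi dphi g hphi hdphi wd cphi phi0 hg t t0.
pose Rem x : R[i] := U t g x -
  (t `^ (- 2^-1))%:C * phi (x / t) * expi (x ^+ 2 / (2 * t) - pi / 4).
change (is_true (Lpnorm p Rem <= (Num.sqrt (2 * N ^+ 2 * D) * t `^ decay_exponent p beta)%:E *
  (Lpnorm 2%:E phi + Lpnorm 2%:E dphi))%E).
(* One number bounds both norms, so [M ^+ 2] is the common parameter of all H^1 bounds. *)
pose M := n2 phi + n2 dphi; have M0 : 0 <= M by rewrite addr_ge0 ?n2_ge0.
have [hr hi] : H1fun (fun x => complex.Re (phi x)) (fun x => complex.Re (dphi x))
      (M ^+ 2) (M ^+ 2) /\
    H1fun (fun x => complex.Im (phi x)) (fun x => complex.Im (dphi x)) (M ^+ 2) (M ^+ 2).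
  by apply: weak_derivative_h1 => //; rewrite /M ?lerDl ?lerDr n2_ge0.
have r0 : complex.Re (phi 0) = 0 by rewrite phi0.
have i0 : complex.Im (phi 0) = 0 by rewrite phi0.
have [e1 [e2 [lim [a1 a2] [b1 b2] c d]]] := hD t t0 _ _ _ _ _ hr hi r0 i0.
pose e x : R[i] := e1 x +i* e2 x.
have [mphi _] := hphi.
have ct n : ccpt (truncate n phi).
  pose s := Num.sqrt (2 * M ^+ 2 + 2 * M ^+ 2).
  apply: (@truncate_ccpt _ n phi (s + s)) => // x.
  by apply: (le_trans (normc_le_norm _)); apply: lerD;
    [exact: (h1_bounded x hr)|exact: (h1_bounded x hi)].
have st0 : 0 < Num.sqrt t by rewrite sqrtr_gt0.
pose Rem0 x : R[i] := (N * (Num.sqrt t)^-1)%:C * (expi (x ^+ 2 / (2 * t)) * e x).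
pose th x : R := x ^+ 2 / (2 * t).
pose a x : R := Num.sqrt pi * (complex.Re (phi (x / t)) + complex.Im (phi (x / t))) + e1 x.
pose b x : R := Num.sqrt pi * (complex.Im (phi (x / t)) - complex.Re (phi (x / t))) + e2 x.
(* [U t g] is determined only almost everywhere; [Rem0] is an explicit representative of the
   remainder, to which pointwise bounds apply. *)
have RemE : Rem = Rem0 %[ae lebesgue_measure].
  have E n x : distorted_ift_integral q (evolve t (truncate n phi)) x =
      DR q (ev1 t n (fun x => complex.Re (phi x)) (fun x => complex.Im (phi x)))
           (ev2 t n (fun x => complex.Re (phi x)) (fun x => complex.Im (phi x))) x +i*
      DI q (ev1 t n (fun x => complex.Re (phi x)) (fun x => complex.Im (phi x)))
           (ev2 t n (fun x => complex.Re (phi x)) (fun x => complex.Im (phi x))) x.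
    rewrite (distorted_iftE q x (ccpt_cintegrable (ccpt_evolve t (ct n)))).2.
    by have [-> ->] := evolve_truncate t n phi.
  have := @U_limit R q U phi g t
    (fun x => N * ((Num.sqrt t)^-1 * (cos (th x) * a x - sin (th x) * b x)))
    (fun x => N * ((Num.sqrt t)^-1 * (sin (th x) * a x + cos (th x) * b x))) hU hg ct.
  move=> H; have {}H := H _ _; apply: aeS (H _ _) => [x hx /hx h|x|x].
  - rewrite /Rem h; exact: (remainderE x (phi (x / t)) (e x) t0).
  - by under eq_fun do rewrite E /=; exact: (lim x).1.
  - by under eq_fun do rewrite E /=; exact: (lim x).2.
have me : cmeasurable e by split; [case: a1|case: a2].
have mth r : measurable_fun setT (fun x : R => x ^+ 2 / (2 * t) - r).
  by apply: measurable_funB => //; apply: measurable_funM => //; exact: measurable_funX.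
have mexp r : cmeasurable (fun x : R => expi (x ^+ 2 / (2 * t) - r)).
  by split; [exact: (measurableT_comp (@measurable_cos R))|
    exact: (measurableT_comp (@measurable_sin R))].
have mRem0 : cmeasurable Rem0.
  apply: cmeasurableM; first exact: cmeasurable_cst.
  by apply: cmeasurableM => //; have := mexp 0; under eq_fun do rewrite subr0.
have mRem : cmeasurable Rem.
  have [_ hLg _] := hg; have [mU _] := U_L2 hU t hLg.
  have mphit : cmeasurable (fun x => phi (x / t)).
    have md : measurable_fun setT (fun x : R => x / t) by exact: measurable_funM.
    by case: mphi => m1 m2; split; [exact: (measurableT_comp m1)|exact: (measurableT_comp m2)].
  have -> : Rem = fun x => U t g x + (- (t `^ (- 2^-1))%:C * phi (x / t)) *
      expi (x ^+ 2 / (2 * t) - pi / 4).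
    by apply/funext => x; rewrite /Rem !mulNr.
  by apply: cmeasurableD => //; apply: cmeasurableM => //; apply: cmeasurableM.
have p2 : (2%:E <= p)%E by case: hp.
rewrite (Lpnorm_ae _ mRem mRem0 RemE); last by apply: lt_le_trans p2; rewrite lte_fin.
rewrite (n2E hphi) (n2E hdphi) -EFinD -EFinM -/M.
pose k := N * (Num.sqrt t)^-1.
have k0 : 0 <= k by rewrite mulr_ge0 ?invr_ge0 ?sqrtr_ge0 // ltW.
have k2 : k ^+ 2 = N ^+ 2 * t^-1 by rewrite exprMn; congr (_ * _); rewrite exprVn (sqr_sqrtr (ltW t0)).
pose rho x := ComplexField.Normc.normc (Rem0 x).
have rhoE x : rho x = k * ComplexField.Normc.normc (e x).
  rewrite /rho /Rem0 ComplexField.Normc.normcM normcR ger0_norm //.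
  by rewrite ComplexField.Normc.normcM normc_expi mul1r.
have rho2 x : rho x ^+ 2 = N ^+ 2 * t^-1 * (e1 x ^+ 2 + e2 x ^+ 2).
  by rewrite rhoE exprMn k2 normc_sqr.
pose E := 2 * N ^+ 2 * D * M ^+ 2.
have N2 : 0 < N ^+ 2 by rewrite exprn_gt0.
have E0 : 0 <= E by rewrite /E !mulr_ge0 ?sqr_ge0 // ltW.
have mrho : measurable_fun setT rho by exact: measurable_normc.
have sup u : (forall x, e1 x ^+ 2 <= u /\ e2 x ^+ 2 <= u) ->
    forall x, rho x ^+ 2 <= N ^+ 2 * t^-1 * (u + u).
  move=> hu x; have [h1 h2] := hu x; rewrite rho2 ler_wpM2l ?lerD //.
  by rewrite mulr_ge0 ?invr_ge0 // ltW.
have int u : L2le e1 u -> L2le e2 u -> L2le rho (N ^+ 2 * t^-1 * (u + u)).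
  move=> h1 h2; rewrite -k2 (_ : rho = fun x => k * ComplexField.Normc.normc (e x)); last first.
    by apply/funext.
  apply: L2leZ; split; first exact: measurable_normc.
  by rewrite nsq_normc // EFinD; apply: leeD; [case: h1|case: h2].
(* The bounds [c], [d], [b], [a] on the errors supply its four hypotheses in this order; the factor
   [t^-1] in the square of [Rem0] makes the bound [D * (t * A)] independent of [t]. *)
have := @Lnorm_decay R p beta t rho E hp t0 mrho E0 (fun x => normc_ge0 _) _ _ _ _.
have -> : Num.sqrt E = Num.sqrt (2 * N ^+ 2 * D) * M.
  by rewrite /E sqrtrM ?sqrtr_sqr ?ger0_norm // !mulr_ge0 // ltW.
move=> h; rewrite (mulrAC _ _ M); apply: h.
- move=> x; apply: le_trans (sup _ c x) _; rewrite /E le_eqVlt; apply/orP; left; apply/eqP; ring.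
- move=> x; apply: le_trans (sup _ d x) _; rewrite /E le_eqVlt; apply/orP; left; apply/eqP; ring.
- apply: L2leW (int _ b1 b2); rewrite /E le_eqVlt; apply/orP; left; apply/eqP; field.
  exact: lt0r_neq0.
- apply: L2leW (int _ a1 a2); rewrite /E le_eqVlt; apply/orP; left; apply/eqP; ring.
Qed.
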